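(* Let $N=3$, $m_0(z)=\frac{1+z^2}{\sqrt2}$, and consider on $\mathcal{S}_3$ the Borel probability measure $m$ whose Fourier coefficients $\hat m(\lambda)=\int_{\mathcal{S}_3}\chi_\lambda\,dm$, $\lambda\in\mathbb{Z}[1/3]$, are $$\hat m(\lambda)=\begin{cases}2^{-(|d_0|+\dots+|d_p|)/2},&\text{if }\lambda=\sum_{k=0}^{p}\frac{d_k}{3^{k+1}}\text{ for some } p\ge 0 \text{ and } d_k\in\{-2,0,2\},\\ 0,&\text{otherwise.}\end{cases}$$ There is a unique isomorphism (unitary operator) $\mathcal{F}_3$ from $L^2(\mathcal{R},\mathcal{H}^s)$ to $L^2(\mathcal{S}_3,m)$ such that for all $f\in L^2(\mathcal{S}_3,m)$ $$\mathcal{F}_3T_\lambda\mathcal{F}_3^{-1}f=\chi_\lambda f\quad(\lambda\in\mathbb{Z}[1/3]),\qquad \mathcal{F}_3U\mathcal{F}_3^{-1}f=m_0\,(f\circ S),\qquad \mathcal{F}_3\chi_{\mathbf{C}}=1.$$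
   Context: $\mathcal{R}$ is the set of all real numbers that have a base-3 expansion containing only finitely many $1$'s; $\mathcal{H}^s$ is the Hausdorff measure of dimension $s=\log_32$ restricted to $\mathcal{R}$, with the standard normalization for which the triadic Cantor set $\mathbf{C}$ has $\mathcal{H}^s(\mathbf{C})=1$; $\chi_{\mathbf{C}}$ is the indicator function of $\mathbf{C}$. On $L^2(\mathcal{R},\mathcal{H}^s)$: $Uf(x)=\frac{1}{\sqrt2}f(x/3)$ and $T_\lambda f(x)=f(x-\lambda)$ for $\lambda\in\mathbb{Z}[1/3]$ (these are unitary). $\mathcal{S}_3=\{(z_n)_{n\in\mathbb{Z}}\mid z_{n+1}^3=z_n,\ |z_n|=1\}$, $S(z_n)_n=(z_{n-1})_n$; for $\lambda=k/3^p\in\mathbb{Z}[1/3]$, $\chi_\lambda((z_n)_n)=z_p^k$; $m_0$ is viewed as the function $(z_n)_n\mapsto m_0(z_0)$ on $\mathcal{S}_3$. *)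

(* Defs.v *)
From HB Require Import structures.
From mathcomp Require Import all_boot all_order all_algebra.
From mathcomp Require Import all_classical all_reals all_analysis.
From mathcomp Require Import measurable_realfun complex lra.

Set Implicit Arguments.
Unset Strict Implicit.
Unset Printing Implicit Defensive.

Import Order.TTheory GRing.Theory Num.Theory.
Import numFieldNormedType.Exports.
Import ComplexField.Normc.

Local Open Scope classical_set_scope.
Local Open Scope complex_scope.
Local Open Scope ring_scope.

Local Notation Re := complex.Re.
Local Notation Im := complex.Im.

Section L2.
Context d (T : measurableType d) (R : realType).
Variable mu : {measure set T -> \bar R}.

Definition cmeasurable (f : T -> R[i]) :=
  measurable_fun setT (fun x => Re (f x)) /\
  measurable_fun setT (fun x => Im (f x)).

Definition cintegral (f : T -> R[i]) : R[i] :=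
  Rintegral mu setT (fun x => Re (f x)) +i* Rintegral mu setT (fun x => Im (f x)).

Definition sqr_norm (f : T -> R[i]) (x : T) : R := normc (f x) ^+ 2.

Definition square_integrable (f : T -> R[i]) :=
  cmeasurable f /\ (\int[mu]_x (sqr_norm f x)%:E < +oo)%E.

Definition L2pred : {pred T -> R[i]} := fun f => `[< square_integrable f >].

Lemma normc_sqr (z : R[i]) : normc z ^+ 2 = Re z ^+ 2 + Im z ^+ 2.
Proof. by case: z => a b /=; rewrite sqr_sqrtr// addr_ge0// sqr_ge0. Qed.

Lemma L2pred_submod_closed : submod_closed L2pred.
Proof.
split.
  apply/asboolP; split.
    by split => /=; exact: measurable_cst.
  rewrite integral0_eq ?ltry// => x _.
  by rewrite /sqr_norm normc_sqr /= expr0n addr0.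
move=> a f g /asboolP[[mfr mfi] fI] /asboolP[[mgr mgi] gI].
have ReE x : Re ((a *: f + g) x) = Re a * Re (f x) - Im a * Im (f x) + Re (g x).
  have -> : (a *: f + g) x = a * f x + g x by [].
  by case: a (f x) (g x) => [? ?] [? ?] [? ?].
have ImE x : Im ((a *: f + g) x) = Re a * Im (f x) + Im a * Re (f x) + Im (g x).
  have -> : (a *: f + g) x = a * f x + g x by [].
  by case: {ReE} a (f x) (g x) => [? ?] [? ?] [? ?].
have mh (h : T -> R[i]) : measurable_fun setT (fun x => Re (h x)) ->
    measurable_fun setT (fun x => Im (h x)) ->
    measurable_fun setT (EFin \o sqr_norm h).
  move=> m1 m2; apply/measurable_EFinP.
  rewrite (_ : sqr_norm h =
    (fun x => Re (h x) ^+ 2 + Im (h x) ^+ 2)); last first.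
    by apply/funext => x; exact: normc_sqr.
  by apply: measurable_funD; apply: measurable_funX.
have mr : measurable_fun setT (fun x => Re ((a *: f + g) x)).
  rewrite (_ : (fun _ => _) =
    (fun x => Re a * Re (f x) - Im a * Im (f x) + Re (g x))); last exact/funext.
  apply: measurable_funD => //; apply: measurable_funB; exact: measurable_funM.
have mi : measurable_fun setT (fun x => Im ((a *: f + g) x)).
  rewrite (_ : (fun _ => _) =
    (fun x => Re a * Im (f x) + Im a * Re (f x) + Im (g x))); last exact/funext.
  apply: measurable_funD => //; apply: measurable_funD; exact: measurable_funM.
apply/asboolP; split; first by split.
pose c : R := 2 * normc a ^+ 2.
have c0 : 0 <= c by rewrite mulr_ge0// sqr_ge0.
apply: (@le_lt_trans _ _ (c%:E * (\int[mu]_x (sqr_norm f x)%:E) +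
    2%:E * \int[mu]_x (sqr_norm g x)%:E)%E); last first.
  by rewrite lte_add_pinfty// lte_mul_pinfty// lee_fin.
rewrite -!ge0_integralZl_EFin//; last 4 first.
- by move=> x _; rewrite lee_fin sqr_ge0.
- exact: mh.
- by move=> x _; rewrite lee_fin sqr_ge0.
- exact: mh.
rewrite -ge0_integralD//; last 4 first.
- by move=> x _; rewrite -EFinM lee_fin mulr_ge0// sqr_ge0.
- by apply: measurable_funeM; exact: mh.
- by move=> x _; rewrite -EFinM lee_fin mulr_ge0// sqr_ge0.
- by apply: measurable_funeM; exact: mh.
apply: ge0_le_integral => //.
- by move=> x _; rewrite lee_fin sqr_ge0.
- exact: mh.
- by apply: emeasurable_funD; apply: measurable_funeM; exact: mh.
move=> x _; rewrite -!EFinM -EFinD lee_fin /sqr_norm !normc_sqr ReE ImE /c normc_sqr.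
move: (Re a) (Im a) (Re (f x)) (Im (f x)) (Re (g x)) (Im (g x)) => p q u v s t.
have := sqr_ge0 (p * u - q * v - s); have := sqr_ge0 (p * v + q * u - t).
nra.
Qed.

HB.instance Definition _ :=
  GRing.isSubmodClosed.Build R[i] (T -> R[i]) L2pred L2pred_submod_closed.

Record L2fun := MkL2fun { L2fun_val :> T -> R[i]; _ : L2fun_val \in L2pred }.
HB.instance Definition _ := [isSub for L2fun_val].
HB.instance Definition _ := [Choice of L2fun by <:].
HB.instance Definition _ := [SubChoice_isSubLmodule of L2fun by <:].

Definition L2null : {pred L2fun} :=
  fun f => `[< {ae mu, forall x, f x = 0} >].

Lemma L2null_zmod_closed : zmod_closed L2null.
Proof.
split; first by apply/asboolP; apply: aeW.
move=> f g /asboolP f0 /asboolP g0; apply/asboolP.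
apply: filterS2 f0 g0 => x fx gx.
have -> : (f - g) x = f x - g x by [].
by rewrite fx gx subr0.
Qed.

HB.instance Definition _ :=
  GRing.isZmodClosed.Build L2fun L2null L2null_zmod_closed.

Definition L2 := Quotient.quot L2null.
HB.instance Definition _ := GRing.Zmodule.on L2.
HB.instance Definition _ := EqQuotient.on L2.

Local Open Scope quotient_scope.

Definition L2scale (a : R[i]) (u : L2) : L2 := \pi_L2 (a *: repr u).

Lemma pi_scale (a : R[i]) (f : L2fun) : L2scale a (\pi_L2 f) = \pi_L2 (a *: f).
Proof.
rewrite /L2scale; apply/eqP; rewrite -Quotient.idealrBE -scalerBr.
have /eqP : repr (\pi_L2 f) = f %[mod L2] by rewrite reprK.
rewrite -Quotient.idealrBE => /asboolP h; apply/asboolP.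
apply: filterS h => x hx.
have -> : (a *: (repr (\pi_L2 f) - f)) x = a * ((repr (\pi_L2 f) - f) x) by [].
by rewrite hx mulr0.
Qed.

Lemma L2scaleA a b u : L2scale a (L2scale b u) = L2scale (a * b) u.
Proof. by rewrite -[u]reprK (pi_scale b) !pi_scale scalerA. Qed.

Lemma L2scale1 : left_id 1 L2scale.
Proof. by move=> u; rewrite -[u]reprK pi_scale scale1r. Qed.

Lemma pi_add : {morph \pi_L2 : f g / f + g}.
Proof. exact: Quotient.pi_add. Qed.

Lemma L2scaleDr : right_distributive L2scale +%R.
Proof.
by move=> a u v; rewrite -[u]reprK -[v]reprK -pi_add !pi_scale scalerDr pi_add.
Qed.

Lemma L2scaleDl u : {morph L2scale^~ u : a b / a + b}.
Proof. by move=> a b; rewrite -[u]reprK !pi_scale scalerDl pi_add. Qed.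

HB.instance Definition _ := GRing.Zmodule_isLmodule.Build R[i] L2
  L2scaleA L2scale1 L2scaleDr L2scaleDl.

(* [L2class f] is meaningful for square integrable [f] only; it is [0] for any
   other [f]. *)
Definition L2class (f : T -> R[i]) : L2 := \pi_L2 (insubd (0 : L2fun) f).

Definition L2repr (u : L2) : T -> R[i] := repr u.

Definition L2dot (u v : L2) : R[i] :=
  cintegral (fun x => L2repr u x * (L2repr v x)^*).

End L2.
Coercion L2repr : L2 >-> Funclass.

Definition unitary d1 d2 (T1 : measurableType d1) (T2 : measurableType d2)
    (R : realType) (mu : {measure set T1 -> \bar R})
    (nu : {measure set T2 -> \bar R}) (F : L2 mu -> L2 nu) :=
  [/\ linear F, bijective F & forall u v, L2dot (F u) (F v) = L2dot u v].

Section hausdorff.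
Context (R : realType).
Implicit Types (A B : set R) (U : (set R)^nat) (r a e : R).
Local Open Scope ereal_scope.

(* [0] is added so that the empty set has diameter [0] and not [-oo]. *)
Definition diameter A : \bar R :=
  ereal_sup (0 |` [set (`|x - y|%R)%:E | x in A & y in A]).

Variable s : R.

Definition hausdorff_pre (e : R) A : \bar R :=
  ereal_inf [set \sum_(k <oo) diameter (U k) `^ s | U in
    [set U : (set R)^nat |
      (forall k, diameter (U k) <= e%:E) /\ A `<=` \bigcup_k U k]].

Definition hausdorff A : \bar R :=
  ereal_sup [set hausdorff_pre e A | e in [set e | (0 < e)%R]].

Hypothesis s_gt0 : (0 < s)%R.

Lemma diameter0 : diameter set0 = 0.
Proof.
rewrite /diameter (_ : [set _ | _ in _ & _ in _] = set0) ?setU0 ?ereal_sup1//.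
by apply/seteqP; split=> // x [y []].
Qed.

Lemma diameter_ge0 A : 0 <= diameter A.
Proof. by apply: ereal_sup_ubound; left. Qed.

Lemma le_diameter x y A : A x -> A y -> (`|x - y|%R)%:E <= diameter A.
Proof. by move=> Ax Ay; apply: ereal_sup_ubound; right; exists x => //; exists y. Qed.

Let cost (e : R) A : \bar R :=
  if diameter A <= e%:E then diameter A `^ s else +oo.

Let cost_ge0 e A : 0 <= cost e A.
Proof. by rewrite /cost; case: ifP => // _; exact: poweR_ge0. Qed.

Let cost0 e : (0 < e)%R -> cost e set0 = 0.
Proof.
by move=> e0; rewrite /cost diameter0 lee_fin ltW// poweR0r// gt_eqF.
Qed.

(* every subset is measurable in [D], so that [mu_ext] ranges over all covers *)
Let D := g_sigma_algebraType [set: set R].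

Let hausdorff_preE e A : (0 < e)%R ->
  hausdorff_pre e A = mu_ext (cost e : set D -> \bar R) A.
Proof.
move=> e0; apply/eqP; rewrite eq_le; apply/andP; split.
  apply: le_ereal_inf_tmp => _ [U [_ AU] <-].
  have [h|] := pselect (forall k, diameter (U k) <= e%:E).
    apply: ereal_inf_lbound; exists U => //.
    by apply: eq_eseriesr => k _; rewrite /cost h.
  move/existsNP => [k /negP Uk].
  rewrite (@eseries_pinfty _ (cost e \o U) xpredT k) ?leey//.
    by move=> n _; rewrite -ltNye (lt_le_trans _ (cost_ge0 _ _)).
  by rewrite /= /cost (negbTE Uk).
apply: le_ereal_inf_tmp => _ [U [h AU] <-].
apply: ereal_inf_lbound; exists U.
  by split => // k; exact: sub_sigma_algebra.
by apply: eq_eseriesr => k _; rewrite /cost h.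
Qed.

Lemma hausdorff_pre_ge0 e A : 0 <= hausdorff_pre e A.
Proof.
apply: le_ereal_inf_tmp => _ [U _ <-].
by apply: nneseries_ge0 => k _ _; exact: poweR_ge0.
Qed.

Lemma hausdorff_pre_le_hausdorff e A :
  (0 < e)%R -> hausdorff_pre e A <= hausdorff A.
Proof. by move=> e0; apply: ereal_sup_ubound; exists e. Qed.

Lemma le_hausdorff_pre e e' A : (e' <= e)%R ->
  hausdorff_pre e A <= hausdorff_pre e' A.
Proof.
move=> ee'; apply: le_ereal_inf_tmp => _ [U [h AU] <-].
apply: ereal_inf_lbound; exists U => //; split => // k.
by rewrite (le_trans (h k))// lee_fin.
Qed.

Lemma hausdorff0 : hausdorff set0 = 0.
Proof.
apply/eqP; rewrite eq_le; apply/andP; split.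
  apply: ge_ereal_sup => _ [e /= e0 <-].
  by rewrite hausdorff_preE// mu_ext0//; exact: cost0.
by apply: le_trans (hausdorff_pre_le_hausdorff _ ltr01); exact: hausdorff_pre_ge0.
Qed.

Lemma hausdorff_ge0 A : 0 <= hausdorff A.
Proof.
by apply: le_trans (hausdorff_pre_le_hausdorff _ ltr01); exact: hausdorff_pre_ge0.
Qed.

Lemma le_hausdorff : {homo hausdorff : A B / A `<=` B >-> A <= B}.
Proof.
move=> A B AB; apply: ge_ereal_sup => _ [e /= e0 <-].
apply: le_trans (hausdorff_pre_le_hausdorff _ e0).
by rewrite !hausdorff_preE//; exact: le_mu_ext.
Qed.

Lemma hausdorff_sigma_subadditive : sigma_subadditive hausdorff.
Proof.
move=> F; apply: ge_ereal_sup => _ [e /= e0 <-].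
rewrite hausdorff_preE// (le_trans (@mu_ext_sigma_subadditive _ D _ _ (cost_ge0 e) F))//.
apply: lee_nneseries => [k _ _|k _]; first exact: mu_ext_ge0.
by rewrite -hausdorff_preE//; exact: hausdorff_pre_le_hausdorff.
Qed.

Let H : {outer_measure set R -> \bar R}.
Proof.
exists hausdorff; split; split.
- exact: hausdorff0.
- exact: hausdorff_ge0.
- exact: le_hausdorff.
- exact: hausdorff_sigma_subadditive.
Defined.

Lemma hausdorffU_separated e A B : (0 < e)%R ->
  (forall x y, A x -> B y -> (e <= `|x - y|)%R) ->
  hausdorff A + hausdorff B <= hausdorff (A `|` B).
Proof.
move=> e0 AB.
have key r : (0 < r)%R -> (r < e)%R ->
    hausdorff_pre r A + hausdorff_pre r B <= hausdorff_pre r (A `|` B).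
  move=> r0 re; apply: le_ereal_inf_tmp => _ [U [h ABU] <-].
  pose V X k := if pselect (U k `&` X !=set0) then U k else set0.
  have Vr X k : diameter (V X k) <= r%:E.
    rewrite /V; case: pselect => ? /=; first exact: h.
    by rewrite diameter0 lee_fin ltW.
  have XV X : X `<=` A `|` B -> X `<=` \bigcup_k V X k.
    move=> XAB x Xx; have [k _ Ukx] := ABU _ (XAB _ Xx).
    by exists k => //; rewrite /V; case: pselect => // -[]; exists x.
  apply: (@le_trans _ _ (\sum_(k <oo) diameter (V A k) `^ s +
                         \sum_(k <oo) diameter (V B k) `^ s)).
    apply: leeD; apply: ereal_inf_lbound; eexists; try reflexivity.
      by split=> //; apply: XV => x; left.
    by split=> //; apply: XV => x; right.
  rewrite -nneseriesD; [|by move=> *; exact: poweR_ge0..].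
  apply: lee_nneseries => [k _ _|k _]; first by rewrite adde_ge0// poweR_ge0.
  have p0 : diameter set0 `^ s = 0 by rewrite diameter0 poweR0r// gt_eqF.
  rewrite /V; case: pselect => [[x [Ux Ax]]|?] /=; last first.
    by rewrite p0 add0e; case: pselect => ? //=; rewrite p0 poweR_ge0.
  case: pselect => [[y [Uy By]]|?] /=; last by rewrite p0 adde0.
  exfalso; have := le_trans (le_diameter Ux Uy) (h k).
  by rewrite lee_fin leNgt (lt_le_trans re)//; exact: AB.
have key2 r r' : (0 < r)%R -> (0 < r')%R ->
    hausdorff_pre r A + hausdorff_pre r' B <= hausdorff (A `|` B).
  move=> r0 r'0; pose q := Num.min (Num.min r r') (e / 2)%R.
  have q0 : (0 < q)%R by rewrite !lt_min r0 r'0 divr_gt0.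
  apply: (@le_trans _ _ (hausdorff_pre q A + hausdorff_pre q B)).
    by apply: leeD; apply: le_hausdorff_pre; rewrite !ge_min lexx ?orbT.
  apply: le_trans (hausdorff_pre_le_hausdorff _ q0).
  by apply: key => //; rewrite gt_min; apply/orP; right; lra.
have [->|fin] := eqVneq (hausdorff (A `|` B)) +oo; first by rewrite leey.
have fAB : hausdorff (A `|` B) \is a fin_num.
  by rewrite ge0_fin_numE ?hausdorff_ge0// ltey.
have finpre r' : (0 < r')%R -> hausdorff_pre r' B \is a fin_num.
  move=> r'0; rewrite ge0_fin_numE ?hausdorff_pre_ge0//.
  rewrite (le_lt_trans (hausdorff_pre_le_hausdorff _ r'0))//.
  by rewrite (@le_lt_trans _ _ (hausdorff (A `|` B))) ?ltey//; apply: le_hausdorff => x; right.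
have fA : hausdorff A \is a fin_num.
  rewrite ge0_fin_numE ?hausdorff_ge0//.
  by rewrite (@le_lt_trans _ _ (hausdorff (A `|` B))) ?ltey//; apply: le_hausdorff => x; left.
rewrite addeC -leeBrDr//; apply: ge_ereal_sup => _ [r' /= r'0 <-].
rewrite leeBrDr// addeC -leeBrDr ?finpre//; apply: ge_ereal_sup => _ [r /= r0 <-].
by rewrite leeBrDr ?finpre//; exact: key2.
Qed.

Lemma hausdorff_caratheodory_ray a : hausdorff.-caratheodory [set` `]a, +oo[].
Proof.
apply: (@le_caratheodory_measurable _ _ H) => A /=.
set C := A `&` _; set B := A `&` _.
have [->|fin] := eqVneq (hausdorff A) +oo; first by rewrite leey.
have fA : hausdorff A \is a fin_num by rewrite ge0_fin_numE ?hausdorff_ge0// ltey.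
pose d (n : nat) : R := (a + n.+1%:R^-1)%R.
have dle n m : (n <= m)%N -> (d m <= d n)%R.
  by move=> nm; rewrite lerD2l lef_pV2 ?posrE ?ltr0n// ler_nat.
have dlt n : (d n.+1 < d n)%R.
  by rewrite ltrD2l ltf_pV2 ?posrE ?ltr0n// ltr_nat.
pose Cn n := A `&` [set x | (d n <= x)%R].
have CnA n : Cn n `<=` A by move=> x [].
pose Rn n := Cn n.+2 `\` Cn n.+1.
have fS X : X `<=` A -> hausdorff X \is a fin_num.
  move=> XA; rewrite ge0_fin_numE ?hausdorff_ge0//.
  by rewrite (@le_lt_trans _ _ (hausdorff A)) ?ltey//; exact: le_hausdorff.
have step n : hausdorff (Cn n) + hausdorff (Rn n) <= hausdorff (Cn n.+2).
  apply: (le_trans (@hausdorffU_separated (d n - d n.+1)%R _ _ _ _)).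
  - by rewrite subr_gt0.
  - move=> x y [_ /= dx] [[Ay _]] /not_andP[//|/= /negP].
    rewrite -ltNge; move: dx (dlt n); move: (d n) (d n.+1) => p q dx pq yd.
    by rewrite ger0_norm; lra.
  - apply: le_hausdorff => x [[Ax /= dx]|[]//]; split => //=.
    by rewrite (le_trans _ dx)// dle// ltnW.
have sumR n : \sum_(i < n) hausdorff (Rn i) <=
    hausdorff (Cn n.+1) + hausdorff (Cn n).
  elim: n => [|n ih]; first by rewrite big_ord0 adde_ge0// hausdorff_ge0.
  rewrite big_ord_recr/= (le_trans (leeD2r _ ih))// -addeA addeC.
  by rewrite leeD2r.
have sumRfin : \sum_(0 <= i <oo) hausdorff (Rn i) < +oo.
  apply: (@le_lt_trans _ _ (hausdorff A + hausdorff A)).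
    apply: lime_le.
      by apply: is_cvg_nneseries => *; exact: hausdorff_ge0.
    apply: nearW => n; rewrite big_mkord (le_trans (sumR n))// leeD//;
      exact: le_hausdorff.
  by rewrite lte_add_pinfty// ltey.
have tail : \sum_(N <= k <oo) hausdorff (Rn k) @[N --> \oo] --> 0.
  by apply: nneseries_tail_cvg => // *; exact: hausdorff_ge0.
have BCn n : hausdorff B + hausdorff (Cn n) <= hausdorff A.
  apply: (le_trans (@hausdorffU_separated (n.+1%:R^-1)%R _ _ _ _)).
  - by rewrite invr_gt0 ltr0n.
  - move=> x y [_ /= /negP]; rewrite in_itv/= andbT -leNgt => xa [_ /=].
    have : (0 < n.+1%:R^-1 :> R)%R by rewrite invr_gt0 ltr0n.
    by rewrite /d; move: (_^-1)%R => t t0 dy; rewrite ler0_norm; lra.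
  - by apply: le_hausdorff => x [] [].
have CE n : C `<=` Cn n.+1 `|` \bigcup_(k in ~` `I_n) Rn k.
  move=> x [Ax /=]; rewrite in_itv/= andbT => ax.
  have [dx|dx] := leP (d n.+1) x; first by left.
  right.
  have [m dm] : exists m, (d m <= x)%R.
    exists (Num.truncn (x - a)^-1).
    have : ((x - a)^-1 < (Num.truncn (x - a)^-1).+1%:R)%R by exact: truncnS_gt.
    rewrite /d; set t := (_.+1%:R)%R => h.
    have : (t^-1 < x - a)%R by rewrite invf_plt ?posrE// ?subr_gt0// ltr0n.
    by rewrite ltrBrDl => /ltW.
  have ex : exists m, (d m <= x)%R by exists m.
  case: (ex_minnP ex) => k dk kmin.
  have nk : (n.+1 < k)%N.
    by rewrite ltnNge; apply/negP => kn; have := le_trans (dle _ _ kn) dk; rewrite leNgt dx.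
  exists k.-2; first by apply/negP; rewrite -leqNgt; case: k nk {dk kmin} => [|[|k]].
  case: k nk dk kmin => [|[|k]]//= nk dk kmin; split => // -[_ /= dk1].
  by have := kmin _ dk1; rewrite ltnn.
have CBle n : hausdorff C + hausdorff B <=
    hausdorff A + \sum_(n <= k <oo) hausdorff (Rn k).
  rewrite addeC (le_trans _ (leeD2r _ (BCn n.+1)))// -addeA leeD2l//.
  apply: (le_trans (le_hausdorff (CE n))).
  apply: (le_trans (outer_measureU2 H _ _)); rewrite leeD2l//.
  exact: (outer_measure_sigma_subadditive_tail H).
have -> : hausdorff A = limn (fun n => hausdorff A + \sum_(n <= k <oo) hausdorff (Rn k)).
  apply/esym/cvg_lim => //; rewrite -[X in _ --> X]adde0.
  by apply: cvgeD => //; [rewrite fin_num_adde_defl|exact: cvg_cst].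
apply: lime_ge; last exact: nearW.
apply/cvg_ex; exists (hausdorff A + 0).
by apply: cvgeD => //; [rewrite fin_num_adde_defl|exact: cvg_cst].
Qed.

Lemma hausdorff_caratheodory_borel A : measurable A -> hausdorff.-caratheodory A.
Proof.
move=> mA; have : (@ocitv R).-sigma.-measurable A by exact: mA.
rewrite RGenOInfty.measurableE; move: A {mA}; apply: smallest_sub => /=.
  split.
  - exact: (caratheodory_measurable_set0 H).
  - by move=> B mB; rewrite setTD; exact: (caratheodory_measurable_setC (mu := H)).
  - by move=> F mF; exact: (caratheodory_measurable_bigcup (mu := H)).
by move=> _ [a ->]; exact: hausdorff_caratheodory_ray.
Qed.

Lemma hausdorff_restr_semi_sigma_additive X :
  semi_sigma_additive (fun A => hausdorff (A `&` X)).
Proof.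
move=> F mF tF mUF.
have cF n : hausdorff.-caratheodory (F n) by exact: hausdorff_caratheodory_borel.
suff -> : hausdorff (\bigcup_n F n `&` X) = \sum_(k <oo) hausdorff (F k `&` X).
  by apply: is_cvg_nneseries => *; exact: hausdorff_ge0.
apply/eqP; rewrite eq_le; apply/andP; split.
  by rewrite setIC (le_trans (outer_measure_bigcup_lim H F X))//;
    under eq_eseriesr do rewrite setIC.
have := caratheodory_lime_le (mu := H) cF tF (\bigcup_n F n `&` X).
rewrite (setIAC _ X) setICr set0I.
rewrite (outer_measure0 H) adde0; apply: le_trans.
apply: lee_nneseries => [*|k _]; first exact: hausdorff_ge0.
by apply: le_hausdorff => x [Fx Xx]; split => //; split => //; exists k.
Qed.

End hausdorff.

Section fractal.
Context (R : realType).

(* 0.d_0 d_1 d_2 ... in base 3 *)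
Definition ternary (d : nat -> 'I_3) : R :=
  limn (series (fun k => (d k)%:R / 3 ^+ k.+1 : R)).

Definition Cantor_set : set R :=
  [set x | exists2 d : nat -> 'I_3, (forall k, d k <> 1%N :> nat) & x = ternary d].

(* The base-3 expansions of [x] are d_0 ... d_(q-1) . d_q d_(q+1) ... preceded
   by the sign of [x]. *)
Definition fractal : set R :=
  [set x | exists (q : nat) (d : nat -> 'I_3), `|x| = 3 ^+ q * ternary d /\
                       finite_set [set k | d k = 1%N :> nat]].

Definition log3_2 : R := ln 2 / ln 3.

Lemma log3_2_gt0 : 0 < log3_2.
Proof. by rewrite divr_gt0// ln_gt0// ltr1n. Qed.

(* No normalizing constant is needed: covers are weighted by [diameter ^ s], for
   which the Cantor set has measure 1. *)
Definition hausdorff_fractal (A : set R) : \bar R :=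
  hausdorff log3_2 (A `&` fractal).

Lemma hausdorff_fractal0 : hausdorff_fractal set0 = 0%E.
Proof. by rewrite /hausdorff_fractal set0I hausdorff0// log3_2_gt0. Qed.

Lemma hausdorff_fractal_ge0 A : (0 <= hausdorff_fractal A)%E.
Proof. exact: hausdorff_ge0. Qed.

Lemma hausdorff_fractal_semi_sigma_additive :
  semi_sigma_additive hausdorff_fractal.
Proof. exact: hausdorff_restr_semi_sigma_additive log3_2_gt0 _. Qed.

HB.instance Definition _ := isMeasure.Build _ _ _ hausdorff_fractal
  hausdorff_fractal0 hausdorff_fractal_ge0 hausdorff_fractal_semi_sigma_additive.

(* [triadic k p] ranges over Z[1/3]. *)
Definition triadic (k : int) (p : nat) : R := k%:~R / 3 ^+ p.

(* Points outside [fractal] form a null set for [hausdorff_fractal], so that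
   [L2 hausdorff_fractal] is the space of square integrable functions on
   [fractal]; [fractal] is invariant under x |-> x / 3 and under translation by
   elements of Z[1/3]. The operators are computed on the representative chosen
   by [L2repr]; both (for such translations) are isometric, so that any other
   representative gives the same class. *)
Definition dilation (f : L2 hausdorff_fractal) : L2 hausdorff_fractal :=
  L2class hausdorff_fractal (fun x => ((Num.sqrt 2)^-1)%:C * f (x / 3)).

Definition translation (l : R) (f : L2 hausdorff_fractal) :
    L2 hausdorff_fractal :=
  L2class hausdorff_fractal (fun x => f (x - l)).

End fractal.

Section solenoid.
Context (R : realType).

Definition solenoid_set : set {ptws int -> R[i]^o} :=
  [set z | forall n : int, z (n + 1) ^+ 3 = z n /\ `|z n| = 1].

Definition solenoid : Type := set_type solenoid_set.
HB.instance Definition _ := Topological.copy solenoid (set_type solenoid_set).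

Definition coord (z : solenoid) (n : int) : R[i] := set_val z n.

Definition mk_solenoid z (h : solenoid_set z) : solenoid :=
  exist (fun z => z \in solenoid_set) z (mem_set h).

Lemma solenoid_set1 : solenoid_set (fun=> 1).
Proof. by move=> n; rewrite expr1n normr1. Qed.

HB.instance Definition _ :=
  isPointed.Build solenoid (mk_solenoid solenoid_set1).

Lemma solenoid_shift_subproof (z : solenoid) :
  solenoid_set (fun n => coord z (n - 1)).
Proof. by move=> n; have := set_valP z (n - 1); rewrite subrK addrK. Qed.

Definition solenoid_shift (z : solenoid) : solenoid :=
  mk_solenoid (solenoid_shift_subproof z).

Definition borel_solenoid := g_sigma_algebraType (@open solenoid).

(* the character chi_l for l = k / 3 ^ p *)
Definition chi (k : int) (p : nat) (z : borel_solenoid) : R[i] := coord z p ^ k.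

Definition m0 (z : R[i]) : R[i] := (1 + z ^+ 2) / (Num.sqrt 2)%:C.

Variable m : {measure set borel_solenoid -> \bar R}.

Definition fourier (k : int) (p : nat) : R[i] := cintegral m (chi k p).

Definition mul_chi (k : int) (p : nat) (f : L2 m) : L2 m :=
  L2class m (fun z => chi k p z * f z).

(* Computed on the representative [L2repr f]. When the image of |m0|^2 m under
   [solenoid_shift] is m, the operator is isometric and the class obtained does
   not depend on the representative. *)
Definition mul_m0_shift (f : L2 m) : L2 m :=
  L2class m (fun z => m0 (coord z 0) * f (solenoid_shift z)).

End solenoid.

(* [l = \sum_(j <= p) d_j / 3 ^ (j + 1)] with digits in {-2, 0, 2} *)
Definition even_expansion (R : realType) (l : R) (p : nat) (d : nat -> int) :=
  (forall j, (j <= p)%N -> d j \in [:: -2; 0; 2]) /\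
  l = \sum_(j < p.+1) (d j)%:~R / 3 ^+ j.+1.

(* Main.v *)
Require Import Defs.
From HB Require Import structures.
From mathcomp Require Import all_boot all_order all_algebra.
From mathcomp Require Import all_classical all_reals all_analysis.
From mathcomp Require Import measurable_realfun complex ring lra.

(* The translates [T_l chi_C] and the characters [chi_l] have the same Gram
   matrix: the overlap [a(l) = H^s(C \cap (C - l))] and the Fourier coefficient
   of [m] at [l] are both the indicator of [0] on the integers and both satisfy
   [a(l / 3) = a(l) + (a(l + 2) + a(l - 2)) / 2], for [a] because
   [3 C = C \cup (C + 2)], for [m] because an expansion of [l / 3] is a digit [c]
   followed by an expansion of [l - c]. As both families span dense subspaces,
   [T_l chi_C |-> chi_l] extends to a unique unitary operator, and the two
   intertwining relations need to be checked on the generators only. For the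
   dilation this uses [U chi_C = (chi_C + T_2 chi_C) / sqrt 2]; that
   [f |-> m_0 (f \o S)] is well defined and isometric follows from the recursion
   for the coefficients of [m], which says that [S] maps [|m_0|^2 m] to [m].

   Density is obtained by showing that, for a closed subspace V, the sets whose
   indicator multiplies V into itself form a sigma-algebra. For characters it
   contains the sets [Re z_n < a] and [Im z_n < a], whose indicators are bounded
   pointwise limits of polynomials in characters. For translates of [chi_C] it
   contains the half-lines with triadic end points once V is known to contain the
   indicators of all small copies of C. Those come from the large ones: two
   neighbouring copies of size h make up one of size 3 h, so V contains the sums
   [e_j + e_(j+1)] of consecutive orthogonal vectors, hence [e_0 - (-1) ^ n e_n]
   for all n, and the average of these tends to [e_0].

   The normalization [H^s C = 1] is obtained from the covers of C by triadic
   intervals and from [|b x - b y| <= |x - y| ^ s] on C, where [b] reads the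
   digits 0 and 2 of a point of C as the binary digits 0 and 1. *)

Set Implicit Arguments.
Unset Strict Implicit.
Unset Printing Implicit Defensive.

Import Order.TTheory GRing.Theory Num.Theory.
Import numFieldNormedType.Exports.
Import ComplexField.Normc.
Import HBNNSimple.

Local Open Scope classical_set_scope.
Local Open Scope complex_scope.
Local Open Scope ring_scope.

Local Notation Re := complex.Re.
Local Notation Im := complex.Im.
Local Notation coord := Defs.coord.

(** * Hilbert spaces *)

(** The vectors [T_l chi_C] are neither orthogonal nor indexed without repetition: a pair [(k, p)]
    stands for k / 3^p, and every triadic number has many such pairs. Comparing Gram matrices avoids
    any discussion of independence. The overlaps of C are never computed in closed form either: the
    recursion lowers the exponent of the denominator, so it determines all of them from the
    integers.

    The recursion for [m] is known on characters only, whereas boundedness of f |-> m_0 (f o S) is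
    an identity for all nonnegative measurable functions. Density of the characters in L^2(m) cannot
    be used directly, since composition with S is not yet known to be continuous there. Density is
    therefore proved for every finite measure and applied to the sum of [m] and its image under S.

    The operators are computed on chosen representatives. A norm estimate on the level of functions
    settles two questions at once: the operator is continuous, and its value does not depend on the
    representative. *)

Lemma normc_ge0 (R : realType) (a : R[i]) : 0 <= normc a.
Proof. by case: a => x y; exact: sqrtr_ge0. Qed.

Lemma normc_real (R : realType) (x : R) : normc x%:C = `|x|.
Proof. by rewrite /= expr0n addr0 sqrtr_sqr. Qed.

Lemma mulc_conj (R : realType) (a : R[i]) : a * a^* = (normc a ^+ 2)%:C.
Proof.
rewrite normc_sqr; case: a => x y; apply/eqP.
by rewrite eq_complex /=; apply/andP; split; apply/eqP; ring.
Qed.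

Section inner_product.
Context {R : realType}.

Definition hnorm (H : lmodType R[i]) (dot : H -> H -> R[i]) (u : H) : R :=
  Num.sqrt (Re (dot u u)).

(** A predicate on a bare form: the spaces [L2 mu] then need no topology, and convergence is spelled
    out with [hnorm]. *)
Record hilbert (H : lmodType R[i]) (dot : H -> H -> R[i]) : Prop := Hilbert {
  dot_linear : forall a u v w, dot (a *: u + v) w = a * dot u w + dot v w;
  dotC : forall u v, dot u v = (dot v u)^*;
  dot_ge0 : forall u, 0 <= dot u u;
  dot_eq0 : forall u, dot u u = 0 -> u = 0;
  hilbert_complete : forall u : nat -> H,
    (forall e : R, 0 < e ->
      exists n, forall j k, (n <= j)%N -> (n <= k)%N -> hnorm dot (u j - u k) < e) ->
    exists l, forall e : R, 0 < e ->
      exists n, forall k, (n <= k)%N -> hnorm dot (l - u k) < e }.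

Definition closed_subspace (H : lmodType R[i]) (dot : H -> H -> R[i])
    (V : set H) :=
  [/\ V 0, forall a u v, V u -> V v -> V (a *: u + v) &
      forall u, (forall e : R, 0 < e -> exists2 v, V v & hnorm dot (u - v) < e) ->
        V u].

(** Lists with repetitions make sums into concatenations and require no equality test on the
    indices. *)
Definition comb (H : lmodType R[i]) I (e : I -> H) (s : seq (R[i] * I)) : H :=
  \sum_(x <- s) x.1 *: e x.2.

Definition closed_span (H : lmodType R[i]) (dot : H -> H -> R[i]) I
    (e : I -> H) : set H :=
  [set u | forall r : R, 0 < r -> exists s, hnorm dot (u - comb e s) < r].

Section theory.
Context (H : lmodType R[i]) (dot : H -> H -> R[i]) (hH : hilbert dot).
Local Notation N := (hnorm dot).

Lemma dotDl u v w : dot (u + v) w = dot u w + dot v w.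
Proof. by rewrite -[u]scale1r (dot_linear hH) mul1r scale1r. Qed.

Lemma dot0l w : dot 0 w = 0.
Proof. by apply: (@addrI _ (dot 0 w)); rewrite -dotDl !addr0. Qed.

Lemma dotZl a u w : dot (a *: u) w = a * dot u w.
Proof. by rewrite -[a *: u]addr0 (dot_linear hH) dot0l addr0. Qed.

Lemma dotDr u v w : dot w (u + v) = dot w u + dot w v.
Proof. by rewrite (dotC hH) dotDl rmorphD/= -!(dotC hH). Qed.

Lemma dotZr a u w : dot w (a *: u) = a^* * dot w u.
Proof. by rewrite (dotC hH) dotZl rmorphM/= -(dotC hH). Qed.

Lemma dot_suml I (s : seq I) (f : I -> H) w :
  dot (\sum_(i <- s) f i) w = \sum_(i <- s) dot (f i) w.
Proof.
elim: s => [|i s ih]; first by rewrite !big_nil dot0l.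
by rewrite !big_cons dotDl ih.
Qed.

Lemma dot_sumr I (s : seq I) (f : I -> H) w :
  dot w (\sum_(i <- s) f i) = \sum_(i <- s) dot w (f i).
Proof.
by rewrite (dotC hH) dot_suml rmorph_sum/=; apply: eq_bigr => i _; rewrite -(dotC hH).
Qed.

Lemma Re_dot_ge0 u : 0 <= Re (dot u u).
Proof. by have := dot_ge0 hH u; rewrite lecE => /andP[]. Qed.

Lemma dot_norm u : dot u u = (N u ^+ 2)%:C.
Proof.
rewrite /hnorm sqr_sqrtr ?Re_dot_ge0//.
by have := dot_ge0 hH u; rewrite lecE; case: (dot u u) => a b /= /andP[/eqP ->].
Qed.

Lemma hnorm_ge0 u : 0 <= N u. Proof. exact: sqrtr_ge0. Qed.

Lemma hnorm0_eq0 u : N u = 0 -> u = 0.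
Proof. by move=> h; apply: (dot_eq0 hH); rewrite dot_norm h expr0n. Qed.

Lemma hnorm0 : N 0 = 0.
Proof. by rewrite /hnorm dot0l sqrtr0. Qed.

Lemma hnormZ a u : N (a *: u) = normc a * N u.
Proof.
rewrite /hnorm dotZl dotZr dot_norm mulrA mulc_conj -rmorphM/= -exprMn.
rewrite sqrtr_sqr ger0_norm//; last by rewrite mulr_ge0 ?normc_ge0 ?hnorm_ge0.
by rewrite sqrtr_sqr ger0_norm// hnorm_ge0.
Qed.

Lemma hnormN u : N (- u) = N u.
Proof. by rewrite -scaleN1r hnormZ normcN normc1 mul1r. Qed.

Lemma sqr_hnorm u : N u ^+ 2 = Re (dot u u).
Proof. by rewrite sqr_sqrtr ?Re_dot_ge0. Qed.

Lemma sqr_hnormD u v :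
  N (u + v) ^+ 2 = N u ^+ 2 + N v ^+ 2 + 2 * Re (dot u v).
Proof.
rewrite !sqr_hnorm dotDl !dotDr (dotC hH v u).
by case: (dot u u) (dot u v) (dot v v) => ? ? [? ?] [? ?] /=; ring.
Qed.

(** Cauchy-Schwarz, from the squared norm of [N v *: u - N u *: v], which is 2 [N u] [N v] times the
    difference of the two sides. The real part is all that the triangle inequality needs. *)
Lemma Re_dot_le u v : Re (dot u v) <= N u * N v.
Proof.
have [/hnorm0_eq0 ->|u0] := eqVneq (N u) 0; first by rewrite dot0l hnorm0 mul0r.
have [/hnorm0_eq0 ->|v0] := eqVneq (N v) 0.
  by rewrite (dotC hH) dot0l rmorph0 hnorm0 mulr0.
have p : 0 < N u * N v by rewrite mulr_gt0// lt_def hnorm_ge0 andbT.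
have := sqr_ge0 (N ((N v)%:C *: u + (- N u)%:C *: v)).
rewrite sqr_hnormD !hnormZ !normc_real normrN !ger0_norm ?hnorm_ge0//.
rewrite dotZl dotZr.
have -> : Re ((N v)%:C * (((- N u)%:C)^* * dot u v)) = - (N u * N v * Re (dot u v)).
  by case: (dot u v) => x y /=; ring.
move: p; move: (N u) (N v) (Re _) => a b x p.
rewrite (mulrC b a) => h; have : 0 <= a * b * (a * b - x) by nra.
by rewrite pmulr_rge0// subr_ge0.
Qed.

Lemma hnormD u v : N (u + v) <= N u + N v.
Proof.
rewrite -(@ler_pXn2r _ 2)// ?nnegrE ?addr_ge0 ?hnorm_ge0// sqr_hnormD.
by have := Re_dot_le u v; rewrite sqrrD -mulr_natl; lra.
Qed.

Lemma hnormB u v : N (u - v) = N (v - u).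
Proof. by rewrite -hnormN opprB. Qed.

Lemma hnorm_dist u v w : N (u - w) <= N (u - v) + N (v - w).
Proof. by have := hnormD (u - v) (v - w); rewrite addrA subrK. Qed.

Lemma comb_cat I (e : I -> H) s t : comb e (s ++ t) = comb e s + comb e t.
Proof. by rewrite /comb big_cat. Qed.

Lemma comb_scale I (e : I -> H) a s :
  comb e [seq (a * x.1, x.2) | x <- s] = a *: comb e s.
Proof.
by rewrite /comb big_map scaler_sumr; apply: eq_bigr => x _; rewrite scalerA.
Qed.

Lemma combB I (e : I -> H) s t :
  comb e (s ++ [seq (-1 * x.1, x.2) | x <- t]) = comb e s - comb e t.
Proof. by rewrite comb_cat comb_scale scaleN1r. Qed.

Lemma dot_comb I (e : I -> H) s t :
  dot (comb e s) (comb e t) =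
  \sum_(x <- s) \sum_(y <- t) x.1 * (y.1^* * dot (e x.2) (e y.2)).
Proof.
rewrite dot_suml; apply: eq_bigr => x _; rewrite dotZl dot_sumr mulr_sumr.
by apply: eq_bigr => y _; rewrite dotZr.
Qed.

Lemma comb_subspace I (e : I -> H) V s : closed_subspace dot V ->
  (forall i, V (e i)) -> V (comb e s).
Proof.
move=> [V0 VD _] Ve; elim: s => [|x s ih]; first by rewrite /comb big_nil.
by rewrite /comb big_cons; exact: VD.
Qed.

Lemma closed_subspace0 : closed_subspace dot [set 0].
Proof.
split=> //= [a u v -> ->|u h]; first by rewrite scaler0 addr0.
apply: hnorm0_eq0; apply/eqP; rewrite eq_le hnorm_ge0 andbT.
apply/ler_addgt0Pr => e /h[_ /= ->]; rewrite subr0 add0r; exact: ltW.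
Qed.

Lemma closed_span_gen I (e : I -> H) i : closed_span dot e (e i).
Proof.
by move=> r r0; exists [:: (1, i)]; rewrite /comb big_seq1 scale1r subrr hnorm0.
Qed.

Lemma closed_span_subspace I (e : I -> H) :
  closed_subspace dot (closed_span dot e).
Proof.
split.
- by move=> r r0; exists [::]; rewrite /comb big_nil subrr hnorm0.
- move=> a u v hu hv r r0.
  have c0 : 0 < normc a + 1 by rewrite ltr_wpDl ?normc_ge0.
  have r2 : 0 < r / 2 by rewrite divr_gt0.
  have [s us] := hu (r / 2 / (normc a + 1)) (divr_gt0 r2 c0).
  have [t vt] := hv _ r2.
  exists ([seq (a * x.1, x.2) | x <- s] ++ t).
  rewrite comb_cat comb_scale opprD addrACA -scalerBr.
  rewrite (le_lt_trans (hnormD _ _))// hnormZ [ltRHS](splitr r) ltrD//.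
  rewrite (le_lt_trans _ (_ : (normc a + 1) * N (u - comb e s) < _))//.
    by rewrite ler_wpM2r ?hnorm_ge0// lerDl.
  by rewrite mulrC -ltr_pdivlMr.
- move=> u h r r0.
  have r2 : 0 < r / 2 by rewrite divr_gt0.
  have [v hv uv] := h _ r2; have [s vs] := hv _ r2.
  exists s; rewrite (le_lt_trans (hnorm_dist _ v _))//.
  by rewrite [ltRHS](splitr r) ltrD.
Qed.

End theory.

(** * Bounded operators and isometries between two spaces *)

Section two_spaces.
Context {H1 H2 : lmodType R[i]} {dot1 : H1 -> H1 -> R[i]}
  {dot2 : H2 -> H2 -> R[i]} (h1 : hilbert dot1) (h2 : hilbert dot2).
Local Notation N1 := (hnorm dot1).
Local Notation N2 := (hnorm dot2).

(** A combination close to [u] is mapped to a combination of the [A (e i)] close to [A u]. The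
    subspace [V] will be {0} to compare two operators, an orthogonal complement to prove an identity
    between integrals, and a closed span to prove its invariance. *)
Lemma bounded_linear_span I (e : I -> H1) (A : H1 -> H2) (B : R) V :
  linear A -> (forall u, N2 (A u) <= B * N1 u) -> closed_subspace dot2 V ->
  (forall i, V (A (e i))) -> forall u, closed_span dot1 e u -> V (A u).
Proof.
move=> lA bA VV VA u hu.
have A0 : A 0 = 0.
  by have := lA (-1) 0 0; rewrite scaler0 addr0 scaleN1r => ->; exact: addNr.
have Ac s : A (comb e s) = comb (A \o e) s.
  rewrite /comb; elim: s => [|x s ih]; first by rewrite !big_nil.
  by rewrite !big_cons lA ih.
case: (VV) => _ _; apply => r r0.
(* [B] carries no sign assumption, so a positive bound is made from it before dividing. *)
have B0 : 0 < `|B| + 1 by rewrite ltr_wpDl.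
have [s us] := hu _ (divr_gt0 r0 B0).
exists (A (comb e s)); first by rewrite Ac; apply: (comb_subspace _ VV).
have -> : A u - A (comb e s) = A (u - comb e s).
  by rewrite addrC -scaleN1r -lA scaleN1r addrC.
apply: le_lt_trans (bA _) _; rewrite ltr_pdivlMr// mulrC in us.
apply: le_lt_trans us; rewrite ler_wpM2r ?hnorm_ge0//.
by rewrite (le_trans (ler_norm _))// lerDl.
Qed.

Lemma bounded_linear_eq I (e : I -> H1) (A B : H1 -> H2) (a b : R) :
  linear A -> linear B ->
  (forall u, N2 (A u) <= a * N1 u) -> (forall u, N2 (B u) <= b * N1 u) ->
  (forall u, closed_span dot1 e u) -> (forall i, A (e i) = B (e i)) -> A =1 B.
Proof.
move=> lA lB bA bB dense AB u; apply/eqP; rewrite -subr_eq0; apply/eqP.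
apply: (@bounded_linear_span I e (fun u => A u - B u) (a + b) [set 0]) => //.
- by move=> c v w; rewrite lA lB scalerBr opprD addrACA.
- move=> v; rewrite mulrDl (le_trans (hnormD h2 _ _))// lerD//.
  by rewrite hnormN.
- exact: closed_subspace0.
- by move=> i /=; rewrite AB subrr.
Qed.

Context {I : Type} (e : I -> H1) (g : I -> H2).
Hypothesis gram : forall i j, dot1 (e i) (e j) = dot2 (g i) (g j).

Definition span_graph (u : H1) (v : H2) := forall r : R, 0 < r ->
  exists s, N1 (u - comb e s) < r /\ N2 (v - comb g s) < r.

(** The difference is again a combination, and its norm depends on the Gram matrix only. In
    particular every linear relation among the [e i] also holds among the [g i]. *)
Lemma comb_isometry s t :
  N1 (comb e s - comb e t) = N2 (comb g s - comb g t).
Proof.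
rewrite -!combB /hnorm (dot_comb h1) (dot_comb h2).
congr (Num.sqrt (Re _)); apply: eq_bigr => x _; apply: eq_bigr => y _.
by rewrite gram.
Qed.

(** Combinations approaching [u] are Cauchy, hence so are the same combinations of the [g i];
    completeness of the second space supplies the limit. *)
Lemma span_graph_total u : closed_span dot1 e u -> exists v, span_graph u v.
Proof.
move=> hu.
have pos n : 0 < n.+1%:R^-1 :> R by rewrite invr_gt0 ltr0n.
have [s us] := choice (fun n => hu _ (pos n)).
have small (r : R) : 0 < r -> exists n, forall k, (n <= k)%N -> k.+1%:R^-1 < r.
  move=> r0; exists (Num.truncn r^-1) => k nk.
  rewrite invf_plt ?posrE// ?ltr0n//.
  have := truncnS_gt r^-1; move/lt_le_trans; apply.
  by rewrite ler_nat ltnS.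
have [v hv] : exists l, forall r : R, 0 < r ->
    exists n, forall k, (n <= k)%N -> N2 (l - comb g (s k)) < r.
  apply: (hilbert_complete h2) => r r0.
  have [n hn] := small (r / 2) (divr_gt0 r0 (ltr0n _ 2)).
  exists n => j k nj nk; rewrite -comb_isometry.
  apply: le_lt_trans (hnorm_dist h1 _ u _) _.
  rewrite [ltRHS](splitr r) ltrD//; first rewrite (hnormB h1).
    exact: lt_trans (us j) (hn _ nj).
  exact: lt_trans (us k) (hn _ nk).
exists v => r r0.
have [n hn] := small r r0; have [n' hn'] := hv r r0.
exists (s (maxn n n')); split; last by apply: hn'; rewrite leq_maxr.
by apply: lt_trans (us _) (hn _ _); rewrite leq_maxl.
Qed.

Lemma span_graph_linear a u u' v v' :
  span_graph u v -> span_graph u' v' -> span_graph (a *: u + u') (a *: v + v').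
Proof.
move=> hu hu' r r0.
have c0 : 0 < normc a + 1 by rewrite ltr_wpDl ?normc_ge0.
have r2 : 0 < r / 2 by rewrite divr_gt0.
have [s [us vs]] := hu (r / 2 / (normc a + 1)) (divr_gt0 r2 c0).
have [t [ut vt]] := hu' _ r2.
exists ([seq (a * x.1, x.2) | x <- s] ++ t).
rewrite !comb_cat !comb_scale.
have aux (x y : R) : 0 <= x -> x < r / 2 / (normc a + 1) -> y < r / 2 ->
    normc a * x + y < r.
  move=> x0 xs yt; rewrite [ltRHS](splitr r) ltrD//.
  rewrite (le_lt_trans _ (_ : (normc a + 1) * x < _))//.
    by rewrite ler_wpM2r// lerDl.
  by rewrite mulrC -ltr_pdivlMr.
split.
- rewrite opprD addrACA -scalerBr.
  by rewrite (le_lt_trans (hnormD h1 _ _))// (hnormZ h1) aux// hnorm_ge0.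
- rewrite opprD addrACA -scalerBr.
  by rewrite (le_lt_trans (hnormD h2 _ _))// (hnormZ h2) aux// hnorm_ge0.
Qed.

Lemma span_graph_norm_le u v : span_graph u v -> N1 u <= N2 v.
Proof.
move=> h; apply/ler_addgt0Pr => r r0.
have [s [us vs]] := h (r / 2) (divr_gt0 r0 (ltr0n _ 2)).
(* Against the empty combination the isometry says that the two combinations have equal norms. *)
have := comb_isometry s [::]; rewrite /comb !big_nil !subr0 -!/(comb _ _) => es.
have := hnorm_dist h1 u (comb e s) 0; rewrite !subr0 es.
have := hnorm_dist h2 (comb g s) v 0; rewrite !subr0 (hnormB h2).
by lra.
Qed.

End two_spaces.

Lemma span_graphC {H1 H2 : lmodType R[i]} {dot1 : H1 -> H1 -> R[i]}
    {dot2 : H2 -> H2 -> R[i]} I (e : I -> H1) (g : I -> H2) u v :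
  @span_graph H1 H2 dot1 dot2 I e g u v -> @span_graph H2 H1 dot2 dot1 I g e v u.
Proof. by move=> h r /h[s [? ?]]; exists s. Qed.

(* The graph of the isometry is the closure of the pairs formed by a linear
   combination of the [e i] and the same combination of the [g i]. *)
Lemma gram_unitary {H1 H2 : lmodType R[i]} {dot1 : H1 -> H1 -> R[i]}
    {dot2 : H2 -> H2 -> R[i]} (h1 : hilbert dot1) (h2 : hilbert dot2)
    I (e : I -> H1) (g : I -> H2) :
  (forall i j, dot1 (e i) (e j) = dot2 (g i) (g j)) ->
  (forall u, closed_span dot1 e u) -> (forall v, closed_span dot2 g v) ->
  exists F : H1 -> H2, [/\ linear F, bijective F,
    forall u v, dot2 (F u) (F v) = dot1 u v & forall i, F (e i) = g i].
Proof.
move=> gram de dg.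
have gram' i j : dot2 (g i) (g j) = dot1 (e i) (e j) by rewrite gram.
have [F hF] := choice (fun u => span_graph_total h1 h2 gram (de u)).
have [G hG] := choice (fun v => span_graph_total h2 h1 gram' (dg v)).
have norm u v : @span_graph H1 H2 dot1 dot2 I e g u v ->
    hnorm dot1 u = hnorm dot2 v.
  move=> h; apply/eqP; rewrite eq_le (span_graph_norm_le h1 h2 gram h)/=.
  exact: (span_graph_norm_le h2 h1 gram' (span_graphC h)).
have sub1 u u' v v' : @span_graph H1 H2 dot1 dot2 I e g u v ->
    @span_graph H1 H2 dot1 dot2 I e g u' v' ->
    @span_graph H1 H2 dot1 dot2 I e g (u - u') (v - v').
  move=> a b; have := span_graph_linear h1 h2 (-1) b a.
  by rewrite !scaleN1r ![- _ + _]addrC.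
have inj2 u v v' : @span_graph H1 H2 dot1 dot2 I e g u v ->
    @span_graph H1 H2 dot1 dot2 I e g u v' -> v = v'.
  move=> a b; have := norm _ _ (sub1 _ _ _ _ a b).
  rewrite subrr (hnorm0 h1) => /esym/(hnorm0_eq0 h2)/eqP.
  by rewrite subr_eq0 => /eqP.
have inj1 u u' v : @span_graph H1 H2 dot1 dot2 I e g u v ->
    @span_graph H1 H2 dot1 dot2 I e g u' v -> u = u'.
  move=> a b; have := norm _ _ (sub1 _ _ _ _ a b).
  rewrite subrr (hnorm0 h2) => /(hnorm0_eq0 h1)/eqP.
  by rewrite subr_eq0 => /eqP.
have lF : linear F.
  by move=> a u v; apply: inj2 (hF _) _; exact: (span_graph_linear h1 h2).
exists F; split => //.
- exists G => u; first exact: (inj1 _ _ _ (span_graphC (hG _)) (hF _)).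
  exact: (inj2 _ _ _ (hF _) (span_graphC (hG _))).
(* Polarization: the norms of u, v and u + v determine the real part of the product. *)
- have reF u v : Re (dot2 (F u) (F v)) = Re (dot1 u v).
    have := sqr_hnormD h2 (F u) (F v).
    have -> : F u + F v = F (u + v) by rewrite -[u in RHS]scale1r lF scale1r.
    rewrite -!(norm _ _ (hF _)) (sqr_hnormD h1 u v).
    by move: (hnorm _ u) (hnorm _ v) (Re _) (Re _) => a b x y; lra.
  have F0 : F 0 = 0.
    by have := lF (-1) 0 0; rewrite scaler0 addr0 scaleN1r => ->; exact: addNr.
  move=> u v; apply/eqP; rewrite eq_complex reF eqxx/=.
  (* The real part of -i c is the imaginary part of c. *)
  have := reF (-'i *: u) v.
  rewrite -[-'i *: u]addr0 lF F0 !addr0 (dotZl h1) (dotZl h2).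
  case: (dot1 u v) (dot2 (F u) (F v)) => a b [c d] /=.
  by rewrite !mulN1r !opprK oppr0 !mul0r !add0r => ->.
- move=> i; apply: (inj2 _ _ _ (hF _)) => r r0; exists [:: (1, i)].
  by rewrite /comb !big_seq1 !scale1r !subrr (hnorm0 h1) (hnorm0 h2).
Qed.

End inner_product.

(** * The space $L^2$ *)

Local Open Scope quotient_scope.

Section L2_theory.
Context d (T : measurableType d) (R : realType) (mu : {measure set T -> \bar R}).
Implicit Types (f g h : T -> R[i]) (u v : L2 mu).
Local Notation sqi := (square_integrable mu).

Lemma square_integrable0 : sqi 0.
Proof. by have [/asboolP] := L2pred_submod_closed mu. Qed.

Lemma square_integrable_linear a f g : sqi f -> sqi g -> sqi (a *: f + g).
Proof.
move=> sf sg; have [_ h] := L2pred_submod_closed mu.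
exact/asboolP/(h a f g (asboolT sf) (asboolT sg)).
Qed.

Lemma square_integrableD f g : sqi f -> sqi g -> sqi (f + g).
Proof. by rewrite -{2}[f]scale1r; exact: square_integrable_linear. Qed.

Lemma square_integrableZ a f : sqi f -> sqi (a *: f).
Proof.
by move=> sf; rewrite -[_ *: _]addr0; apply: square_integrable_linear => //;
  exact: square_integrable0.
Qed.

Lemma square_integrableB f g : sqi f -> sqi g -> sqi (f - g).
Proof.
move=> sf sg; rewrite -scaleN1r; apply: square_integrableD => //.
exact: square_integrableZ.
Qed.

Lemma L2repr_square_integrable u : sqi (L2repr u).
Proof. by rewrite /L2repr; case: (repr u) => f h; exact/asboolP. Qed.

Lemma L2fun_valK f : sqi f -> L2fun_val (insubd (0 : L2fun mu) f) = f.
Proof. by move=> sf; apply: (insubdK (0 : L2fun mu)); exact/asboolP. Qed.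

Lemma L2class_eq f g : sqi f -> sqi g -> {ae mu, forall x, f x = g x} ->
  L2class mu f = L2class mu g.
Proof.
move=> sf sg fg; apply/eqP; rewrite -Quotient.idealrBE; apply/asboolP.
apply: filterS fg => x fgx.
have -> : L2fun_val (insubd (0 : L2fun mu) f - insubd 0 g) x = L2fun_val (insubd (0
  : L2fun mu) f) x - L2fun_val (insubd (0 : L2fun mu) g) x by [].
by rewrite !L2fun_valK// fgx subrr.
Qed.

Lemma L2classP f : sqi f -> {ae mu, forall x, L2repr (L2class mu f) x = f x}.
Proof.
move=> sf; rewrite /L2repr /L2class.
set v := insubd _ _; set w := repr _.
have /eqP : w = v %[mod L2 mu] by rewrite reprK.
rewrite -Quotient.idealrBE => /asboolP; apply: filterS => x.
rewrite -[X in X = _ -> _]/(L2fun_val w x - L2fun_val v x) => /eqP.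
by rewrite subr_eq0 (L2fun_valK sf) => /eqP.
Qed.

Lemma L2reprK u : L2class mu (L2repr u) = u.
Proof.
rewrite /L2class /L2repr -[RHS]reprK; congr (\pi_(L2 mu) _).
by apply/val_inj/L2fun_valK/L2repr_square_integrable.
Qed.

Lemma L2class_linear a f g : sqi f -> sqi g ->
  L2class mu (a *: f + g) = a *: L2class mu f + L2class mu g.
Proof.
move=> sf sg.
rewrite -[a *: L2class _ _]/(L2scale _ _) pi_scale -Defs.pi_add.
congr (\pi_(L2 mu) _); apply/val_inj.
rewrite [LHS]L2fun_valK; last exact: square_integrable_linear.
rewrite -[RHS]/(a *: L2fun_val (insubd 0 f) + L2fun_val (insubd 0 g)).
by rewrite !L2fun_valK.
Qed.

Lemma L2classD f g : sqi f -> sqi g ->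
  L2class mu (f + g) = L2class mu f + L2class mu g.
Proof.
by move=> sf sg; rewrite -{1}[f]scale1r L2class_linear// scale1r.
Qed.

Lemma L2class0 : L2class mu 0 = 0.
Proof.
have := L2classD square_integrable0 square_integrable0.
by rewrite addr0 => /(congr1 (fun u => u - L2class mu 0)); rewrite subrr addrK.
Qed.

Lemma L2classZ a f : sqi f -> L2class mu (a *: f) = a *: L2class mu f.
Proof.
move=> sf; have := L2class_linear a sf square_integrable0.
by rewrite L2class0 !addr0.
Qed.

Lemma L2classB f g : sqi f -> sqi g ->
  L2class mu (f - g) = L2class mu f - L2class mu g.
Proof.
move=> sf sg; rewrite -scaleN1r L2classD//; last exact: square_integrableZ.
by rewrite L2classZ// scaleN1r.
Qed.

End L2_theory.

Section complex_integral.
Context d (T : measurableType d) (R : realType) (mu : {measure set T -> \bar R}).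
Implicit Types (f g h : T -> R[i]) (u v : L2 mu).
Local Notation sqi := (square_integrable mu).

Definition cintegrable f :=
  mu.-integrable setT (EFin \o (fun x => Re (f x))) /\
  mu.-integrable setT (EFin \o (fun x => Im (f x))).

Lemma cmeasurableM f g : cmeasurable f -> cmeasurable g ->
  cmeasurable (fun x => f x * g x).
Proof.
move=> [fr fi] [gr gi]; split.
  rewrite (_ : (fun _ => _) =
      (fun x => Re (f x) * Re (g x) - Im (f x) * Im (g x))).
    by apply: measurable_funB; exact: measurable_funM.
  by apply/funext => x; case: (f x) (g x) => [? ?] [].
rewrite (_ : (fun _ => _) =
    (fun x => Re (f x) * Im (g x) + Im (f x) * Re (g x))).
  by apply: measurable_funD; exact: measurable_funM.
by apply/funext => x; case: (f x) (g x) => [? ?] [].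
Qed.

Lemma cmeasurable_cst (c : R[i]) : cmeasurable (fun _ : T => c).
Proof. by split; exact: measurable_cst. Qed.

Lemma cmeasurableD f g : cmeasurable f -> cmeasurable g ->
  cmeasurable (fun x => f x + g x).
Proof.
move=> [fr fi] [gr gi]; split.
  rewrite (_ : (fun _ => _) = (fun x => Re (f x) + Re (g x))).
    exact: measurable_funD.
  by apply/funext => x; case: (f x) (g x) => [? ?] [].
rewrite (_ : (fun _ => _) = (fun x => Im (f x) + Im (g x))).
  exact: measurable_funD.
by apply/funext => x; case: (f x) (g x) => [? ?] [].
Qed.

Lemma cmeasurable_conj f : cmeasurable f -> cmeasurable (fun x => (f x)^*).
Proof.
move=> [fr fi]; split.
  rewrite (_ : (fun _ => _) = (fun x => Re (f x)))//.
  by apply/funext => x; case: (f x).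
rewrite (_ : (fun _ => _) = (fun x => - Im (f x))).
  exact: measurableT_comp.
by apply/funext => x; case: (f x).
Qed.

Lemma cmeasurable_real (r : T -> R) : measurable_fun setT r ->
  cmeasurable (fun x => (r x)%:C).
Proof. by move=> mr; split => //=; exact: measurable_cst. Qed.

Lemma measurable_sqr_norm f : cmeasurable f -> measurable_fun setT (sqr_norm f).
Proof.
move=> [fr fi]; rewrite (_ : sqr_norm f = (fun x => Re (f x) ^+ 2 + Im (f x) ^+ 2)).
  by apply: measurable_funD; exact: measurable_funX.
by apply/funext => x; exact: normc_sqr.
Qed.

Lemma sqr_norm_ge0 f x : 0 <= sqr_norm f x.
Proof. exact: sqr_ge0. Qed.

Lemma square_integrableP f :
  sqi f <-> cmeasurable f /\ mu.-integrable setT (EFin \o sqr_norm f).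
Proof.
split=> -[mf fi]; split => //.
- apply/integrableP; split.
    by apply/measurable_EFinP; exact: measurable_sqr_norm.
  by under eq_integral do rewrite /= ger0_norm ?sqr_norm_ge0//.
- by apply: (integrable_lty _ fi).
Qed.

Lemma square_integrable_le f g : cmeasurable f -> sqi g ->
  (forall x, sqr_norm f x <= sqr_norm g x) -> sqi f.
Proof.
move=> mf /square_integrableP[mg ig] fg; apply/square_integrableP; split=> //.
apply: le_integrable ig => //.
  by apply/measurable_EFinP; exact: measurable_sqr_norm.
by move=> x _ /=; rewrite lee_fin !ger0_norm ?sqr_norm_ge0.
Qed.

Lemma cintegrable_dot f g : sqi f -> sqi g ->
  cintegrable (fun x => f x * (g x)^*).
Proof.
move=> /square_integrableP[mf If] /square_integrableP[mg Ig].
have [mr mi] := cmeasurableM mf (cmeasurable_conj mg).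
have b x : `|Re (f x * (g x)^*)| <= sqr_norm f x + sqr_norm g x /\
           `|Im (f x * (g x)^*)| <= sqr_norm f x + sqr_norm g x.
  rewrite /sqr_norm !normc_sqr; case: (f x) (g x) => a b [c e] /=.
  have := sqr_ge0 (a - c); have := sqr_ge0 (b - e).
  have := sqr_ge0 (a + c); have := sqr_ge0 (b + e).
  have := sqr_ge0 (a - e); have := sqr_ge0 (b - c).
  have := sqr_ge0 (a + e); have := sqr_ge0 (b + c).
  by rewrite !ler_norml => *; split; apply/andP; split; nra.
by split; apply: (le_integrable measurableT _ _ (integrableD measurableT If Ig));
  do ?[exact/measurable_EFinP]; move=> x _ /=;
  rewrite -[leRHS]/(`|sqr_norm f x + sqr_norm g x|%:E) lee_fin
    [leRHS]ger0_norm ?addr_ge0 ?sqr_norm_ge0//; have [] := b x.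
Qed.

Lemma cintegral_linear a f g : cintegrable f -> cintegrable g ->
  cintegral mu (fun x => a * f x + g x) = a * cintegral mu f + cintegral mu g.
Proof.
move=> [fr fi] [gr gi].
have iZ (c : R) r : mu.-integrable setT (EFin \o r) ->
    mu.-integrable setT (EFin \o (fun x => c * r x)).
  by move=> ir; exact: (integrableZl measurableT c ir).
have iD r s : mu.-integrable setT (EFin \o r) -> mu.-integrable setT (EFin \o s) ->
    mu.-integrable setT (EFin \o (fun x => r x + s x)).
  by move=> ir is'; exact: (integrableD measurableT ir is').
have lin (b c : R) r s t : mu.-integrable setT (EFin \o r) ->
    mu.-integrable setT (EFin \o s) -> mu.-integrable setT (EFin \o t) ->
    Rintegral mu setT (fun x => b * r x + c * s x + t x) =
    b * Rintegral mu setT r + c * Rintegral mu setT s + Rintegral mu setT t.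
  move=> ir is' it; rewrite RintegralD//; last by apply: iD; exact: iZ.
  by rewrite RintegralD//; [rewrite !RintegralZl|exact: iZ|exact: iZ].
rewrite /cintegral; case: a => b c.
transitivity ((b * Rintegral mu setT (fun x => Re (f x)) +
    (- c) * Rintegral mu setT (fun x => Im (f x)) +
    Rintegral mu setT (fun x => Re (g x))) +i*
  (b * Rintegral mu setT (fun x => Im (f x)) +
    c * Rintegral mu setT (fun x => Re (f x)) +
    Rintegral mu setT (fun x => Im (g x)))); last first.
  by apply/eqP; rewrite eq_complex/=; apply/andP; split; apply/eqP; ring.
rewrite -!lin//; congr (_ +i* _); apply: eq_Rintegral => x _;
  by case: (f x) (g x) => [? ?] [? ?] /=; ring.
Qed.

Lemma cintegral_ae f g : cmeasurable f -> cmeasurable g ->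
  {ae mu, forall x, f x = g x} -> cintegral mu f = cintegral mu g.
Proof.
move=> [fr fi] [gr gi] fg; rewrite /cintegral /Rintegral.
congr (fine _ +i* fine _); apply: ae_eq_integral => //; try exact/measurable_EFinP;
  by apply: filterS fg => x -> _.
Qed.

Lemma L2dotE f g : sqi f -> sqi g ->
  L2dot (L2class mu f) (L2class mu g) = cintegral mu (fun x => f x * (g x)^*).
Proof.
move=> sf sg; rewrite /L2dot; apply: cintegral_ae.
- apply: cmeasurableM; first exact: (L2repr_square_integrable _).1.
  by apply: cmeasurable_conj; exact: (L2repr_square_integrable _).1.
- by apply: cmeasurableM sf.1 (cmeasurable_conj sg.1).
- by apply: filterS2 (L2classP sf) (L2classP sg) => x -> ->.
Qed.

Lemma cintegral_sqr_norm f : sqi f ->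
  cintegral mu (fun x => f x * (f x)^*) = (Rintegral mu setT (sqr_norm f))%:C.
Proof.
move=> sf; rewrite /cintegral; under eq_Rintegral do rewrite mulc_conj.
under [X in _ +i* X]eq_Rintegral do rewrite mulc_conj.
by rewrite /= Rintegral_cst// mul0r.
Qed.

Local Notation N := (hnorm (@L2dot _ _ _ mu)).

Lemma hnorm_L2 f : sqi f -> N (L2class mu f) = Num.sqrt (Rintegral mu setT (sqr_norm f)).
Proof. by move=> sf; rewrite /hnorm L2dotE// cintegral_sqr_norm. Qed.

(** Translates norm estimates into estimates of extended integrals, the form in which Fatou and
    dominated convergence apply. *)
Lemma hnorm_L2_lt f (e : R) : sqi f -> 0 < e ->
  (N (L2class mu f) < e) = (\int[mu]_x (sqr_norm f x)%:E < (e ^+ 2)%:E)%E.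
Proof.
move=> sf e0; rewrite hnorm_L2// -[X in _ < X]gtr0_norm// -sqrtr_sqr.
have i0 : (0 <= \int[mu]_x (sqr_norm f x)%:E)%E.
  by apply: integral_ge0 => x _; rewrite lee_fin sqr_norm_ge0.
rewrite ltr_sqrt ?exprn_gt0// -lte_fin fineK//.
by rewrite ge0_fin_numE//; exact: sf.2.
Qed.

End complex_integral.

Lemma hnorm_L2_le d1 d2 (T1 : measurableType d1) (T2 : measurableType d2)
    (R : realType) (mu : {measure set T1 -> \bar R})
    (nu : {measure set T2 -> \bar R}) (f : T2 -> R[i]) (g : T1 -> R[i]) (B : R) :
  0 <= B -> square_integrable nu f -> square_integrable mu g ->
  (\int[nu]_x (sqr_norm f x)%:E <= (B ^+ 2)%:E * \int[mu]_x (sqr_norm g x)%:E)%E ->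
  hnorm (@L2dot _ _ _ nu) (L2class nu f) <= B * hnorm (@L2dot _ _ _ mu) (L2class mu g).
Proof.
move=> B0 sf sg fg; rewrite !hnorm_L2//.
rewrite -[X in X * _]ger0_norm// -sqrtr_sqr -sqrtrM ?sqr_ge0// ler_sqrt; last first.
  by rewrite mulr_ge0 ?sqr_ge0// Rintegral_ge0// => x _; exact: sqr_norm_ge0.
have fin d (T : measurableType d) (la : {measure set T -> \bar R}) h :
    square_integrable la h -> (\int[la]_x (sqr_norm h x)%:E)%E \is a fin_num.
  move=> sh; rewrite ge0_fin_numE//; first exact: sh.2.
  by apply: integral_ge0 => x _; rewrite lee_fin sqr_norm_ge0.
by rewrite -lee_fin EFinM !fineK// fin.
Qed.

Lemma limn_einf_le (R : realType) (u : (\bar R)^nat) (c : \bar R) :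
  (forall n, u n <= c)%E -> (limn_einf u <= c)%E.
Proof.
move=> uc; rewrite limn_einf_lim; apply: lime_le; first exact: is_cvg_einfs.
apply: nearW => n; apply: le_trans (uc n).
by apply: ereal_inf_lbound; exists n => /=.
Qed.

Lemma cvg_of_half_dist (R : realType) (u : R^nat) (C : R) :
  (forall n, `|u n.+1 - u n| <= C / 2 ^+ n) -> cvgn u.
Proof.
move=> h; have C0 : 0 <= C by have := h 0%N; rewrite expr0 divr1; exact: le_trans.
have : cvgn (series (telescope u)).
  apply: normed_cvg; apply: (series_le_cvg _ _ h) => [n|n|]//=.
    by rewrite divr_ge0// exprn_ge0.
  have := @is_cvg_geometric_series R C 2^-1.
  rewrite ger0_norm ?invr_ge0// invf_lt1// ltr1n => /(_ isT).
  rewrite (_ : geometric C 2^-1 = (fun n => C / 2 ^+ n))//.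
  by apply/funext => n /=; rewrite exprVn.
rewrite telescopeK => hc.
have -> : u = (fun n => (u n - u 0%N) + u 0%N) by apply/funext => n; rewrite subrK.
by apply: is_cvgD => //; exact: is_cvg_cst.
Qed.

(** * Completeness of $L^2$ and dominated convergence *)

Section L2_hilbert.
Context d (T : measurableType d) (R : realType) (mu : {measure set T -> \bar R}).
Implicit Types (f g h : T -> R[i]) (u v : L2 mu).
Local Notation sqi := (square_integrable mu).
Local Notation N := (hnorm (@L2dot _ _ _ mu)).

Lemma sqr_normE f x : sqr_norm f x = Re (f x) ^+ 2 + Im (f x) ^+ 2.
Proof. exact: normc_sqr. Qed.

Lemma sqr_norm_cvg (f_ : nat -> T -> R[i]) f g x :
  Re (f_ n x) @[n --> \oo] --> Re (f x) -> Im (f_ n x) @[n --> \oo] --> Im (f x) ->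
  sqr_norm (f_ n - g) x @[n --> \oo] --> sqr_norm (f - g) x.
Proof.
move=> hr hi.
have E h : sqr_norm (h - g) x = (Re (h x) - Re (g x)) * (Re (h x) - Re (g x)) +
    (Im (h x) - Im (g x)) * (Im (h x) - Im (g x)).
  have -> : sqr_norm (h - g) x = normc (h x - g x) ^+ 2 by [].
  by rewrite normc_sqr -!expr2; case: (h x) (g x) => [? ?] [].
rewrite E; under eq_fun do rewrite E.
by apply: cvgD; apply: cvgM; apply: cvgB => //; exact: cvg_cst.
Qed.

(** Riesz-Fischer. Along a fast subsequence with increments [D k] the weighted sum [G] of the 4^k
    |D_k|^2 is integrable. Where it is finite, |D_k| is at most sqrt G / 2^k, so the subsequence
    converges pointwise. *)
Lemma L2_complete (u : nat -> L2 mu) :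
  (forall e : R, 0 < e -> exists n, forall j k, (n <= j)%N -> (n <= k)%N ->
     N (u j - u k) < e) ->
  exists l, forall e : R, 0 < e -> exists n, forall k, (n <= k)%N -> N (l - u k) < e.
Proof.
move=> cauchy.
pose f n := L2repr (u n).
have sf n : sqi (f n) by exact: L2repr_square_integrable.
have uE j k : u j - u k = L2class mu (f j - f k).
  by rewrite L2classB// !L2reprK.
have sfB j k : sqi (f j - f k) by exact: square_integrableB.
(* The integral of 4^k |D_k|^2 is then at most 1 / (4 * 4^k), below the summable bound 1 /
   2^(k+1). *)
pose eps k : R := (4 ^+ k * 2)^-1.
have eps0 k : 0 < eps k by rewrite invr_gt0 mulr_gt0 ?exprn_gt0.
have [n0 hn0] := choice (fun k => cauchy _ (eps0 k)).
(* A cumulative sum is nondecreasing and dominates both [n0 k] and [k]. *)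
pose phi k := (\sum_(i < k.+1) (n0 i).+1)%N.
have phi_ge k : (n0 k <= phi k)%N.
  by rewrite /phi big_ord_recr (leq_trans (leqnSn _))// leq_addl.
have phi_homo k : (phi k <= phi k.+1)%N by rewrite {2}/phi big_ord_recr leq_addr.
have phi_large k : (k <= phi k)%N.
  by elim: k => // k ih; rewrite /phi big_ord_recr/= (leq_ltn_trans ih)// addnS ltnS leq_addr.
pose D k := f (phi k.+1) - f (phi k).
have iD k : (\int[mu]_x (sqr_norm (D k) x)%:E <= (eps k ^+ 2)%:E)%E.
  rewrite /D ltW// -hnorm_L2_lt// -uE; apply: hn0 => //.
  exact: leq_trans (phi_ge k) (phi_homo k).
have mD k : measurable_fun setT (sqr_norm (D k)).
  exact: measurable_sqr_norm (sfB _ _).1.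
pose G x := (\sum_(k <oo) (4 ^+ k * sqr_norm (D k) x)%:E)%E.
have mterm k : measurable_fun setT (fun x => (4 ^+ k * sqr_norm (D k) x)%:E).
  by apply/measurable_EFinP; apply: measurable_funM.
have term0 k x : (0 <= (4 ^+ k * sqr_norm (D k) x)%:E)%E.
  by rewrite lee_fin mulr_ge0 ?sqr_norm_ge0 ?exprn_ge0.
have mG : measurable_fun setT G by apply: ge0_emeasurable_sum.
have iG : (\int[mu]_x G x < +oo)%E.
  rewrite integral_nneseries//.
  apply: (@le_lt_trans _ _ 1%:E); last exact: ltry.
  apply: le_trans (@epsilon_trick0 R 1 xpredT ler01).
  apply: lee_nneseries => [k _ _|k _]; first exact: integral_ge0.
  under eq_integral do rewrite EFinM.
  rewrite ge0_integralZl_EFin ?exprn_ge0//; last 2 first.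
    by move=> x _; rewrite lee_fin sqr_norm_ge0.
    exact/measurable_EFinP.
  apply: (@le_trans _ _ ((4 ^+ k)%:E * (eps k ^+ 2)%:E)%E).
    by rewrite lee_pmul2l// lte_fin exprn_gt0.
  rewrite -EFinM lee_fin /eps natrX div1r.
  have p4 : 4 ^+ k != 0 :> R by rewrite expf_neq0.
  have -> : 4 ^+ k * (4 ^+ k * 2)^-1 ^+ 2 = (4 * 4 ^+ k)^-1 :> R by field.
  rewrite lef_pV2 ?posrE ?mulr_gt0 ?exprn_gt0//.
  have le24 : 2 ^+ k <= 4 ^+ k :> R by rewrite lerXn2r ?nnegrE// ler_nat.
  by rewrite exprS; have : 0 <= 2 ^+ k :> R by [rewrite exprn_ge0]; lra.
have aeG : {ae mu, forall x, (G x < +oo)%E}.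
  have : mu.-integrable setT G.
    apply/integrableP; split => //.
    rewrite (eq_integral G)// => x _; rewrite gee0_abs//; exact: nneseries_ge0.
  move=> /(integrable_ae measurableT); apply: filterS => x /(_ Logic.I).
  by rewrite ge0_fin_numE ?nneseries_ge0.
pose A := [set x | (G x < +oo)%E].
have mA : measurable A.
  rewrite -[A]setTI; exact: emeasurable_fun_infty_o.
(* Cutting off outside the convergence set makes the sequence converge at every point, so that the
   limit is measurable. *)
pose f' k x := (\1_A x)%:C * f (phi k) x.
have cvgf x : A x -> cvgn (fun k => Re (f (phi k) x)) /\ cvgn (fun k => Im (f (phi k) x)).
  move=> Ax.
  have Gfin : G x \is a fin_num by rewrite ge0_fin_numE ?nneseries_ge0.
  pose M := fine (G x).
  have le k : sqr_norm (D k) x <= M / 4 ^+ k.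
    rewrite ler_pdivlMr ?exprn_gt0// mulrC -lee_fin fineK// /G.
    by rewrite (nneseriesD1 (n := k))// leeDl// nneseries_ge0.
  have M0 : 0 <= M by rewrite fine_ge0// nneseries_ge0.
  have le2 k (a : R) : a ^+ 2 <= sqr_norm (D k) x -> `|a| <= Num.sqrt M / 2 ^+ k.
    move=> ha; rewrite -sqrtr_sqr.
    have -> : Num.sqrt M / 2 ^+ k = Num.sqrt (M / 4 ^+ k).
      rewrite sqrtrM// sqrtrV ?exprn_ge0//; congr (_ / _).
      rewrite (_ : 4 ^+ k = (2 ^+ k) ^+ 2).
        by rewrite sqrtr_sqr ger0_norm// exprn_ge0.
      by rewrite -exprM mulnC exprM; congr (_ ^+ _); rewrite expr2 -natrM.
    by apply: ler_wsqrtr; exact: le_trans ha (le k).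
  split; apply: (@cvg_of_half_dist _ _ (Num.sqrt M)) => k; apply: le2;
    rewrite /sqr_norm normc_sqr /D -[(f (phi k.+1) - f (phi k)) x]/(f (phi k.+1) x - f (phi k) x);
    case: (f (phi k.+1) x) (f (phi k) x) => [? ?] [? ?] /=.
    by rewrite lerDl sqr_ge0.
  by rewrite lerDr sqr_ge0.
have cvgf' x : cvgn (fun k => Re (f' k x)) /\ cvgn (fun k => Im (f' k x)).
  rewrite /f' indicE; case: (boolP (x \in A)) => [/set_mem/cvgf[hr hi]|_].
    by split; under eq_fun do rewrite mul1r.
  by split; under eq_fun do rewrite mul0r; exact: is_cvg_cst.
pose l x := limn (fun k => Re (f' k x)) +i* limn (fun k => Im (f' k x)).
have mf' k : cmeasurable (f' k).
  apply: cmeasurableM; last exact: (sf _).1.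
  by apply: cmeasurable_real; exact: measurable_indic.
have ml : cmeasurable l.
  split.
    apply: (@measurable_fun_cvg _ _ _ _ (fun k x => Re (f' k x))) => [k|x _].
      exact: (mf' k).1.
    exact: (cvgf' x).1.
  apply: (@measurable_fun_cvg _ _ _ _ (fun k x => Im (f' k x))) => [k|x _].
    exact: (mf' k).2.
  exact: (cvgf' x).2.
have aef' k : {ae mu, forall x, f' k x = f (phi k) x}.
  by apply: filterS aeG => x Ax; rewrite /f' indicE mem_set// mul1r.
(* Fatou along the subsequence: for fixed [k] the Cauchy bound on [f (phi j) - f k] survives the
   limit in [j]. *)
have key (e : R) : 0 < e -> exists n, forall k, (n <= k)%N ->
    (\int[mu]_x (sqr_norm (l - f k) x)%:E <= (e ^+ 2)%:E)%E.
  move=> e0; have [n hn] := cauchy e e0; exists n => k nk.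
  pose F j x := (sqr_norm (f' (j + n)%N - f k) x)%:E.
  have mF j : measurable_fun setT (F j).
    apply/measurable_EFinP/measurable_sqr_norm.
    have := cmeasurableD (mf' (j + n)%N) (cmeasurableM (cmeasurable_cst _ (-1)) (sf k).1).
    by congr cmeasurable; apply/funext => x; rewrite mulN1r.
  have F0 j x : (0 <= F j x)%E by rewrite lee_fin sqr_norm_ge0.
  have -> : (\int[mu]_x (sqr_norm (l - f k) x)%:E = \int[mu]_x limn_einf (F^~ x))%E.
    apply: eq_integral => x _.
    have cF : F j x @[j --> \oo] --> (sqr_norm (l - f k) x)%:E.
      apply: cvg_EFin; first by apply: nearW.
      apply: sqr_norm_cvg.
        by have := (cvgf' x).1; rewrite -(cvg_shiftn n).
      by have := (cvgf' x).2; rewrite -(cvg_shiftn n).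
    by rewrite (cvg_limn_einf_sup cF).1.
  apply: le_trans (fatou mu measurableT mF (fun j x _ => F0 j x)) _.
  apply: limn_einf_le => j.
  rewrite (_ : (\int[mu]_x F j x)%E =
      (\int[mu]_x (sqr_norm (f (phi (j + n)%N) - f k) x)%:E)%E).
    rewrite ltW// -hnorm_L2_lt// -uE; apply: hn => //.
    by rewrite (leq_trans _ (phi_large _))// leq_addl.
  apply: ge0_ae_eq_integral => //.
  - by apply/measurable_EFinP/measurable_sqr_norm; exact: (sfB _ _).1.
  - by move=> x _; rewrite lee_fin sqr_norm_ge0.
  - apply: filterS (aef' (j + n)%N) => x hx _.
    by rewrite /F /sqr_norm -[(f' _ - _) x]/(f' (j + n)%N x - f k x) hx.
have sl : sqi l.
  have [n /(_ n (leqnn n)) hn] := key 1 ltr01.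
  rewrite -[l](subrK (f n)); apply: square_integrableD => //; split.
    have := cmeasurableD ml (cmeasurableM (cmeasurable_cst _ (-1)) (sf n).1).
    by congr cmeasurable; apply/funext => x; rewrite mulN1r.
  by apply: le_lt_trans hn _; exact: ltry.
exists (L2class mu l) => e e0.
have e2 : 0 < e / 2 by rewrite divr_gt0.
have [n hn] := key _ e2; exists n => k nk.
have -> : L2class mu l - u k = L2class mu (l - f k).
  by rewrite L2classB// L2reprK.
rewrite hnorm_L2_lt//; last exact: square_integrableB.
apply: le_lt_trans (hn k nk) _; rewrite lte_fin ltrXn2r// ?ltW//.
by rewrite ltr_pdivrMr// ltr_pMr// ltr1n.
Qed.
End L2_hilbert.

Lemma Re_scale (R : realType) (r : R) (z : R[i]) : Re (r%:C * z) = r * Re z.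
Proof. by case: z => a b /=; rewrite mul0r subr0. Qed.

Lemma Im_scale (R : realType) (r : R) (z : R[i]) : Im (r%:C * z) = r * Im z.
Proof. by case: z => a b /=; rewrite mul0r addr0. Qed.

Section L2_operators.
Context d (T : measurableType d) (R : realType) (mu : {measure set T -> \bar R}).
Implicit Types (f g h : T -> R[i]) (u v : L2 mu) (V : set (L2 mu)).
Local Notation sqi := (square_integrable mu).
Local Notation dot := (@L2dot _ _ _ mu).
Local Notation N := (hnorm dot).

Lemma L2_ind (P : L2 mu -> Prop) : (forall f, sqi f -> P (L2class mu f)) ->
  forall u, P u.
Proof. by move=> h u; rewrite -[u]L2reprK; apply/h/L2repr_square_integrable. Qed.

Lemma cintegral_conj f : cintegrable mu f ->
  cintegral mu (fun x => (f x)^*) = (cintegral mu f)^*.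
Proof.
move=> [fr fi]; rewrite /cintegral; apply/eqP; rewrite eq_complex/=.
apply/andP; split; apply/eqP.
  by apply: eq_Rintegral => x _; case: (f x).
rewrite -mulN1r -RintegralZl//; apply: eq_Rintegral => x _.
by case: (f x) => a b /=; rewrite mulN1r.
Qed.

Lemma Rintegral_sqr_norm_eq0 f : sqi f -> Rintegral mu setT (sqr_norm f) = 0 ->
  L2class mu f = 0.
Proof.
move=> sf f0; rewrite -(L2class0 mu); apply: L2class_eq => //.
  exact: square_integrable0.
have /square_integrableP[mf If] := sf.
have mE : measurable_fun setT (EFin \o sqr_norm f).
  by apply/measurable_EFinP; exact: measurable_sqr_norm.
have /(ae_eq_integral_abs mu measurableT mE) : (\int[mu]_x `|(EFin \o sqr_norm f) x|)%E = 0%E.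
  under eq_integral do rewrite /= ger0_norm ?sqr_norm_ge0//.
  rewrite -[LHS]fineK; first by rewrite -/(Rintegral mu setT _) f0.
  rewrite ge0_fin_numE; first exact: sf.2.
  by apply: integral_ge0 => x _; rewrite lee_fin sqr_norm_ge0.
apply: filterS => x /(_ Logic.I) /=.
rewrite /sqr_norm => -[] /eqP; rewrite sqrf_eq0 => /eqP.
exact: eq0_normc.
Qed.

Lemma hilbert_L2 : hilbert dot.
Proof.
split.
- move=> a; elim/L2_ind => f sf; elim/L2_ind => g sg; elim/L2_ind => h sh.
  rewrite -L2class_linear// !L2dotE//; last exact: square_integrable_linear.
  rewrite -cintegral_linear; [|exact: cintegrable_dot..].
  congr cintegral; apply/funext => x.
  by rewrite mulrA -mulrDl.
- elim/L2_ind => f sf; elim/L2_ind => g sg.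
  rewrite !L2dotE// -cintegral_conj; last exact: cintegrable_dot.
  congr cintegral; apply/funext => x.
  by rewrite rmorphM/= conjCK mulrC.
- elim/L2_ind => f sf; rewrite L2dotE// cintegral_sqr_norm//.
  rewrite lecR; apply: Rintegral_ge0 => x _; exact: sqr_norm_ge0.
- elim/L2_ind => f sf; rewrite L2dotE// cintegral_sqr_norm// => -[].
  exact: Rintegral_sqr_norm_eq0.
- exact: L2_complete.
Qed.

Lemma sqr_norm_distC f g x : sqr_norm (f - g) x = sqr_norm (g - f) x.
Proof.
rewrite !sqr_normE -[(f - g) x]/(f x - g x) -[(g - f) x]/(g x - f x).
by case: (f x) (g x) => a b [c e] /=; ring.
Qed.

(** Dominated convergence for |f - f_n|^2, with bound 4 |g|^2. A single good [n] for each [e] is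
    what membership in a closed subspace asks for. *)
Lemma L2_dct (f_ : nat -> T -> R[i]) f g :
  (forall n, cmeasurable (f_ n)) -> cmeasurable f -> sqi g ->
  (forall n x, sqr_norm (f_ n) x <= sqr_norm g x) ->
  (forall x, Re (f_ n x) @[n --> \oo] --> Re (f x)) ->
  (forall x, Im (f_ n x) @[n --> \oo] --> Im (f x)) ->
  sqi f /\ forall e : R, 0 < e -> exists n, N (L2class mu f - L2class mu (f_ n)) < e.
Proof.
move=> mf_ mf sg fg hr hi.
have sf_ n : sqi (f_ n) by exact: square_integrable_le (mf_ n) sg (fg n).
have sqc x : sqr_norm (f_ n) x @[n --> \oo] --> sqr_norm f x.
  have := @sqr_norm_cvg _ _ _ f_ f 0 x (hr x) (hi x).
  by rewrite subr0; under eq_fun do rewrite subr0.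
have sf : sqi f.
  apply: (square_integrable_le mf sg) => x.
  by rewrite -(cvg_lim _ (sqc x))//; apply: limr_le; [exact: cvgP (sqc x)|exact: nearW].
split => // e e0.
pose F n x := (sqr_norm (f - f_ n) x)%:E.
have F4 n x : sqr_norm (f - f_ n) x <= 4 * sqr_norm g x.
  have h1 : sqr_norm f x <= sqr_norm g x.
    by rewrite -(cvg_lim _ (sqc x))//; apply: limr_le; [exact: cvgP (sqc x)|exact: nearW].
  have h2 := fg n x.
  suff : sqr_norm (f - f_ n) x <= 2 * sqr_norm f x + 2 * sqr_norm (f_ n) x.
    by move: h1 h2; lra.
  rewrite !sqr_normE -[(f - f_ n) x]/(f x - f_ n x).
  case: (f x) (f_ n x) => a b [c e'] /=.
  by have := sqr_ge0 (a + c); have := sqr_ge0 (b + e'); nra.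
have /square_integrableP[mg Ig] := sg.
have cvg0 : (\int[mu]_x F n x)%E @[n --> \oo] --> (\int[mu]_x (cst 0) x)%E.
  apply: (@dominated_cvg _ _ _ mu setT measurableT F _ (fun x => (4 * sqr_norm g x)%:E)) => //.
  - move=> n; apply/measurable_EFinP/measurable_sqr_norm.
    exact: (square_integrableB sf (sf_ n)).1.
  - move=> x _; apply: cvg_EFin; first exact: nearW.
    have -> : 0 = sqr_norm (f - f) x.
      by rewrite subrr /sqr_norm normc0 expr0n.
    have -> : fine \o F ^~ x = (fun n => sqr_norm (f_ n - f) x).
      by apply/funext => n /=; rewrite sqr_norm_distC.
    exact: sqr_norm_cvg.
  - exact: (integrableZl measurableT 4 Ig).
  - by move=> n x _; rewrite /F abse_EFin lee_fin ger0_norm ?sqr_norm_ge0.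
rewrite integral0 in cvg0.
have e2 : (0 < (e ^+ 2)%:E :> \bar R)%E by rewrite lte_fin exprn_gt0.
have [n _ /(_ n (leqnn n)) /= hn] := cvg0 _ (open_ereal_lt' e2).
exists n; rewrite -L2classB// hnorm_L2_lt//; exact: square_integrableB.
Qed.

End L2_operators.

(** * Bounded multipliers *)

Lemma bernoulli_ineq (R : realDomainType) (t : R) n : -1 <= t ->
  1 + n%:R * t <= (1 + t) ^+ n.
Proof.
move=> t1; have t0 : 0 <= 1 + t by rewrite -lerBlDl sub0r.
elim: n => [|n ih]; first by rewrite mul0r addr0 expr0.
rewrite exprS (le_trans _ (ler_wpM2l t0 ih))//.
have : 0 <= n%:R * t ^+ 2 by rewrite mulr_ge0 ?sqr_ge0.
by rewrite -[n.+1]addn1 natrD; nra.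
Qed.

(** With s = sqrt r and c = 1 / s - 1, Bernoulli gives n c <= s^-n, hence n r^n <= s^n / c. *)
Lemma cvg_natr_mul_geometric (R : realType) (r : R) : 0 <= r < 1 ->
  n%:R * r ^+ n @[n --> \oo] --> 0.
Proof.
move=> /andP[]; rewrite le_eqVlt => /predU1P[<- _|r0 r1].
  rewrite (_ : (fun _ => _) = (fun=> 0)); first exact: cvg_cst.
  by apply/funext => -[|n]; rewrite ?mul0r// expr0n mulr0.
pose s := Num.sqrt r; have s0 : 0 < s by rewrite sqrtr_gt0.
have s1 : s < 1 by rewrite -sqrtr1 ltr_sqrt.
pose c := s^-1 - 1; have c0 : 0 < c by rewrite subr_gt0 invf_gt1.
have le n : n%:R * r ^+ n <= c^-1 * s ^+ n.
  have -> : r ^+ n = s ^+ n * s ^+ n by rewrite -exprMn -expr2 sqr_sqrtr// ltW.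
  rewrite mulrA.
  have s0' := ltW s0; rewrite ler_wpM2r ?exprn_ge0//.
  have := @bernoulli_ineq R c n; rewrite (_ : 1 + c = s^-1); last by rewrite /c; ring.
  rewrite exprVn => h.
  rewrite -(ler_pM2r c0) mulVf ?gt_eqF// mulrAC -ler_pdivlMr ?exprn_gt0//.
  by rewrite mul1r (le_trans _ (h _)); lra.
apply: (@squeeze_cvgr _ _ _ _ (fun=> 0) (fun n => c^-1 * s ^+ n)).
- have r0' := ltW r0; apply: nearW => n; by rewrite le mulr_ge0 ?exprn_ge0.
- exact: cvg_cst.
- by apply: cvg_geometric; rewrite ger0_norm// ltW.
Qed.

(** Bernoulli twice. Below 1/2 the power is at least 1 - n (2 y)^n. From 1/2 on, 1 - u <= 1 / (1 +
    u) bounds it by 1 / (1 + n (2 y)^n), at most 1 / (n + 1). The factor n in the exponent decides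
    the case y = 1/2: without it the limit there would be 1 / e. *)
Lemma cvg_polynomial_step (R : realType) (y : R) : 0 <= y <= 1 ->
  (1 - y ^+ n) ^+ (n * 2 ^ n) @[n --> \oo] --> ((y < 2^-1)%R%:R : R).
Proof.
move=> /andP[y0 y1].
have yn n : 0 <= y ^+ n <= 1 by rewrite exprn_ge0// exprn_ile1.
have q01 n : 0 <= (1 - y ^+ n) ^+ (n * 2 ^ n) <= 1.
  by have /andP[? ?] := yn n; rewrite exprn_ge0 ?exprn_ile1//; lra.
have [lt|ge] := ltP y 2^-1.
  apply: (@squeeze_cvgr _ _ _ _ (fun n => 1 - n%:R * (2 * y) ^+ n) (fun=> 1)).
  - apply: nearW => n; have /andP[_ ->] := q01 n; rewrite andbT.
    have /andP[a b] := yn n; have := @bernoulli_ineq R (- y ^+ n) (n * 2 ^ n).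
    by rewrite natrM natrX exprMn lerN2 mulrN mulrA; apply.
  - rewrite -[X in _ --> X]subr0; apply: cvgB; first exact: cvg_cst.
    by apply: cvg_natr_mul_geometric; apply/andP; split; lra.
  - exact: cvg_cst.
apply: (@squeeze_cvgr _ _ _ _ (fun=> 0) (fun n => harmonic n)).
- apply: nearW => n; have /andP[-> _] := q01 n; rewrite /=.
  have /andP[a b] := yn n.
  have d0 : 0 < 1 + y ^+ n by lra.
  apply: (@le_trans _ _ ((1 + y ^+ n)^-1 ^+ (n * 2 ^ n))).
    apply: lerXn2r; rewrite ?nnegrE ?invr_ge0; [lra|lra|].
    by rewrite -[leRHS]mul1r ler_pdivlMr//; nra.
  rewrite exprVn lef_pV2 ?posrE ?exprn_gt0// (le_trans _ (bernoulli_ineq _ _))//; last lra.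
  rewrite -addn1 natrD addrC lerD2l natrM natrX -mulrA -exprMn.
  rewrite ler_peMr// exprn_ege1//; lra.
- exact: cvg_cst.
- exact: cvg_harmonic.
Qed.

Section multipliers.
Context d (T : measurableType d) (R : realType) (mu : {measure set T -> \bar R}).
Implicit Types (f g h : T -> R[i]) (u v : L2 mu) (V : set (L2 mu)).
Local Notation sqi := (square_integrable mu).
Local Notation dot := (@L2dot _ _ _ mu).
Local Notation N := (hnorm dot).

Definition cbounded h := cmeasurable h /\ exists B : R, forall x, normc (h x) <= B.

Definition mulL2 h u : L2 mu := L2class mu (fun x => h x * L2repr u x).

Lemma sqr_norm_mul_le h (B : R) f x : normc (h x) <= B ->
  sqr_norm (fun x => h x * f x) x <= sqr_norm (B%:C *: f) x.
Proof.
move=> hB; rewrite /sqr_norm -[(B%:C *: f) x]/(B%:C * f x) !normcM !exprMn.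
rewrite ler_wpM2r ?sqr_ge0// normc_real ler_sqr ?nnegrE ?normc_ge0//.
exact: le_trans hB (ler_norm _).
Qed.

Lemma square_integrable_mul h f : cbounded h -> sqi f -> sqi (fun x => h x * f x).
Proof.
move=> [mh [B hB]] sf.
apply: (square_integrable_le (cmeasurableM mh sf.1) (square_integrableZ B%:C sf)).
by move=> x; exact: sqr_norm_mul_le.
Qed.

Lemma mulL2_class h f : cbounded h -> sqi f ->
  mulL2 h (L2class mu f) = L2class mu (fun x => h x * f x).
Proof.
move=> bh sf; apply: L2class_eq; [|exact: square_integrable_mul|].
  by apply: square_integrable_mul => //; exact: L2repr_square_integrable.
by apply: filterS (L2classP sf) => x ->.
Qed.

Lemma mulL2_linear h : cbounded h -> linear (mulL2 h).
Proof.
move=> bh a; elim/L2_ind => f sf; elim/L2_ind => g sg.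
rewrite -L2class_linear// !mulL2_class//; last exact: square_integrable_linear.
rewrite -L2class_linear//; [|exact: square_integrable_mul..].
congr L2class; apply/funext => x.
rewrite -[LHS]/(h x * (a * f x + g x)) -[RHS]/(a * (h x * f x) + h x * g x).
by rewrite mulrDr mulrCA.
Qed.

Lemma mulL2_bound h (B : R) : cmeasurable h -> (forall x, normc (h x) <= B) ->
  forall u, N (mulL2 h u) <= B * N u.
Proof.
move=> mh hB; have bh : cbounded h by split=> //; exists B.
elim/L2_ind => f sf; rewrite mulL2_class//.
have B0 : 0 <= B by apply: le_trans (hB point); exact: normc_ge0.
apply: hnorm_L2_le => //; first exact: square_integrable_mul.
rewrite -ge0_integralZl_EFin ?sqr_ge0//; last 2 first.
- by move=> x _; rewrite lee_fin sqr_norm_ge0.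
- by apply/measurable_EFinP/measurable_sqr_norm; exact: sf.1.
apply: ge0_le_integral => //.
- by move=> x _; rewrite lee_fin sqr_norm_ge0.
- by apply/measurable_EFinP/measurable_sqr_norm/cmeasurableM => //; exact: sf.1.
- apply/measurable_EFinP/measurable_funM => //.
  by apply: measurable_sqr_norm; exact: sf.1.
- move=> x _; rewrite -EFinM lee_fin (le_trans (sqr_norm_mul_le _ (hB x)))//.
  rewrite /sqr_norm -[(B%:C *: f) x]/(B%:C * f x) normcM exprMn normc_real.
  by rewrite ger0_norm.
Qed.

Lemma cbounded_cst (c : R[i]) : cbounded (fun=> c).
Proof. by split; [exact: cmeasurable_cst|exists (normc c)]. Qed.

Lemma cboundedM g h : cbounded g -> cbounded h -> cbounded (fun x => g x * h x).
Proof.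
move=> [mg [B gB]] [mh [C hC]]; split; first exact: cmeasurableM.
by exists (B * C) => x; rewrite normcM ler_pM ?normc_ge0.
Qed.

Lemma cboundedD g h : cbounded g -> cbounded h -> cbounded (fun x => g x + h x).
Proof.
move=> [mg [B gB]] [mh [C hC]]; split; first exact: cmeasurableD.
by exists (B + C) => x; rewrite (le_trans (le_normcD _ _))// lerD.
Qed.

Definition multiplier V h := cbounded h /\ forall u, V u -> V (mulL2 h u).

Section fix_subspace.
Context V (VV : closed_subspace dot V).

Lemma multiplier_cst (c : R[i]) : multiplier V (fun=> c).
Proof.
split; first exact: cbounded_cst.
elim/L2_ind => f sf Vf; rewrite mulL2_class//; last exact: cbounded_cst.
have [V0 VD _] := VV; have := VD c _ _ Vf V0.
by rewrite addr0 -L2classZ.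
Qed.

Lemma multiplierM g h : multiplier V g -> multiplier V h ->
  multiplier V (fun x => g x * h x).
Proof.
move=> [bg Vg] [bh Vh]; split; first exact: cboundedM.
elim/L2_ind => f sf Vf; have := Vg _ (Vh _ Vf).
rewrite !mulL2_class//; [|exact: cboundedM|exact: square_integrable_mul].
by congr (V (L2class _ _)); apply/funext => x; rewrite mulrA.
Qed.

Lemma multiplierD g h : multiplier V g -> multiplier V h ->
  multiplier V (fun x => g x + h x).
Proof.
move=> [bg Vg] [bh Vh]; split; first exact: cboundedD.
elim/L2_ind => f sf Vf; have [V0 VD _] := VV.
have := VD 1 _ _ (Vg _ Vf) (Vh _ Vf); rewrite scale1r !mulL2_class//.
  rewrite -L2classD; [|exact: square_integrable_mul..].
  by congr (V (L2class _ _)); apply/funext => x; rewrite mulrDl.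
exact: cboundedD.
Qed.

Lemma multiplierX h n : multiplier V h -> multiplier V (fun x => h x ^+ n).
Proof.
move=> Vh; elim: n => [|n ih]; first exact: multiplier_cst.
by under eq_fun do rewrite exprS; exact: multiplierM.
Qed.

(** A bounded pointwise limit of multipliers applied to [f] converges in norm, with [B] |f| as
    dominating function, and [V] is closed. *)
Lemma multiplier_lim (h_ : nat -> T -> R[i]) h (B : R) :
  (forall n, multiplier V (h_ n)) -> (forall n x, normc (h_ n x) <= B) ->
  cbounded h -> (forall x, Re (h_ n x) @[n --> \oo] --> Re (h x)) ->
  (forall x, Im (h_ n x) @[n --> \oo] --> Im (h x)) -> multiplier V h.
Proof.
move=> Vh hB bh hr hi; split => //; elim/L2_ind => f sf Vf.
rewrite mulL2_class//; have [V0 VD Vc] := VV; apply: Vc => e e0.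
have [] := @L2_dct _ _ _ mu (fun n x => h_ n x * f x) (fun x => h x * f x) (B%:C *: f).
- by move=> n; apply: cmeasurableM; [exact: (Vh n).1.1|exact: sf.1].
- by apply: cmeasurableM; [exact: bh.1|exact: sf.1].
- exact: square_integrableZ.
- by move=> n x; exact: sqr_norm_mul_le.
- move=> x; have ReE (z w : R[i]) : Re (z * w) = Re z * Re w - Im z * Im w.
    by case: z w => ? ? [].
  rewrite ReE; under eq_fun do rewrite ReE.
  by apply: cvgB; apply: cvgM => //; exact: cvg_cst.
- move=> x; have ImE (z w : R[i]) : Im (z * w) = Re z * Im w + Im z * Re w.
    by case: z w => ? ? [].
  rewrite ImE; under eq_fun do rewrite ImE.
  by apply: cvgD; apply: cvgM => //; exact: cvg_cst.
- move=> _ /(_ e e0)[n hn]; exists (mulL2 (h_ n) (L2class mu f)).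
    exact: (Vh n).2.
  by rewrite mulL2_class//; exact: (Vh n).1.
Qed.

Lemma multiplier_real_lim (r_ : nat -> T -> R) (r : T -> R) (B : R) :
  (forall n, multiplier V (fun x => (r_ n x)%:C)) ->
  (forall n x, `|r_ n x| <= B) -> measurable_fun setT r ->
  (forall x, r_ n x @[n --> \oo] --> r x) -> multiplier V (fun x => (r x)%:C).
Proof.
move=> Vr rB mr rr.
apply: (@multiplier_lim (fun n x => (r_ n x)%:C) _ B) => //.
- by move=> n x; rewrite normc_real.
- split; first exact: cmeasurable_real.
  exists B => x; rewrite normc_real;
    have h : `|r_ n x| @[n --> \oo] --> `|r x| by apply: cvg_norm; exact: rr.
  by rewrite -(cvg_lim _ h)//; apply: limr_le; [exact: cvgP h|exact: nearW].
- by move=> x /=; exact: cvg_cst.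
Qed.

Definition mult_set (E : set T) :=
  measurable E /\ multiplier V (fun x => (\1_E x)%:C).

Lemma mult_set0 : mult_set set0.
Proof.
split=> //; have := multiplier_cst 0; congr multiplier.
by apply/funext => x; rewrite indic0.
Qed.

Lemma mult_setC E : mult_set E -> mult_set (~` E).
Proof.
move=> [mE VE]; split; first exact: measurableC.
have := multiplierD (multiplier_cst 1) (multiplierM (multiplier_cst (-1)) VE).
congr multiplier; apply/funext => x; rewrite !indicE in_setC.
by case: (x \in E); rewrite /= ?mulr1 ?mulr0 ?addr0 ?subrr.
Qed.

Lemma mult_setI E F : mult_set E -> mult_set F -> mult_set (E `&` F).
Proof.
move=> [mE VE] [mF VF]; split; first exact: measurableI.
have := multiplierM VE VF; congr multiplier; apply/funext => x.
by rewrite -rmorphM/= indicI.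
Qed.

Lemma mult_setU E F : mult_set E -> mult_set F -> mult_set (E `|` F).
Proof.
move=> hE hF; rewrite -[E `|` F]setCK setCU.
by apply: mult_setC; apply: mult_setI; exact: mult_setC.
Qed.

Lemma mult_set_bigcup (F : (set T)^nat) : (forall n, mult_set (F n)) ->
  mult_set (\bigcup_n F n).
Proof.
move=> hF; have mU : measurable (\bigcup_n F n).
  by apply: bigcup_measurable => n _; exact: (hF n).1.
split=> //.
have hU n : mult_set (\bigcup_(i < n) F i).
  elim: n => [|n ih]; first by rewrite II0 bigcup_set0; exact: mult_set0.
  by rewrite IIS bigcup_setU bigcup_set1; exact: mult_setU.
apply: (@multiplier_real_lim (fun n => \1_(\bigcup_(i < n) F i)) _ 1).
- by move=> n; exact: (hU n).2.
- by move=> n x; rewrite indicE normr_nat; case: (_ \in _).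
- exact: measurable_indic.
- move=> x; apply: cvg_near_cst.
  have [Ux|nU] := pselect ((\bigcup_n F n) x).
    have [n _ Fnx] := Ux; exists n.+1 => // k /= nk.
    by rewrite !indicE !mem_set//; exists n.
  apply: nearW => n; rewrite !indicE (memNset nU) memNset// => -[k _ Fkx].
  by apply: nU; exists k.
Qed.

Lemma mult_set_sigma_algebra : sigma_algebra setT mult_set.
Proof.
split; [exact: mult_set0|by move=> A hA; rewrite setTD; exact: mult_setC|].
exact: mult_set_bigcup.
Qed.

(** The affine change from [r] to [y] moves the threshold [a] to 1/2; the constant [c] keeps |r - a|
    / c below 1/4, so that [y] stays within [0, 1]. Polynomials in [r] then converge to the
    indicator by [cvg_polynomial_step]. *)
Lemma mult_set_lt (r : T -> R) (B a : R) : measurable_fun setT r ->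
  multiplier V (fun x => (r x)%:C) -> (forall x, `|r x| <= B) ->
  mult_set [set x | r x < a].
Proof.
move=> mr Vr rB; pose c := 4 * (B + `|a| + 1).
have c0 : 0 < c.
  by rewrite mulr_gt0// ltr_wpDl// addr_ge0// (le_trans _ (rB point)).
pose y x := c^-1 * r x + (2^-1 - c^-1 * a).
have yE x : (y x < 2^-1) = (r x < a).
  by rewrite /y addrCA -mulrBr gtrDl pmulr_rlt0 ?invr_gt0// subr_lt0.
have y01 x : 0 <= y x <= 1.
  rewrite /y addrCA -mulrBr; set t := _ * (r x - a).
  have : `|t| <= 4^-1.
    rewrite /t normrM normfV (gtr0_norm c0) ler_pdivrMl// /c mulrAC divff ?mul1r//.
    by rewrite (le_trans (ler_normB _ _))// (le_trans (lerD (rB x) (lexx _)))// lerDl.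
  by rewrite ler_norml => /andP[? ?]; apply/andP; split; lra.
have Vy : multiplier V (fun x => (y x)%:C).
  have := multiplierD (multiplierM (multiplier_cst (c^-1)%:C) Vr)
    (multiplier_cst (2^-1 - c^-1 * a)%:C).
  by congr multiplier; apply/funext => x; rewrite -rmorphM -rmorphD.
have mE : measurable [set x | r x < a].
  rewrite (_ : [set _ | _] = r @^-1` `]-oo, a[); last first.
    by apply/seteqP; split => x /=; rewrite in_itv.
  by rewrite -[X in measurable X]setTI; exact: mr.
split => //.
apply: (@multiplier_real_lim (fun n x => (1 - y x ^+ n) ^+ (n * 2 ^ n)) _ 1).
- move=> n.
  have := multiplierX (n * 2 ^ n) (multiplierD (multiplier_cst 1)
    (multiplierM (multiplier_cst (-1)) (multiplierX n Vy))).
  congr multiplier; apply/funext => x.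
  by rewrite rmorphXn rmorphB rmorphXn rmorph1 mulN1r.
- move=> n x; have /andP[y0 y1] := y01 x.
  have a0 := exprn_ge0 n y0; have a1 := exprn_ile1 n y0 y1.
  by rewrite ger0_norm ?exprn_ge0 ?exprn_ile1//; lra.
- exact: measurable_indic.
- move=> x; have := cvg_polynomial_step (y01 x); rewrite yE.
  by rewrite indicE mem_setE.
Qed.

End fix_subspace.
End multipliers.

(** * From indicator multipliers to density *)

Section density.
Context d (T : measurableType d) (R : realType) (mu : {measure set T -> \bar R}).
Implicit Types (f g h : T -> R[i]) (u v : L2 mu).
Local Notation sqi := (square_integrable mu).
Local Notation dot := (@L2dot _ _ _ mu).
Local Notation N := (hnorm dot).
Context (V : set (L2 mu)) (VV : closed_subspace dot V).
Hypothesis VE : forall E, measurable E -> mult_set V E.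

Lemma multiplier_nnsfun (s : {nnsfun T >-> R}) : multiplier V (fun x => (s x)%:C).
Proof.
have Vsum (r : seq R) : multiplier V
    (fun x => (\sum_(y <- r) y * \1_(s @^-1` [set y]) x)%:C).
  elim: r => [|y r ih].
    by under eq_fun do rewrite big_nil; exact: multiplier_cst.
  under eq_fun do rewrite big_cons rmorphD rmorphM.
  apply: multiplierD => //; apply: multiplierM => //; first exact: multiplier_cst.
  by apply: (VE _).2; exact: measurable_funPTI.
have := Vsum (finmap.enum_fset (fset_set (range s))); congr multiplier; apply/funext => x.
by rewrite [in RHS]fimfunE fsbig_finite//; exact: fimfunP.
Qed.

Definition restr f (K : set T) x := (\1_K x)%:C * f x.

Lemma cbounded_indic (K : set T) : measurable K ->
  cbounded (fun x => (\1_K x)%:C : R[i]).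
Proof.
move=> mK; split; first exact/cmeasurable_real/measurable_indic.
by exists 1 => x; rewrite normc_real indicE; case: (_ \in _); rewrite /= ?normr1 ?normr0.
Qed.

Lemma restr_square_integrable f K : measurable K -> sqi f -> sqi (restr f K).
Proof. by move=> mK; apply: square_integrable_mul; exact: cbounded_indic. Qed.

Context (K : nat -> set T) (mK : forall n, measurable (K n))
  (sK : forall n, sqi (fun x => (\1_(K n) x)%:C))
  (VK : forall n, V (L2class mu (fun x => (\1_(K n) x)%:C))).

(** Simple functions increase to [r]; as multipliers applied to the indicator of [K n] they give
    elements of [V] that converge to the restriction of [r]. *)
Lemma restr_nonneg_in (r : T -> R) n : (forall x, 0 <= r x) ->
  sqi (fun x => (r x)%:C) -> V (L2class mu (restr (fun x => (r x)%:C) (K n))).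
Proof.
move=> r0 sr; have [V0 VD Vc] := VV; apply: Vc => e e0.
have mr : measurable_fun setT (EFin \o r).
  by apply/measurable_EFinP; exact: sr.1.1.
have r0' x : setT x -> (0 <= (EFin \o r) x)%E by rewrite lee_fin.
pose s := nnsfun_approx measurableT mr.
have cs x : s k x @[k --> \oo] --> r x.
  have := cvg_nnsfun_approx measurableT mr r0' (x := x) Logic.I.
  by move/fine_cvgP => [].
have les k x : s k x <= r x.
  rewrite -(cvg_lim _ (cs x))//.
  apply: nondecreasing_cvgn_le; last exact: cvgP (cs x).
  by move=> m n' mn; have /lefP := nd_nnsfun_approx measurableT mr mn; apply.
have s0 k x : 0 <= s k x by exact: fun_ge0.
have [] := @L2_dct _ _ _ mu (fun k => restr (fun x => (s k x)%:C) (K n))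
  (restr (fun x => (r x)%:C) (K n)) (fun x => (r x)%:C).
- move=> k; apply: cmeasurableM; apply: cmeasurable_real.
    exact: measurable_indic.
  exact: measurable_funP.
- by apply: cmeasurableM; [apply: cmeasurable_real; exact: measurable_indic|exact: sr.1].
- by [].
- move=> k x; rewrite /sqr_norm /restr -rmorphM !normc_real lerXn2r ?nnegrE//.
  rewrite !ger0_norm ?mulr_ge0// indicE; case: (_ \in _); rewrite ?mul1r ?mul0r//.
- move=> x; rewrite Re_scale; under eq_fun do rewrite Re_scale.
  by apply: cvgM; [exact: cvg_cst|exact: cs].
- move=> x; rewrite Im_scale; under eq_fun do rewrite Im_scale.
  by apply: cvgM; [exact: cvg_cst|rewrite /=; exact: cvg_cst].
- move=> _ /(_ e e0)[k hk]; eexists; last exact: hk.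
  have := (multiplier_nnsfun (s k)).2 _ (VK n).
  rewrite mulL2_class//; last exact: (multiplier_nnsfun (s k)).1.
  by congr (V (L2class _ _)); apply/funext => x; rewrite /restr mulrC.
Qed.

Lemma restr_in f n : sqi f -> V (L2class mu (restr f (K n))).
Proof.
move=> sf.
have sp (r : T -> R) : measurable_fun setT r -> (forall x, r x ^+ 2 <= sqr_norm f x) ->
    sqi (fun x => (r x)%:C).
  move=> mr rf; apply: (square_integrable_le _ sf); first exact: cmeasurable_real.
  by move=> x; rewrite /sqr_norm normc_real real_normK ?num_real.
have part (r : T -> R) : measurable_fun setT r -> (forall x, r x ^+ 2 <= sqr_norm f x) ->
    V (L2class mu (restr (fun x => (r x)%:C) (K n))).
  move=> mr rf.
  have mp : measurable_fun setT (fun x => Num.max (r x) 0).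
    by apply: measurable_maxr => //; exact: measurable_cst.
  have mn : measurable_fun setT (fun x => Num.max (- r x) 0).
    by apply: measurable_maxr; [exact: measurableT_comp|exact: measurable_cst].
  have b1 x : Num.max (r x) 0 ^+ 2 <= sqr_norm f x.
    by rewrite (le_trans _ (rf x))//; case: (leP (r x) 0) => _; rewrite ?expr0n ?sqr_ge0.
  have b2 x : Num.max (- r x) 0 ^+ 2 <= sqr_norm f x.
    by rewrite (le_trans _ (rf x))//; case: (leP (- r x) 0) => _; rewrite ?expr0n ?sqr_ge0 ?sqrrN.
  have p0 (x : T) : 0 <= Num.max (r x) 0 by rewrite le_max lexx orbT.
  have n0 (x : T) : 0 <= Num.max (- r x) 0 by rewrite le_max lexx orbT.
  have [_ VD _] := VV.
  have := VD (-1) _ _ (restr_nonneg_in n n0 (sp _ mn b2)) (restr_nonneg_in n p0 (sp _ mp b1)).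
  rewrite -L2class_linear; [|exact: restr_square_integrable (sp _ _ _)..].
  congr (V (L2class _ _)); apply/funext => x.
  rewrite -[LHS]/(-1 * restr _ _ x + restr _ _ x) mulN1r /restr -mulrN -mulrDr.
  rewrite -rmorphN -rmorphD; congr (_ * _%:C).
  by case: (leP (r x) 0) => ?; case: (leP (- r x) 0) => ?; lra.
have [_ VD _] := VV.
have VR : V (L2class mu (restr (fun x => (Re (f x))%:C) (K n))).
  by apply: part => [|x]; [exact: sf.1.1|rewrite sqr_normE lerDl sqr_ge0].
have VI : V (L2class mu (restr (fun x => (Im (f x))%:C) (K n))).
  by apply: part => [|x]; [exact: sf.1.2|rewrite sqr_normE lerDr sqr_ge0].
have := VD 'i _ _ VI VR; rewrite -L2class_linear.
- congr (V (L2class _ _)); apply/funext => x.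
  rewrite -[LHS]/('i * restr _ _ x + restr _ _ x) /restr mulrCA -mulrDr; congr (_ * _).
  by case: (f x) => a b; apply/eqP; rewrite eq_complex/=; apply/andP; split; apply/eqP; ring.
- apply: restr_square_integrable => //; apply: sp; first exact: sf.1.2.
  by move=> x; rewrite sqr_normE lerDr sqr_ge0.
- apply: restr_square_integrable => //; apply: sp; first exact: sf.1.1.
  by move=> x; rewrite sqr_normE lerDl sqr_ge0.
Qed.

Lemma mult_set_dense : {ae mu, forall x, (\bigcup_n K n) x} -> forall u, V u.
Proof.
move=> aeK; elim/L2_ind => f sf.
pose U n := \bigcup_(i < n) K i.
have mU n : measurable (U n) by apply: bigcup_measurable => i _; exact: mK.
have VU n : V (L2class mu (restr f (U n))).
  have [V0 VD _] := VV.
  elim: n => [|n ih].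
    rewrite (_ : restr _ _ = 0) ?L2class0//.
    by apply/funext => x; rewrite /restr /U II0 bigcup_set0 indic0 mul0r.
  have sr := restr_square_integrable (mU n) sf.
  (* The sets [K n] may overlap: on the new one, only what [U n] has not yet contributed is
     added. *)
  have := VD 1 _ _ (restr_in n (square_integrableB sf sr)) ih.
  rewrite -L2class_linear//; last first.
    by apply: restr_square_integrable => //; exact: square_integrableB.
  congr (V (L2class _ _)); apply/funext => x.
  rewrite -[LHS]/(1 * restr (f - restr f (U n)) (K n) x + restr f (U n) x).
  rewrite /restr -[(f - _) x]/(f x - (\1_(U n) x)%:C * f x) mul1r.
  have -> : U n.+1 = U n `|` K n by rewrite /U IIS bigcup_setU bigcup_set1.
  rewrite !indicE in_setU; case: (x \in U n); case: (x \in K n);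
    by rewrite /= ?mul1r ?mul0r ?subrr ?subr0 ?addr0 ?add0r.
have [_ _ Vc] := VV; apply: Vc => e e0.
pose g := restr f (\bigcup_n K n).
have mUK : measurable (\bigcup_n K n) by apply: bigcup_measurable.
have sg : sqi g by exact: restr_square_integrable.
have -> : L2class mu f = L2class mu g.
  apply: L2class_eq => //; apply: filterS aeK => x Kx.
  by rewrite /g /restr indicE mem_set// mul1r.
have c1 x : \1_(U n) x @[n --> \oo] --> (\1_(\bigcup_n K n) x : R).
  apply: cvg_near_cst.
  have [Ux|nU] := pselect ((\bigcup_n K n) x).
    have [n _ Fnx] := Ux; exists n.+1 => // k /= nk.
    by rewrite !indicE !mem_set//; exists n.
  apply: nearW => n; rewrite !indicE (memNset nU) memNset// => -[k _ Fkx].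
  by apply: nU; exists k.
have [] := @L2_dct _ _ _ mu (fun n => restr f (U n)) g f.
- by move=> n; exact: (restr_square_integrable (mU n) sf).1.
- exact: sg.1.
- by [].
- move=> n x; rewrite /sqr_norm /restr indicE; case: (_ \in _); rewrite ?mul1r ?mul0r//.
  by rewrite normc0 expr0n sqr_ge0.
- move=> x; rewrite Re_scale; under eq_fun do rewrite Re_scale.
  by apply: cvgM => //; exact: cvg_cst.
- move=> x; rewrite Im_scale; under eq_fun do rewrite Im_scale.
  by apply: cvgM => //; exact: cvg_cst.
- by move=> _ /(_ e e0)[n hn]; exists (L2class mu (restr f (U n))).
Qed.
End density.

(** * The solenoid *)

Lemma ptws_cvg (I : Type) (T : topologicalType) (F : set_system (I -> T))
    (f : I -> T) : Filter F ->
  (forall i, g i @[g --> F] --> f i) -> {ptws, F --> f}.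
Proof.
move=> FF h; apply/cvg_sup => i; apply/cvg_image.
  by apply/seteqP; split => // x _; exists (fun=> x).
move=> B /h FB; exists ((fun g => g i) @^-1` B) => //.
by apply/seteqP; split => [_ [g gB <-]//|x Bx]; exists (fun=> x).
Qed.

Section solenoid_topology.
Context (R : realType).
Implicit Types (z w : solenoid R).

Lemma coordS z (n : int) : coord z (n + 1) ^+ 3 = coord z n.
Proof. by have [] := set_valP z n. Qed.

Lemma normc_coord z (n : int) : normc (coord z n) = 1.
Proof. by have [_ []] := set_valP z n. Qed.

(** A coordinate determines all earlier ones, so one coordinate of large index controls any finite
    number of them. *)
Lemma coord_exp z (n : int) k : coord z (n - k%:Z) = coord z n ^+ (3 ^ k).
Proof.
elim: k => [|k ih]; first by rewrite subr0 expr1.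
rewrite expnSr exprM -ih -coordS; congr (coord z _ ^+ _).
by rewrite -addn1 PoszD; ring.
Qed.

Lemma normc_le (z : R[i]) : normc z <= `|Re z| + `|Im z|.
Proof.
case: z => a b /=; rewrite -[leRHS]ger0_norm ?addr_ge0// -sqrtr_sqr.
apply: ler_wsqrtr; rewrite sqrrD !real_normK ?num_real// -addrA lerD2l lerDr.
by rewrite mulrn_wge0// mulr_ge0.
Qed.

Lemma normcX (a : R[i]) n : normc (a ^+ n) = normc a ^+ n.
Proof.
by elim: n => [|n ih]; [rewrite !expr0 normc1|rewrite !exprS normcM ih].
Qed.

Lemma normc_exp_dist (a b : R[i]) n : normc a = 1 -> normc b = 1 ->
  normc (a ^+ n - b ^+ n) <= n%:R * normc (a - b).
Proof.
move=> a1 b1; elim: n => [|n ih]; first by rewrite !expr0 subrr normc0 mul0r.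
have -> : a ^+ n.+1 - b ^+ n.+1 = a * (a ^+ n - b ^+ n) + (a - b) * b ^+ n.
  by rewrite !exprS; ring.
rewrite (le_trans (le_normcD _ _))// !normcM normcX a1 b1 expr1n mulr1 mul1r.
by rewrite -addn1 natrD mulrDl mul1r lerD2r.
Qed.

Lemma solenoid_cvg_open (O : set (solenoid R)) z (w : nat -> solenoid R) :
  open O -> O z ->
  (forall n : int, normc (coord z n - coord (w k) n) @[k --> \oo] --> (0 : R)) ->
  exists k, O (w k).
Proof.
move=> [W oW <-] Oz wz.
have : {ptws, (set_val \o w) @ \oo --> (set_val z : {ptws int -> R[i]^o})}.
  apply: ptws_cvg => n; apply/cvgrPdist_lt => e e0.
  (* Radii in [R[i]^o] are complex numbers; a positive one equals its real part. *)
  have e0' : 0 < Re e by move: e0; rewrite ltcE => /andP[].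
  have eE : e = (Re e)%:C.
    by move: e0; rewrite ltcE /= => /andP[/eqP]; case: (e) => a b /= ->.
  apply: (@filterS _ \oo _ _ _ _ (cvgr_lt 0 (wz n) _ e0')) => k h.
  change (is_true ((normc (coord z n - coord (w k) n))%:C < e)); by rewrite eE ltcR.
move=> /(_ W (open_nbhs_nbhs (conj oW Oz)))[k _ /(_ k (leqnn k))].
by exists k.
Qed.

Lemma continuous_coord (n : int) :
  continuous (fun z : solenoid R => coord z n : R[i]^o).
Proof.
move=> z; apply: (@continuous_comp _ _ _ (set_val : solenoid R -> {ptws int -> R[i]^o})
  (fun f => f n)); first exact: initial_continuous.
exact: (@proj_continuous _ (fun=> R[i]^o)).
Qed.

Lemma open_Re_lt (a : R) : open [set z : R[i]^o | Re z < a].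
Proof.
rewrite openE => z /= za; apply/nbhs_ballP.
exists (a - Re z)%:C; first by rewrite /= ltcR subr_gt0.
move=> w; rewrite -ball_normE /= -[`|_|]/((normc (z - w))%:C) ltcR => h.
have : `|Re z - Re w| <= normc (z - w).
  case: (z) (w) => [x y] [x' y'] /=; rewrite -sqrtr_sqr.
  by apply: ler_wsqrtr; rewrite lerDl sqr_ge0.
by rewrite ler_norml => /andP[? ?]; lra.
Qed.

Lemma open_Im_lt (a : R) : open [set z : R[i]^o | Im z < a].
Proof.
rewrite openE => z /= za; apply/nbhs_ballP.
exists (a - Im z)%:C; first by rewrite /= ltcR subr_gt0.
move=> w; rewrite -ball_normE /= -[`|_|]/((normc (z - w))%:C) ltcR => h.
have : `|Im z - Im w| <= normc (z - w).
  case: (z) (w) => [x y] [x' y'] /=; rewrite -sqrtr_sqr.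
  by apply: ler_wsqrtr; rewrite lerDr sqr_ge0.
by rewrite ler_norml => /andP[? ?]; lra.
Qed.

Lemma measurable_Re_coord_lt (n : int) (a : R) :
  measurable ([set z | Re (coord z n) < a] : set (borel_solenoid R)).
Proof.
apply: sub_sigma_algebra.
by have /continuousP/(_ _ (@open_Re_lt a)) := @continuous_coord n.
Qed.

Lemma measurable_Im_coord_lt (n : int) (a : R) :
  measurable ([set z | Im (coord z n) < a] : set (borel_solenoid R)).
Proof.
apply: sub_sigma_algebra.
by have /continuousP/(_ _ (@open_Im_lt a)) := @continuous_coord n.
Qed.

Lemma measurable_fun_lt d (T : measurableType d) (f : T -> R) :
  (forall a, measurable [set x | f x < a]) -> measurable_fun setT f.
Proof.
move=> h; apply: (measurability _ (RGenInftyO.measurableE R)) => _ [_ [a ->] <-].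
rewrite setTI (_ : _ @^-1` _ = [set x | f x < a])//.
Qed.

Lemma cmeasurable_coord (n : int) :
  cmeasurable (fun z : borel_solenoid R => coord z n).
Proof.
split; apply: measurable_fun_lt => a; [exact: measurable_Re_coord_lt|].
exact: measurable_Im_coord_lt.
Qed.

(** Every open set is a countable union of rational boxes, each constraining one coordinate. If no
    box around z fitted into [O], points outside [O] taken from smaller and smaller boxes would
    converge to z. *)
Lemma solenoid_borel_ind (G : set (set (solenoid R))) : sigma_algebra setT G ->
  (forall (p : nat) a, G [set z | Re (coord z p) < a]) ->
  (forall (p : nat) a, G [set z | Im (coord z p) < a]) ->
  forall A : set (borel_solenoid R), measurable A -> G A.
Proof.
move=> sG GR GI; apply: smallest_sub => // O oO.
have [G0 GC GU] := sG.
have GU2 A B : G A -> G B -> G (A `|` B).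
  move=> GA GB; rewrite -bigcup2E; apply: GU => -[//|[//|n]] /=.
  exact: G0.
have GC' A : G A -> G (~` A) by rewrite -setTD; exact: GC.
have GI2 A B : G A -> G B -> G (A `&` B).
  by move=> GA GB; rewrite -[_ `&` _]setCK setCI; apply/GC'/GU2; exact: GC'.
have le (r : solenoid R -> R) a : (forall a, G [set z | r z < a]) ->
    G [set z | a < r z].
  move=> Gr; rewrite (_ : [set _ | _] =
      \bigcup_n ~` [set z | r z < a + n.+1%:R^-1]).
    by apply: GU => n; apply: GC'.
  apply/seteqP; split => z /=.
    rewrite -subr_gt0 => h.
    have [n hn] : exists n : nat, n.+1%:R^-1 < r z - a.
      exists (Num.truncn (r z - a)^-1).
      by rewrite invf_plt ?posrE// ?ltr0n// truncnS_gt.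
    exists n => //; apply/negP; rewrite -leNgt -lerBrDl ltW//.
  move=> [n _ /negP]; rewrite -leNgt.
  have : 0 < n.+1%:R^-1 :> R by rewrite invr_gt0.
  by move=> p h; apply: lt_le_trans h; rewrite ltrDl.
(* Passing from coordinate [N] to coordinate n multiplies distances by at most 3^(N + |n|); the
   radius 9^-N makes the product tend to 0. *)
pose delta N : R := (9^-1) ^+ N.
have delta0 N : 0 < delta N by rewrite exprn_gt0.
pose box (t : nat * (rat * rat)) : set (solenoid R) :=
  [set z | Re (coord z t.1) < ratr t.2.1 + delta t.1] `&`
  [set z | ratr t.2.1 - delta t.1 < Re (coord z t.1)] `&`
  ([set z | Im (coord z t.1) < ratr t.2.2 + delta t.1] `&`
  [set z | ratr t.2.2 - delta t.1 < Im (coord z t.1)]).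
have Gbox t : G (box t).
  apply: (GI2); apply: (GI2); [exact: GR|apply: le; exact: GR|exact: GI|].
  by apply: (le); exact: GI.
(* An enumeration of the boxes inside [O], with the empty set for every other code. *)
pose F n := if unpickle n is Some t then
  if pselect (box t `<=` O) then box t else set0 else set0.
suff -> : O = \bigcup_n F n.
  apply: GU => n; rewrite /F; case: unpickle => [t|]; last exact: G0.
  by case: pselect => _ //=; exact: G0.
apply/seteqP; split => z; last first.
  move=> [n _]; rewrite /F; case: unpickle => [t|//].
  by case: pselect => [h|//] /= /h.
move=> Oz; suff [t [tz tO]] : exists t, box t z /\ box t `<=` O.
  by exists (pickle t) => //; rewrite /F pickleK; case: pselect.
apply: contrapT => hN.
have [w hw] : exists w : nat -> solenoid R, forall N : nat, ~ O (w N) /\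
    normc (coord z N - coord (w N) N) <= 4 * delta N.
  suff h (N : nat) : exists v, ~ O v /\ normc (coord z N - coord v N) <= 4 * delta N.
    by have [w hw] := choice h; exists w.
  have rat_near (x : R) : exists q : rat, x - delta N < ratr q < x + delta N.
    have /rat_in_itvoo[q] : x - delta N < x + delta N by have := delta0 N; lra.
    by rewrite in_itv/=; exists q.
  have [q1 /andP[a1 b1]] := rat_near (Re (coord z N)).
  have [q2 /andP[a2 b2]] := rat_near (Im (coord z N)).
  have tz : box (N, (q1, q2)) z by split; split => /=; lra.
  have /existsNP[w /not_implyP[[[/= c1 c2] [/= c3 c4]] Ow]] : ~ (box (N, (q1, q2)) `<=` O).
    by move=> h; apply: hN; exists (N, (q1, q2)).
  exists w; split => //.
  move: a1 b1 a2 b2 c1 c2 c3 c4; move: (ratr q1) (ratr q2) (delta N) => x y e.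
  case: (coord z N) (coord w N) => a b [a' b'] /= *.
  apply: (le_trans (@normc_le ((a +i* b) - (a' +i* b')))) => /=.
  have : `|a - a'| <= 2 * e by rewrite ler_norml; apply/andP; split; lra.
  have : `|b - b'| <= 2 * e by rewrite ler_norml; apply/andP; split; lra.
  lra.
have [k] : exists k, O (w k); last by have [] := hw k.
apply: (solenoid_cvg_open oO Oz) => n.
apply: (@squeeze_cvgr _ _ _ _ (fun=> 0) (fun k => (4 * 3 ^+ `|n|%N) * 3^-1 ^+ k)).
- exists `|n|%N => // N /= nN; rewrite normc_ge0 /=.
  (* For [N] at least |n| the coordinate n is a 3^k-th power of coordinate [N], whether n is
     negative or not. *)
  have [k nE kE] : exists2 k : nat, n = N%:Z - k%:Z & (k <= N + `|n|)%N.
    case: n nN => a aN.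
      exists (N - a)%N; first by rewrite -subzn// subKr.
      exact: leq_trans (leq_subr a N) (leq_addr a N).
    by exists (N + a.+1)%N; rewrite // PoszD opprD addrA subrr add0r NegzE.
  rewrite nE !coord_exp.
  rewrite (le_trans (normc_exp_dist _ _ _)) ?normc_coord//.
  rewrite (le_trans (ler_wpM2l _ (hw N).2)) ?ler0n// -nE.
  rewrite (_ : 4 * _ * _ = (3 ^ (N + `|n|))%:R * (4 * delta N)).
    apply: ler_wpM2r; first by rewrite mulr_ge0 ?(ltW (delta0 N)).
    by rewrite ler_nat leq_pexp2l.
  rewrite natrX exprD /delta (_ : 9^-1 = 3^-1 * 3^-1); last by field.
  rewrite exprMn.
  have : (3 : R) ^+ N != 0 by rewrite expf_neq0.
  by rewrite exprVn => ?; field.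
- exact: cvg_cst.
- by apply: cvg_geometric; rewrite ger0_norm// invf_lt1// ltr1n.
Qed.

End solenoid_topology.

(** For closedness, multiplying u - v by the conjugate of [c] turns the product with w into |c|^2,
    so that [Re_dot_le] bounds the modulus of [c]. *)
Lemma closed_orthogonal (R : realType) (H : lmodType R[i]) (dot : H -> H -> R[i])
    (hH : hilbert dot) (w : H) : closed_subspace dot [set u | dot u w = 0].
Proof.
split=> /= [|a u v hu hv|u hu]; first exact: dot0l.
  by rewrite (dot_linear hH) hu hv mulr0 addr0.
apply: eq0_normc; apply/eqP; rewrite eq_le normc_ge0 andbT.
set c := dot u w.
have key (e : R) : 0 < e -> normc c <= e * hnorm dot w.
  move=> /hu[v /= vw uv].
  have uvw : dot (u - v) w = c.
    by rewrite (dotDl hH) -scaleN1r (dotZl hH) vw mulr0 addr0.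
  have := Re_dot_le hH (c^* *: (u - v)) w.
  rewrite (dotZl hH) uvw (hnormZ hH) mulrC mulc_conj /=.
  have -> : normc c^* = normc c by case: (c) => a b; rewrite /= sqrrN.
  have [->|c0] := eqVneq (normc c) 0.
    by move=> _; rewrite mulr_ge0 ?hnorm_ge0// (le_trans (hnorm_ge0 _ _) (ltW uv)).
  have cp : 0 < normc c by rewrite lt_def c0 normc_ge0.
  rewrite expr2 -mulrA ler_pM2l// => /le_trans; apply.
  by apply: ler_wpM2r; [exact: hnorm_ge0|exact: ltW].
have [w0|w0] := eqVneq (hnorm dot w) 0; first by have := key 1 ltr01; rewrite w0 mulr0.
have wp : 0 < hnorm dot w by rewrite lt_def w0 hnorm_ge0.
apply/ler_addgt0Pr => e e0; rewrite add0r.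
by have := key _ (divr_gt0 e0 wp); rewrite divfK.
Qed.

(** * Operators on classes induced by operators on functions *)

Section L2_operator.
Context d1 d2 (T1 : measurableType d1) (T2 : measurableType d2) (R : realType)
  (mu : {measure set T1 -> \bar R}) (nu : {measure set T2 -> \bar R}).

(** Applied to the difference of [f] and the chosen representative of its class, the estimate shows
    that the class of [A f] depends on the class of [f] only; linearity on classes follows. *)
Lemma L2_operator (A : (T1 -> R[i]) -> T2 -> R[i]) (B : R) : 0 <= B ->
  linear A ->
  (forall f, square_integrable mu f -> cmeasurable (A f) /\
     (\int[nu]_x (sqr_norm (A f) x)%:E <=
      (B ^+ 2)%:E * \int[mu]_x (sqr_norm f x)%:E)%E) ->
  [/\ forall f, square_integrable mu f -> square_integrable nu (A f),
      forall f, square_integrable mu f ->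
        L2class nu (A (L2repr (L2class mu f))) = L2class nu (A f),
      linear (fun u : L2 mu => L2class nu (A (L2repr u))) &
      forall u : L2 mu, hnorm (@L2dot _ _ _ nu) (L2class nu (A (L2repr u))) <=
        B * hnorm (@L2dot _ _ _ mu) u].
Proof.
move=> B0 lA bA.
have sA f : square_integrable mu f -> square_integrable nu (A f).
  move=> sf; have [mA hA] := bA f sf; split=> //; apply: le_lt_trans hA _.
  by rewrite lte_mul_pinfty ?lee_fin ?sqr_ge0//; exact: sf.2.
have nA f : square_integrable mu f ->
    hnorm (@L2dot _ _ _ nu) (L2class nu (A f)) <=
    B * hnorm (@L2dot _ _ _ mu) (L2class mu f).
  by move=> sf; apply: hnorm_L2_le => //; [exact: sA|exact: (bA f sf).2].
have AB f g : A (f - g) = A f - A g.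
  by rewrite addrC -scaleN1r lA scaleN1r addrC.
have cA f : square_integrable mu f ->
    L2class nu (A (L2repr (L2class mu f))) = L2class nu (A f).
  move=> sf; have sr := L2repr_square_integrable (L2class mu f).
  apply/eqP; rewrite -subr_eq0 -L2classB; [|exact: sA..]; rewrite -AB.
  apply/eqP/(hnorm0_eq0 (hilbert_L2 nu))/eqP; rewrite eq_le hnorm_ge0 andbT.
  apply: le_trans (nA _ (square_integrableB sr sf)) _.
  by rewrite L2classB// L2reprK subrr (hnorm0 (hilbert_L2 mu)) mulr0.
split => //.
- move=> a; elim/L2_ind => f sf; elim/L2_ind => g sg.
  rewrite -L2class_linear// !cA//; last exact: square_integrable_linear.
  by rewrite lA L2class_linear//; exact: sA.
- by elim/L2_ind => f sf; rewrite cA//; exact: nA.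
Qed.
End L2_operator.

(** * Characters of the solenoid and their density *)

Section characters.
Context (R : realType).
Implicit Types (z : borel_solenoid R) (k l : int) (p q : nat).

Lemma coord_neq0 z (n : int) : coord z n != 0.
Proof.
by apply/eqP => h; have := normc_coord z n; rewrite h normc0 => /eqP; rewrite eq_sym oner_eq0.
Qed.

Lemma coord_shift z (n : int) : coord (solenoid_shift z) n = coord z (n - 1).
Proof. by []. Qed.

(** The fraction k / 3^p with denominator 3^(p + q); products of characters are computed at a common
    level. *)
Lemma chiE k p q z : chi k p z = coord z (p + q)%N ^ (k * (3 ^ q)%N).
Proof.
rewrite /chi (_ : (p : int) = (p + q)%N%:Z - q%:Z); last by rewrite PoszD addrK.
by rewrite coord_exp exprnP exprz_exp mulrC.
Qed.

Lemma chiM k p l q z :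
  chi k p z * chi l q z = chi (k * (3 ^ q)%N + l * (3 ^ p)%N) (p + q) z.
Proof.
by rewrite (chiE k p q) (chiE l q p) (addnC q p) -expfzDr ?coord_neq0.
Qed.

Lemma chi0 p z : chi 0 p z = 1.
Proof. by rewrite /chi expr0z. Qed.

Lemma conjc_inv (a : R[i]) : normc a = 1 -> a^* = a^-1.
Proof.
move=> a1; have h : a * a^* = 1 by rewrite mulc_conj a1 expr1n.
have a0 : a != 0 by apply: contra_eq_neq h => ->; rewrite mul0r eq_sym oner_eq0.
by rewrite -[RHS]mulr1 -h mulKf.
Qed.

Lemma conj_coord z (n : int) : (coord z n)^* = (coord z n)^-1.
Proof. exact/conjc_inv/normc_coord. Qed.

Lemma normc_chi k p z : normc (chi k p z) = 1.
Proof.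
rewrite /chi; case: k => n; first by rewrite -exprnP normcX normc_coord expr1n.
by rewrite NegzE -invr_expz normcV -exprnP normcX normc_coord expr1n invr1.
Qed.

Lemma conj_chi k p z : (chi k p z)^* = chi (- k) p z.
Proof. by rewrite conjc_inv ?normc_chi// /chi invr_expz. Qed.

Lemma cmeasurable_chi k p : cmeasurable (chi k p : borel_solenoid R -> R[i]).
Proof.
have mX (f : borel_solenoid R -> R[i]) n : cmeasurable f ->
    cmeasurable (fun z => f z ^+ n).
  move=> mf; elim: n => [|n ih]; first exact: cmeasurable_cst.
  by under eq_fun do rewrite exprS; exact: cmeasurableM.
case: k => n; first exact/mX/cmeasurable_coord.
have -> : chi (Negz n) p = (fun z : borel_solenoid R => ((coord z p)^*) ^+ n.+1).
  by apply/funext => z; rewrite conj_coord exprVn.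
exact/mX/cmeasurable_conj/cmeasurable_coord.
Qed.

Lemma cbounded_chi k p : cbounded (chi k p : borel_solenoid R -> R[i]).
Proof.
by split; [exact: cmeasurable_chi|exists 1 => z; rewrite normc_chi].
Qed.
End characters.

Section density.
Context (R : realType) (mu : {measure set (borel_solenoid R) -> \bar R}).
Hypothesis mu_fin : (mu setT < +oo)%E.

Lemma cbounded_square_integrable f : cbounded f -> square_integrable mu f.
Proof.
move=> bf.
have s1 : square_integrable mu (fun=> 1).
  split; first exact: cmeasurable_cst.
  rewrite (eq_integral (cst 1%E)); last by move=> x _; rewrite /sqr_norm normc1 expr1n.
  by rewrite integral_cst// mul1e.
have := square_integrable_mul bf s1.
by under [X in square_integrable _ X -> _]eq_fun do rewrite mulr1.
Qed.

Definition chi_class (i : int * nat) : L2 mu := L2class mu (chi i.1 i.2).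

(** The measure is any finite one, because the lemma is applied to [m] and also to the sum of [m]
    and its image under the shift. *)
Lemma chi_dense u : closed_span (@L2dot _ _ _ mu) chi_class u.
Proof.
set V := closed_span _ _.
have VV : closed_subspace (@L2dot _ _ _ mu) V by exact: closed_span_subspace (hilbert_L2 mu) _ _.
have Vchi k p : multiplier V (chi k p).
  split; first exact: cbounded_chi.
  move=> u' Vu'; apply: (bounded_linear_span (B := 1)
    (mulL2_linear (cbounded_chi R k p)) _ VV _ Vu') => [v|i].
    apply: mulL2_bound; first exact: cmeasurable_chi.
    by move=> z; rewrite normc_chi.
  rewrite mulL2_class; [|exact: cbounded_chi|exact/cbounded_square_integrable/cbounded_chi].
  under [X in L2class _ X]eq_fun do rewrite chiM.
  exact: (closed_span_gen (hilbert_L2 mu) chi_class (_, _)).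
have VE E : measurable E -> mult_set V E.
  apply: (solenoid_borel_ind (mult_set_sigma_algebra VV)) => p a.
  - apply: (@mult_set_lt _ _ _ _ _ VV _ 1); first exact: (cmeasurable_coord _ _).1.
      have := multiplierM (multiplier_cst VV (2^-1)%:C) (multiplierD VV (Vchi 1 p) (Vchi (-1) p)).
      congr multiplier; apply/funext => z.
      rewrite -(conj_chi 1) /chi expr1z; case: (coord z p) => x y.
      by apply/eqP; rewrite eq_complex/=; apply/andP; split; apply/eqP; field.
    move=> z; rewrite -(normc_coord z p); case: (coord z p) => x y /=.
    by rewrite -sqrtr_sqr; apply: ler_wsqrtr; rewrite lerDl sqr_ge0.
  - apply: (@mult_set_lt _ _ _ _ _ VV _ 1); first exact: (cmeasurable_coord _ _).2.
      have := multiplierM (multiplier_cst VV (0 +i* - 2^-1))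
        (multiplierD VV (Vchi 1 p) (multiplierM (multiplier_cst VV (-1)) (Vchi (-1) p))).
      congr multiplier; apply/funext => z.
      rewrite -(conj_chi 1) /chi expr1z; case: (coord z p) => x y.
      by apply/eqP; rewrite eq_complex/=; apply/andP; split; apply/eqP; field.
    move=> z; rewrite -(normc_coord z p); case: (coord z p) => x y /=.
    by rewrite -sqrtr_sqr; apply: ler_wsqrtr; rewrite lerDr sqr_ge0.
(* As the measure is finite, the whole space can serve for every [K n]; its indicator is the trivial
   character. *)
apply: (mult_set_dense VV VE (K := fun=> setT)) => //.
- by move=> _; apply/cbounded_square_integrable/cbounded_indic.
- move=> _; have := closed_span_gen (hilbert_L2 mu) chi_class (0, 0%N).
  congr (V (L2class _ _)); apply/funext => z.
  by rewrite chi0 indicT.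
- by apply: aeW => z; exists 0%N.
Qed.
End density.

(** * The shift and the weight $|m_0|^2$ *)

Section shift.
Context (R : realType).
Implicit Types (z : borel_solenoid R) (k l : int) (p q : nat).

(** The shift turns a condition on coordinate p into one on p - 1, possibly coordinate -1;
    half-plane conditions are measurable for all integer indices. *)
Lemma measurable_solenoid_shift :
  measurable_fun setT (@solenoid_shift R : borel_solenoid R -> borel_solenoid R).
Proof.
move=> _ A mA; rewrite setTI.
pose G := [set B : set (solenoid R) |
  measurable (@solenoid_shift R @^-1` B : set (borel_solenoid R))].
have sG : sigma_algebra setT G.
  split; rewrite /G /=.
  - by rewrite preimage_set0.
  - by move=> B mB; rewrite setTD preimage_setC; exact: measurableC.
  - by move=> F mF; rewrite preimage_bigcup; exact: bigcup_measurable.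
by apply: (solenoid_borel_ind sG) A mA => p a;
  [exact: measurable_Re_coord_lt|exact: measurable_Im_coord_lt].
Qed.

Lemma cmeasurable_shift (f : borel_solenoid R -> R[i]) : cmeasurable f ->
  cmeasurable (fun z => f (solenoid_shift z)).
Proof.
move=> [mr mi]; split.
  exact: (measurableT_comp mr measurable_solenoid_shift).
exact: (measurableT_comp mi measurable_solenoid_shift).
Qed.

Lemma chi_shift k q z : chi k q.+1 (solenoid_shift z) = chi k q z.
Proof. by rewrite /chi coord_shift -addn1 PoszD addrK. Qed.

Lemma chi_lift k q z : chi k q z = chi (k * 3) q.+1 z.
Proof. by rewrite (chiE k q 1) addn1. Qed.

Definition m0_weight z : R := normc (m0 (coord z 0)) ^+ 2.

(** The frequencies 0, 2 and -2 with weights 1, 1/2 and 1/2 are exactly the three terms of the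
    recursion for the coefficients. *)
Lemma m0_weightE z :
  (m0_weight z)%:C = 1 + 2^-1 * (chi 2 0 z + chi (- 2) 0 z).
Proof.
rewrite /m0_weight -mulc_conj -(conj_chi 2) /chi.
have := mulc_conj (coord z 0); rewrite normc_coord expr1n.
rewrite /m0 -[coord z 0%:Z ^ 2]/(coord z 0 ^+ 2); move: (coord z 0) => c cc.
have s2 : ((Num.sqrt 2 : R)%:C)^-1 * (((Num.sqrt 2 : R)%:C)^-1)^* = 2^-1.
  rewrite mulc_conj normcV normc_real ger0_norm ?sqrtr_ge0// exprVn sqr_sqrtr//.
  by rewrite fmorphV/= rmorph_nat.
rewrite rmorphM/= mulrACA s2 rmorphD/= rmorph1 rmorphXn/=.
have : c ^+ 2 * c^* ^+ 2 = 1 by rewrite -exprMn cc expr1n.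
move: (c ^+ 2) (c^* ^+ 2) => a b ab.
have -> : (1 + a) * (1 + b) = 2 + (a + b) by rewrite mulrDl !mulrDr ab; ring.
by field.
Qed.

Lemma m0_weight_ge0 z : 0 <= m0_weight z.
Proof. exact: sqr_ge0. Qed.

Lemma m0_weight_le2 z : m0_weight z <= 2.
Proof.
have : normc ((m0_weight z)%:C) <= 2.
  rewrite m0_weightE (le_trans (le_normcD _ _))// normc1 normcM.
  have := @le_normcD R (chi 2 0 z) (chi (- 2) 0 z); rewrite !normc_chi.
  have -> : normc (2^-1 : R[i]) = 2^-1.
    by rewrite normcV -[2]/(2%:R) -(rmorph_nat (real_complex R) 2) normc_real ger0_norm.
  by lra.
by rewrite normc_real ger0_norm// m0_weight_ge0.
Qed.

Lemma cmeasurable_m0 : cmeasurable (fun z : borel_solenoid R => m0 (coord z 0)).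
Proof.
rewrite /m0; apply: cmeasurableM; last exact: cmeasurable_cst.
apply: cmeasurableD; first exact: cmeasurable_cst.
by under eq_fun do rewrite expr2; apply: cmeasurableM; exact: cmeasurable_coord.
Qed.

Lemma measurable_m0_weight : measurable_fun setT m0_weight.
Proof. exact: measurable_sqr_norm cmeasurable_m0. Qed.

End shift.

Section invariance.
Context (R : realType) (m : {measure set (borel_solenoid R) -> \bar R}).
Hypothesis m_fin : (m setT < +oo)%E.
Hypothesis m_rec : forall k q, fourier m k q.+1 = fourier m k q +
  2^-1 * (fourier m (k + 2 * 3 ^+ q) q + fourier m (k - 2 * 3 ^+ q) q).

Let shift_measure : {measure set (borel_solenoid R) -> \bar R} :=
  measure_function_pushforward__canonical__measure_function_Measure m
    (@measurable_solenoid_shift R).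

(** In L^2 of this sum both f and f o S are controlled in L^2(m), so that [A] below is bounded
    although the effect of S on L^2(m) is still unknown. *)
Let mS := measure_add m shift_measure.

Let mS_fin : (mS setT < +oo)%E.
Proof.
by rewrite /mS measure_addE lte_add_pinfty//= /pushforward preimage_setT.
Qed.

Let A (f : borel_solenoid R -> R[i]) (z : borel_solenoid R) : R[i] :=
  (m0_weight z)%:C * f (solenoid_shift z) - f z.

Let A_linear : linear A.
Proof.
move=> a f g; apply/funext => z.
rewrite -[RHS]/(a * A f z + A g z) /A.
rewrite -[(a *: f + g) z]/(a * f z + g z).
by rewrite -[(a *: f + g) _]/(a * f (solenoid_shift z) + g (solenoid_shift z)); ring.
Qed.

Let A_bound f : square_integrable mS f -> cmeasurable (A f) /\
  (\int[m]_z (sqr_norm (A f) z)%:E <= (3 ^+ 2)%:E * \int[mS]_z (sqr_norm f z)%:E)%E.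
Proof.
move=> [mf If].
have mSf := cmeasurable_shift mf.
have mA : cmeasurable (A f).
  rewrite /A; under eq_fun do rewrite -mulN1r.
  apply: cmeasurableD.
    by apply: cmeasurableM mSf; apply: cmeasurable_real; exact: measurable_m0_weight.
  by apply: cmeasurableM mf; exact: cmeasurable_cst.
have mE (g : borel_solenoid R -> R[i]) : cmeasurable g -> measurable_fun setT (fun z
  : borel_solenoid R => (sqr_norm g z)%:E).
  by move=> mg; apply/measurable_EFinP; exact: measurable_sqr_norm.
have E0 (g : borel_solenoid R -> R[i]) (z : borel_solenoid R) : (0 <= (sqr_norm g z)%:E)%E.
  by rewrite lee_fin sqr_norm_ge0.
split => //.
rewrite (ge0_integral_measure_add _ _ measurableT)//; last exact: mE.
rewrite (ge0_integral_pushforward (@measurable_solenoid_shift R))//; last exact: mE.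
rewrite preimage_setT -ge0_integralD//; last 3 first.
  exact: (mE _ mf).
  by move=> z _; exact: E0.
  exact: (measurableT_comp (mE _ mf) (@measurable_solenoid_shift R)).
rewrite -ge0_integralZl_EFin//; last 2 first.
  by move=> z _; apply: adde_ge0; exact: E0.
  by apply: emeasurable_funD;
    [exact: (mE _ mf)|exact: (measurableT_comp (mE _ mf) (@measurable_solenoid_shift R))].
apply: ge0_le_integral => //.
- exact: mE.
- by apply: measurable_funeM; apply: emeasurable_funD;
  [exact: (mE _ mf)|exact: (measurableT_comp (mE _ mf) (@measurable_solenoid_shift R))].
move=> z _; rewrite /= -EFinD -EFinM lee_fin !sqr_normE /A.
move: (m0_weight_ge0 z) (m0_weight_le2 z); move: (m0_weight z) => w w0 w2.
case: (f z) (f (solenoid_shift z)) => a b [c e] /=.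
rewrite !mul0r subr0 addr0.
(* The weight is at most 2, so the square is at most 8 y^2 + 2 x^2; this is where the operator bound
   3 comes from. *)
have key (x y : R) : (w * y - x) ^+ 2 <= 9 * (x ^+ 2 + y ^+ 2).
  have : (w * y - x) ^+ 2 <= 2 * (w * y) ^+ 2 + 2 * x ^+ 2.
    by have := sqr_ge0 (w * y + x); nra.
  have : (w * y) ^+ 2 <= 4 * y ^+ 2.
    by rewrite exprMn ler_wpM2r ?sqr_ge0//; nra.
  by have := sqr_ge0 x; have := sqr_ge0 y; lra.
by have := key a c; have := key b e; lra.
Qed.

Let cbounded_m0_weight :
  cbounded (fun z : borel_solenoid R => (m0_weight z)%:C : R[i]).
Proof.
split; first by apply: cmeasurable_real; exact: measurable_m0_weight.
exists 2 => z; rewrite normc_real ger0_norm; [exact: m0_weight_le2|exact: m0_weight_ge0].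
Qed.

Let bounded_cintegrable (f : borel_solenoid R -> R[i]) :
  cbounded f -> cintegrable m f.
Proof.
move=> bf.
have := cintegrable_dot (cbounded_square_integrable m_fin bf)
  (cbounded_square_integrable m_fin (cbounded_cst _ 1)).
by under eq_fun do rewrite rmorph1 mulr1.
Qed.

(** The integral of [A f] is the inner product of [A f] with 1. By the recursion it vanishes on
    characters, hence on their closed span, which is all of L^2(mS). *)
Lemma cintegral_shift (h : borel_solenoid R -> R[i]) : cbounded h ->
  cintegral m (fun z => (m0_weight z)%:C * h (solenoid_shift z)) = cintegral m h.
Proof.
move=> bh.
have s1 : square_integrable m (fun=> 1).
  exact/(cbounded_square_integrable m_fin)/cbounded_cst.
have [sA cA lA bA] := L2_operator (ler0n _ 3) A_linear A_bound.
have V := closed_orthogonal (hilbert_L2 m) (L2class m (fun=> 1)).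
have dot1 (f : borel_solenoid R -> R[i]) : square_integrable m f ->
    L2dot (L2class m f) (L2class m (fun=> 1)) = cintegral m f.
  move=> sf; rewrite L2dotE//; congr cintegral; apply/funext => z.
  by rewrite rmorph1 mulr1.
have bw := cbounded_m0_weight.
have bS (f : borel_solenoid R -> R[i]) : cbounded f -> cbounded (fun z
  : borel_solenoid R => f (solenoid_shift z)).
  by move=> [mf [B fB]]; split; [exact: cmeasurable_shift|exists B].
have ci := bounded_cintegrable.
have dotA (f : borel_solenoid R -> R[i])
  : cbounded f -> L2dot (L2class m (A f)) (L2class m (fun=> 1)) =
    cintegral m (fun z => (m0_weight z)%:C * f (solenoid_shift z)) - cintegral m f.
  move=> bf; rewrite dot1; last exact/sA/(cbounded_square_integrable mS_fin).
  have := cintegral_linear (-1) (ci _ bf) (ci _ (cboundedM bw (bS _ bf))).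
  rewrite mulN1r addrC => <-; congr cintegral.
  by apply/funext => z; rewrite /A mulN1r addrC.
have sh := cbounded_square_integrable mS_fin bh.
apply/eqP; rewrite -subr_eq0 -dotA// -cA//; apply/eqP.
apply: (bounded_linear_span lA bA V _ (chi_dense mS_fin (L2class mS h))) => -[k p].
rewrite /chi_class /= cA; last exact/(cbounded_square_integrable mS_fin)/cbounded_chi.
(* Every character can be written at a positive level, where composition with the shift lowers the
   level by one. *)
wlog [q ->] : k p / exists q, p = q.+1.
  move=> wl; have -> : chi k p = chi (k * 3) p.+1 :> (borel_solenoid R -> R[i]).
    by apply/funext => z; exact: chi_lift.
  by apply: wl; exists p.
rewrite dotA; last exact: cbounded_chi.
rewrite -[cintegral m (chi k q.+1)]/(fourier m k q.+1) m_rec.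
apply/eqP; rewrite subr_eq0; apply/eqP.
have cc i j := ci _ (cbounded_chi R i j).
have E z : (m0_weight z)%:C * chi k q.+1 (solenoid_shift z) =
    2^-1 * (1 * chi (k + 2 * 3 ^+ q) q z + chi (k - 2 * 3 ^+ q) q z) + chi k q z.
  rewrite m0_weightE chi_shift mulrDl !mul1r addrC; congr (_ + _).
  rewrite -mulrA mulrDl !chiM !add0n.
  by rewrite expn0 !mulr1 ![_ * _ + k]addrC -natz natrX mulNr.
under [X in cintegral _ X]eq_fun do rewrite E.
have cs : cintegrable m (fun z => 1 * chi (k + 2 * 3 ^+ q) q z + chi (k - 2 * 3 ^+ q) q z).
  apply: ci; apply: cboundedD; last exact: cbounded_chi.
  by apply: cboundedM; [exact: cbounded_cst|exact: cbounded_chi].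
rewrite (cintegral_linear _ cs (cc _ _)) (cintegral_linear _ (cc _ _) (cc _ _)).
by rewrite mul1r addrC.
Qed.

(** Monotone convergence from the simple functions, which are bounded and so covered by
    [cintegral_shift]. *)
Lemma integral_shift (g : borel_solenoid R -> R) : measurable_fun setT g ->
  (forall z, 0 <= g z) ->
  (\int[m]_z (m0_weight z * g (solenoid_shift z))%:E = \int[m]_z (g z)%:E)%E.
Proof.
move=> mg g0.
have bounded_case (s : {nnsfun borel_solenoid R >-> R}) :
    (\int[m]_z (m0_weight z * s (solenoid_shift z))%:E = \int[m]_z (s z)%:E)%E.
  have [B [_ sB]] := simple_bounded s.
  have bs : cbounded (fun z : borel_solenoid R => (s z)%:C : R[i]).
    split; first by apply: cmeasurable_real; exact: measurable_funP.
    exists (B + 1) => z; rewrite normc_real.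
    by apply: (sB (B + 1)); [rewrite ltrDl|].
  have bw : cbounded (fun z : borel_solenoid R =>
    (m0_weight z)%:C * (s (solenoid_shift z))%:C : R[i]).
    apply: (cboundedM cbounded_m0_weight); have [ms [C sC]] := bs.
    by split; [exact: (cmeasurable_shift ms)|exists C].
  have := cintegral_shift bs; move=> /(congr1 (@complex.Re R)).
  rewrite /cintegral /=.
  under eq_Rintegral do rewrite mul0r subr0.
  move=> h; have := congr1 (@EFin R) h; rewrite /Rintegral !fineK//.
  - apply: integrable_fin_num => //; exact: (bounded_cintegrable bs).1.
  - have := integrable_fin_num measurableT (bounded_cintegrable bw).1.
    by under eq_integral do rewrite /= mul0r subr0.
have mgE : measurable_fun setT (EFin \o g) by exact/measurable_EFinP.
pose s := nnsfun_approx measurableT mgE.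
have cs x : (EFin \o s ^~ x) k @[k --> \oo] --> (g x)%:E.
  by apply: (cvg_nnsfun_approx measurableT mgE) => // y _; rewrite lee_fin.
have nds x : {homo (fun k => s k x) : i j / (i <= j)%N >-> i <= j}.
  by move=> i j ij; have /lefP := nd_nnsfun_approx measurableT mgE ij; apply.
have lim1 : (\int[m]_z (s k z)%:E)%E @[k --> \oo] --> (\int[m]_z (g z)%:E)%E.
  rewrite (eq_integral (fun z => limn (fun k => (s k z)%:E))); last first.
    by move=> z _; apply/esym/cvg_lim => //; exact: cs.
  apply: cvg_monotone_convergence => //.
  - by move=> k; apply/measurable_EFinP.
  - by move=> k z _; rewrite lee_fin.
  - by move=> z _ i j ij; rewrite lee_fin nds.
have lim2 : (\int[m]_z (m0_weight z * s k (solenoid_shift z))%:E)%E @[k --> \oo] -->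
    (\int[m]_z (m0_weight z * g (solenoid_shift z))%:E)%E.
  rewrite (eq_integral (fun z => limn (fun k =>
    (m0_weight z * s k (solenoid_shift z))%:E))); last first.
    move=> z _; apply/esym/cvg_lim => //; under eq_fun do rewrite EFinM.
    by rewrite EFinM; apply: cvgeZl => //; exact: cs.
  apply: cvg_monotone_convergence => //.
  - move=> k; apply/measurable_EFinP; apply: measurable_funM.
      exact: measurable_m0_weight.
    by apply: (measurableT_comp _ (@measurable_solenoid_shift R)).
  - by move=> k z _; rewrite lee_fin mulr_ge0 ?m0_weight_ge0.
  - by move=> z _ i j ij; rewrite lee_fin ler_wpM2l ?m0_weight_ge0 ?nds.
have -> : (\int[m]_z (m0_weight z * g (solenoid_shift z))%:E)%E =
    limn (fun k => \int[m]_z (m0_weight z * s k (solenoid_shift z))%:E)%E.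
  by apply/esym/cvg_lim.
under eq_fun do rewrite bounded_case.
exact/cvg_lim.
Qed.

End invariance.

(** * The Cantor set and its Hausdorff measure *)

Section digit_expansion.
Context (R : realType).
Implicit Types (a : nat -> R) (A b : R).

(** Digits are arbitrary reals, so that digitwise sums are allowed. Base 3 with digits 0, 2 gives
    the points of C, base 2 with digits 0, 1 their images under b. *)
Definition expansion b a : R := limn (series (fun k => a k / b ^+ k.+1)).

Lemma is_cvg_expansion A b a : 1 < b -> (forall k, 0 <= a k <= A) ->
  cvgn (series (fun k => a k / b ^+ k.+1)).
Proof.
move=> b1 ha; have b0 : 0 < b by lra.
have bk k : 0 < b ^+ k by rewrite exprn_gt0.
apply: (@series_le_cvg _ _ (geometric (A / b) b^-1)) => [k|k|k|].
- by rewrite divr_ge0 ?(ltW (bk _))//; have /andP[] := ha k.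
- have /andP[a0 aA] := ha 0%N; rewrite /= mulr_ge0 ?exprn_ge0 ?invr_ge0 ?(ltW b0)//.
  by rewrite divr_ge0 ?(ltW b0)// (le_trans a0).
- have /andP[_ aA] := ha k; rewrite /= exprVn exprS invfM mulrA.
  by rewrite ler_pM2r ?invr_gt0// ler_pM2r ?invr_gt0.
- apply: is_cvg_geometric_series; rewrite ger0_norm ?invr_ge0 ?(ltW b0)//.
  by rewrite invf_lt1.
Qed.

Lemma expansionS A b a : 1 < b -> (forall k, 0 <= a k <= A) ->
  expansion b a = (a 0%N + expansion b (fun k => a k.+1)) / b.
Proof.
move=> b1 ha; have b0 : b != 0 by apply/eqP; lra.
have ha' k : 0 <= a k.+1 <= A by [].
have c1 := is_cvg_expansion b1 ha; have c2 := is_cvg_expansion b1 ha'.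
apply/cvg_lim => //; rewrite -(cvg_shiftS (series _)).
have -> : [sequence series (fun k => a k / b ^+ k.+1) n.+1]_n =
    (fun n => (a 0%N + series (fun k => a k.+1 / b ^+ k.+1) n) / b).
  apply/funext => n; rewrite /= /series /= big_nat_recl// expr1 mulrDl; congr (_ + _).
  rewrite mulr_suml; apply: eq_bigr => k _.
  by rewrite [in LHS]exprS invfM mulrA mulrAC -mulrA.
by apply: cvgM; [apply: cvgD; [exact: cvg_cst|exact: c2]|exact: cvg_cst].
Qed.

Lemma expansionD A A' b a a' : 1 < b -> (forall k, 0 <= a k <= A) ->
  (forall k, 0 <= a' k <= A') ->
  expansion b (fun k => a k + a' k) = expansion b a + expansion b a'.
Proof.
move=> b1 ha ha'; apply/cvg_lim => //.
have c1 := is_cvg_expansion b1 ha; have c2 := is_cvg_expansion b1 ha'.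
have -> : series (fun k => (a k + a' k) / b ^+ k.+1) =
    (fun n => series (fun k => a k / b ^+ k.+1) n + series (fun k => a' k / b ^+ k.+1) n).
  apply/funext => n; rewrite /series /= -big_split/=.
  by apply: eq_bigr => k _; rewrite mulrDl.
exact: cvgD c1 c2.
Qed.

Lemma expansion_ge0 A b a : 1 < b -> (forall k, 0 <= a k <= A) -> 0 <= expansion b a.
Proof.
move=> b1 ha; apply: limr_ge; first exact: is_cvg_expansion b1 ha.
apply: nearW => n; apply: sumr_ge0 => k _; have /andP[a0 _] := ha k.
by rewrite divr_ge0// exprn_ge0//; lra.
Qed.

Lemma expansion_cst A b : 1 < b -> 0 <= A -> expansion b (fun=> A) = A / (b - 1).
Proof.
move=> b1 A0; have b0 : b != 0 by apply/eqP; lra.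
have b10 : b - 1 != 0 by apply/eqP; lra.
have := @expansionS A b (fun=> A) b1 (fun=> _); rewrite A0 lexx => /(_ (fun=> isT)) h.
have hb : expansion b (fun=> A) * b = A + expansion b (fun=> A) by rewrite {1}h divfK.
by apply: (mulIf b10); rewrite divfK// mulrBr mulr1 hb addrK.
Qed.

Lemma expansion_le A b a : 1 < b -> (forall k, 0 <= a k <= A) ->
  expansion b a <= A / (b - 1).
Proof.
move=> b1 ha; have A0 : 0 <= A by have /andP[/le_trans] := ha 0%N; exact.
have hA k : 0 <= A - a k <= A by have /andP[? ?] := ha k; apply/andP; split; lra.
rewrite -expansion_cst//.
have -> : expansion b (fun=> A) = expansion b (fun k => a k + (A - a k)).
  by congr expansion; apply/funext => k; rewrite addrC subrK.
by rewrite (expansionD b1 ha hA) lerDl (expansion_ge0 b1 hA).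
Qed.

(** Digits read off by iterating an expanding map: the n-th partial sum is x_0 - x_n / b^n, and the
    remainders stay bounded. *)
Lemma expansion_remainder (b : R) a (x : nat -> R) (B : R) : 1 < b ->
  (forall k, 0 <= x k <= B) -> (forall k, x k = (a k + x k.+1) / b) ->
  expansion b a = x 0%N.
Proof.
move=> b1 xB xS; have b0 : 0 < b by lra.
have E n : series (fun k => a k / b ^+ k.+1) n = x 0%N - x n / b ^+ n.
  elim: n => [|n ih]; first by rewrite /series /= big_geq// expr0 divr1 subrr.
  have bn : b ^+ n != 0 by rewrite expf_neq0// gt_eqF.
  rewrite seriesEnat/= big_nat_recr//= -[X in X + _]/(series _ n) ih (xS n) exprS.
  by field; rewrite bn gt_eqF.
apply/cvg_lim => //; rewrite (_ : series _ = (fun n => x 0%N - x n / b ^+ n)); last exact/funext.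
rewrite -[X in _ --> X]subr0; apply: cvgB; first exact: cvg_cst.
apply: (@squeeze_cvgr _ _ _ _ (fun=> 0) (fun n => B * b^-1 ^+ n)).
- apply: nearW => n; have /andP[x0 x1] := xB n.
  rewrite divr_ge0 ?exprn_ge0 ?(ltW b0)//= exprVn ler_wpM2r// invr_ge0 exprn_ge0//.
  exact: ltW.
- exact: cvg_cst.
- by apply: cvg_geometric; rewrite ger0_norm ?invr_ge0 ?(ltW b0)// invf_lt1.
Qed.
End digit_expansion.

Section Cantor.
Context (R : realType).
Local Notation C := (@Cantor_set R).
Implicit Types (x : R) (d : nat -> bool).

Definition bin_digits (A : R) d k : R := if d k then A else 0.

Lemma bin_digits_itv (A : R) d k : 0 <= A -> 0 <= bin_digits A d k <= A.
Proof. by rewrite /bin_digits; case: (d k) => ->; rewrite lexx. Qed.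

Definition cantor_point d : R := expansion 3 (bin_digits 2 d).

Let lt13 : (1 : R) < 3. Proof. by lra. Qed.
Let le02 : (0 : R) <= 2. Proof. by []. Qed.

Lemma ternaryE (d : nat -> 'I_3) : ternary R d = expansion 3 (fun k => (d k)%:R).
Proof. by []. Qed.

Lemma ternary_itv (d : nat -> 'I_3) k : 0 <= ((d k)%:R : R) <= 2.
Proof. by rewrite ler0n/= (ler_nat R _ 2) -ltnS. Qed.

Lemma Cantor_setP x : C x <-> exists d, x = cantor_point d.
Proof.
split=> [[d d1 ->]|[d ->]].
  exists (fun k => d k != 0%N :> nat); rewrite ternaryE; congr expansion.
  apply/funext => k; rewrite /bin_digits; have := d1 k.
  by case: (d k) => -[|[|[|]]].
exists (fun k => if d k then ord_max else ord0) => [k|]; first by case: (d k).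
rewrite ternaryE; congr expansion; apply/funext => k; rewrite /bin_digits.
by case: (d k).
Qed.

Lemma cantor_pointS d :
  cantor_point d = ((if d 0%N then 2 else 0) + cantor_point (fun k => d k.+1)) / 3.
Proof. by rewrite /cantor_point (expansionS lt13 (bin_digits_itv d ^~ le02)). Qed.

Lemma cantor_point_itv d : 0 <= cantor_point d <= 1.
Proof.
rewrite (expansion_ge0 lt13 (bin_digits_itv d ^~ le02))/=.
rewrite (le_trans (expansion_le lt13 (bin_digits_itv d ^~ le02)))//.
by rewrite ler_pdivrMr; lra.
Qed.

Lemma Cantor_set_itv x : C x -> 0 <= x <= 1.
Proof. by move=> /Cantor_setP[d ->]; exact: cantor_point_itv. Qed.

Lemma Cantor_set_self x : C x <-> C (3 * x) \/ C (3 * x - 2).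
Proof.
split=> [/Cantor_setP[d ->]|].
  rewrite cantor_pointS; case: (d 0%N); [right|left]; apply/Cantor_setP;
    exists (fun k => d k.+1); by field.
move=> [] /Cantor_setP[d h]; apply/Cantor_setP.
  exists (fun k => if k is k'.+1 then d k' else false).
  by rewrite cantor_pointS/= -h; field.
exists (fun k => if k is k'.+1 then d k' else true).
by rewrite cantor_pointS/= -h; field.
Qed.

Lemma Cantor_set_compl x : C x -> C (1 - x).
Proof.
move=> /Cantor_setP[d ->]; apply/Cantor_setP; exists (fun k => ~~ d k).
apply/eqP; rewrite subr_eq addrC; apply/eqP.
rewrite /cantor_point -(expansionD lt13 (bin_digits_itv d ^~ le02)
  (bin_digits_itv (fun k => ~~ d k) ^~ le02)).
rewrite (_ : (fun k => _) = fun=> 2); first by rewrite expansion_cst//; field.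
by apply/funext => k; rewrite /bin_digits; case: (d k); rewrite /= ?addr0 ?add0r.
Qed.

(** The usual decreasing finite unions of intervals, which give the measurability of C. *)
Fixpoint Cantor_approx n : set R := if n is n'.+1 then
  [set x | Cantor_approx n' (3 * x)] `|` [set x | Cantor_approx n' (3 * x - 2)]
  else `[0, 1].

Lemma measurable_affine (r c : R) : measurable_fun setT (fun x : R => r * x + c).
Proof. by apply: measurable_funD => //; exact: measurable_funM. Qed.

Lemma measurable_preimage_affine (r c : R) (A : set R) : measurable A ->
  measurable [set x | A (r * x + c)].
Proof.
by move=> mA; rewrite -[X in measurable X]setTI; exact: (measurable_affine r c).
Qed.

Lemma measurable_Cantor_approx n : measurable (Cantor_approx n).
Proof.
elim: n => [|n ih] /=; first exact: measurable_itv.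
apply: measurableU; last exact: (measurable_preimage_affine 3 (-2) ih).
rewrite (_ : [set _ | _] = [set x | Cantor_approx n (3 * x + 0)]).
  exact: (measurable_preimage_affine 3 0 ih).
by apply/seteqP; split=> x /=; rewrite addr0.
Qed.

Lemma Cantor_approx_itv n x : Cantor_approx n x -> 0 <= x <= 1.
Proof.
elim: n x => [|n ih] x /=; first by rewrite in_itv.
by move=> [] /ih/andP[? ?]; apply/andP; split; lra.
Qed.

Lemma Cantor_set_bigcap : C = \bigcap_n Cantor_approx n.
Proof.
apply/seteqP; split=> x.
  move=> Cx n _; elim: n x Cx => [|n ih] x Cx /=.
    by rewrite in_itv/=; exact: Cantor_set_itv.
  by have [/ih|/ih] := (Cantor_set_self x).1 Cx; [left|right].
move=> hx.
(* Points of the first approximation lie in [0, 1/3] or [2/3, 1], so comparison with 1/2 finds the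
   digit. *)
pose tau (y : R) := 3 * y - (if y < 2^-1 then 0 else 2).
pose y k := iter k tau x.
have hy k n : Cantor_approx n (y k).
  elim: k n => [|k ih] n; first exact: hx.
  rewrite /y iterS -/(y k) /tau; have /= := ih n.+1; case: ltP => h [].
  - by rewrite subr0.
  - by move=> /Cantor_approx_itv/andP[? ?]; exfalso; lra.
  - by move=> /Cantor_approx_itv/andP[? ?]; exfalso; lra.
  - by [].
apply/Cantor_setP; exists (fun k => ~~ (y k < 2^-1)).
apply/esym/(@expansion_remainder _ _ _ y 1 lt13) => k.
  exact: Cantor_approx_itv (hy k 0%N).
by rewrite /bin_digits [y k.+1]iterS -/(y k) /tau; case: ltP => _ /=; field.
Qed.

Lemma measurable_Cantor_set : measurable C.
Proof.
by rewrite Cantor_set_bigcap; apply: bigcap_measurable => [|n _];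
  [exists 0%N|exact: measurable_Cantor_approx].
Qed.
End Cantor.

(** * The Hoelder estimate for the map b *)

Section power_inequality.
Context (R : realType).

(** Both a + b and a' are convex combinations of a and a' + b, with complementary weights; the two
    convexity inequalities are added. *)
Lemma powR_increment (t a a' b : R) : 1 <= t -> 0 <= a -> a <= a' -> 0 <= b ->
  (a + b) `^ t - a `^ t <= (a' + b) `^ t - a' `^ t.
Proof.
move=> t1 a0 aa' b0; have [E|D0] := eqVneq (a' - a + b) 0.
  have -> : a' = a by lra.
  by have -> : b = 0 by lra.
have {}D0 : 0 < a' - a + b by rewrite lt_def D0/=; lra.
set D := a' - a + b in D0.
have cvx (w : R) : 0 <= w <= 1 ->
    (w * a + (1 - w) * (a' + b)) `^ t <= w * a `^ t + (1 - w) * (a' + b) `^ t.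
  move=> /andP[w0 w1].
  have := convex_powR t1 (Itv01 w0 w1) (x := a) (y := a' + b).
  rewrite !inE /= !in_itv /= !andbT => h; apply: (h a0).
  by rewrite addr_ge0//; lra.
have w1 : 0 <= (a' - a) / D <= 1.
  rewrite divr_ge0 ?subr_ge0 ?(ltW D0)//= ler_pdivrMr// /D; lra.
have w2 : 0 <= b / D <= 1.
  rewrite divr_ge0 ?(ltW D0)//= ler_pdivrMr// /D; lra.
have Dn : D != 0 by rewrite gt_eqF.
have e1 : (a' - a) / D * a + (1 - (a' - a) / D) * (a' + b) = a + b.
  by rewrite /D in Dn *; field.
have e2 : b / D * a + (1 - b / D) * (a' + b) = a'.
  by rewrite /D in Dn *; field.
have := cvx _ w1; have := cvx _ w2; rewrite e1 e2.
have : (a' - a) / D + b / D = 1 by rewrite -mulrDl divff.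
move: ((a' - a) / D) (b / D) => u v uv.
have -> : v = 1 - u by lra.
by lra.
Qed.

(** Raise a to 1 and then b to 1: by [powR_increment] (a + b)^t - a^t - b^t is at most its value at
    a = b = 1, which is 2^t - 2 = 1. *)
Lemma powR_add_le (t a b : R) : 1 <= t -> 2 `^ t = 3 -> 0 <= a <= 1 -> 0 <= b <= 1 ->
  (a + b) `^ t <= 1 + a `^ t + b `^ t.
Proof.
move=> t1 t3 /andP[a0 a1] /andP[b0 b1].
have := powR_increment t1 a0 a1 b0; have := powR_increment t1 b0 b1 (ler01 : 0 <= 1 :> R).
rewrite (addrC 1 b) powR1 (_ : 1 + 1 = 2)// t3; lra.
Qed.
End power_inequality.

Section Hoelder.
Context (R : realType).
Local Notation s := (@log3_2 R).
Local Notation t := ((@log3_2 R)^-1).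
Local Notation C := (@Cantor_set R).

Definition binary_value (d : nat -> bool) : R := expansion 2 (bin_digits 1 d).

Let lt12 : (1 : R) < 2. Proof. by lra. Qed.
Let lt13 : (1 : R) < 3. Proof. by lra. Qed.
Let s0 : 0 < s := log3_2_gt0 R.

Lemma powR_3_log3_2 : 3 `^ s = 2 :> R.
Proof.
rewrite /powR gt_eqF// /log3_2 divfK ?lnK ?posrE//.
by rewrite gt_eqF// ln_gt0.
Qed.

Lemma powR_2_t : 2 `^ t = 3 :> R.
Proof. by rewrite -powR_3_log3_2 -powRrM divff ?gt_eqF// powRr1. Qed.

Lemma t_ge1 : 1 <= t.
Proof.
rewrite /log3_2 invf_div ler_pdivlMr ?ln_gt0//.
by rewrite mul1r ler_ln ?posrE//; lra.
Qed.

Lemma binary_value_itv d : 0 <= binary_value d <= 1.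
Proof.
rewrite (expansion_ge0 lt12 (bin_digits_itv d ^~ ler01))/=.
rewrite (le_trans (expansion_le lt12 (bin_digits_itv d ^~ ler01)))//.
by rewrite ler_pdivrMr; lra.
Qed.

Lemma binary_valueS d : binary_value d =
  ((if d 0%N then 1 else 0) + binary_value (fun k => d k.+1)) / 2.
Proof. by rewrite /binary_value (expansionS lt12 (bin_digits_itv d ^~ ler01)). Qed.

Lemma binary_value_compl d : binary_value (fun k => ~~ d k) = 1 - binary_value d.
Proof.
apply/esym/eqP; rewrite subr_eq addrC; apply/eqP.
rewrite /binary_value -(expansionD lt12 (bin_digits_itv d ^~ ler01)
  (bin_digits_itv (fun k => ~~ d k) ^~ ler01)).
rewrite (_ : (fun k => _) = fun=> 1 : R); first by rewrite expansion_cst//; field.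
by apply/funext => k; rewrite /bin_digits; case: (d k); rewrite /= ?addr0 ?add0r.
Qed.

Lemma cantor_point_compl d : cantor_point R (fun k => ~~ d k) = 1 - cantor_point R d.
Proof.
apply/esym/eqP; rewrite subr_eq addrC; apply/eqP.
rewrite /cantor_point -(expansionD lt13 (bin_digits_itv d ^~ (ler0n R 2))
  (bin_digits_itv (fun k => ~~ d k) ^~ (ler0n R 2))).
rewrite (_ : (fun k => _) = fun=> 2 : R); first by rewrite expansion_cst//; field.
by apply/funext => k; rewrite /bin_digits; case: (d k); rewrite /= ?addr0 ?add0r.
Qed.

Lemma binary_value_surj y : 0 <= y <= 1 -> exists d, y = binary_value d.
Proof.
move=> y01.
pose tau (y : R) := 2 * y - (if y < 2^-1 then 0 else 1).
pose x k := iter k tau y.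
have hx k : 0 <= x k <= 1.
  elim: k => // k /andP[a b]; rewrite /x iterS -/(x k) /tau.
  by case: ltP => ?; apply/andP; split; lra.
exists (fun k => ~~ (x k < 2^-1)).
apply/esym/(@expansion_remainder _ _ _ x 1 lt12) => // k.
by rewrite /bin_digits [x k.+1]iterS -/(x k) /tau; case: ltP => _ /=; field.
Qed.

(* The excess [binary_value d `^ t - cantor_point d] is at most a third of the
   excess of the shifted digits, hence nonpositive. *)
Lemma binary_value_le_cantor_point d : binary_value d `^ t <= cantor_point R d.
Proof.
have step e : binary_value e `^ t - cantor_point R e <=
    (binary_value (fun k => e k.+1) `^ t - cantor_point R (fun k => e k.+1)) / 3.
  rewrite (binary_valueS e) (cantor_pointS R e).
  have /andP[c0 c1] := binary_value_itv (fun k => e k.+1).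
  have h2 x : 0 <= x -> (x / 2) `^ t = x `^ t / 3.
    move=> x0; rewrite powRM ?invr_ge0//; congr (_ * _).
    have : (2 * 2^-1) `^ t = 1 by rewrite divff// powR1.
    by rewrite powRM ?invr_ge0// powR_2_t => h; apply: (mulfI (_ : 3 != 0)) => //; rewrite h divff.
  case: (e 0%N); last by rewrite add0r h2//; lra.
  rewrite h2 ?addr_ge0//.
  (* With first digit 1 the inequality reads ((1 + c) / 2)^t <= (2 + c^t) / 3, and 2 / 3 is what
     this digit contributes to the point of C. *)
  have := @powR_add_le R _ 1 _ t_ge1 powR_2_t _ (binary_value_itv (fun k => e k.+1)).
  by rewrite ler01 lexx powR1 => /(_ isT); lra.
have bound n e : binary_value e `^ t - cantor_point R e <= 3^-1 ^+ n.
  elim: n e => [|n ih] e.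
    have /andP[c0 c1] := binary_value_itv e; have /andP[x0 x1] := cantor_point_itv R e.
    rewrite expr0; suff : binary_value e `^ t <= 1 by lra.
    have t1 := t_ge1; have <- : 1 `^ t = 1 by rewrite powR1.
    by rewrite ge0_ler_powR ?nnegrE//; lra.
  by rewrite (le_trans (step e))// exprSr ler_wpM2r.
rewrite -subr_le0; have : (3^-1 : R) ^+ n @[n --> \oo] --> 0.
  have := @cvg_geometric R 1 3^-1; rewrite ger0_norm// invf_lt1// => /(_ lt13).
  by rewrite (_ : geometric _ _ = [eta GRing.exp 3^-1])//; apply/funext => n /=; rewrite mul1r.
move=> h; rewrite -(cvg_lim _ h)//; apply: limr_ge; first exact: cvgP h.
exact: nearW.
Qed.

(** A common first digit can be removed, since it halves both sides because 3^-s = 1/2. This reduces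
    the claim to different first digits; if these are 0 and 1 in this order, the left side is not
    positive. *)
Lemma binary_value_Hoelder d d' : binary_value d - binary_value d' <=
  `|cantor_point R d - cantor_point R d'| `^ s.
Proof.
have [->|dd'] := pselect (d = d'); first by rewrite subrr powR_ge0.
have {dd'} ex : exists n, d n != d' n.
  apply: contrapT => h; apply: dd'; apply/funext => n; apply/eqP.
  by apply: contrapT => /negP hn; apply: h; exists n.
case: (ex_minnP ex) => n; elim: n d d' {ex} => [|n ih] d d' dn hmin; last first.
  have d0 : d 0%N = d' 0%N.
    by apply/eqP; apply: contraT => /hmin.
  have hS : forall k, d k.+1 != d' k.+1 -> (n <= k)%N by move=> k /hmin.
  have := ih _ _ dn hS.
  rewrite (binary_valueS d) (binary_valueS d') (cantor_pointS R d) (cantor_pointS R d') d0.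
  set c := binary_value _; set c' := binary_value _; set x := cantor_point R _;
    set x' := cantor_point R _.
  move=> h; set q := if _ then _ else _; set r := if _ then _ else _.
  have -> : (r + x) / 3 - (r + x') / 3 = (x - x') / 3 by field.
  have -> : (q + c) / 2 - (q + c') / 2 = (c - c') / 2 by field.
  rewrite normrM powRM ?normr_ge0// normfV (ger0_norm (ler0n _ 3)).
  have -> : 3^-1 `^ s = 2^-1.
    have : (3 * 3^-1) `^ s = 1 by rewrite divff// powR1.
    by rewrite powRM ?invr_ge0// powR_3_log3_2 => h'; apply: (mulfI (_ : 2 != 0)) => //;
      rewrite h' divff.
  by rewrite ler_pM2r.
have := binary_valueS d; have := binary_valueS d'.
have := cantor_pointS R d; have := cantor_pointS R d'.
have /andP[b0 b1] := binary_value_itv (fun k => d k.+1).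
have /andP[b0' b1'] := binary_value_itv (fun k => d' k.+1).
have hb := binary_value_le_cantor_point (fun k => d k.+1).
have hb' := binary_value_le_cantor_point (fun k => ~~ d' k.+1).
rewrite binary_value_compl cantor_point_compl in hb'.
have x01 := cantor_point_itv R (fun k => d k.+1).
have x01' := cantor_point_itv R (fun k => d' k.+1).
case: (d 0%N) (d' 0%N) dn => -[]// _ -> -> -> ->; last first.
  by apply: le_trans (powR_ge0 _ _); lra.
set a := binary_value _ in b0 b1 hb *; set b := binary_value _ in b0' b1' hb' *.
set x := cantor_point _ _ in hb x01 *; set y := cantor_point _ _ in hb' x01' *.
(* [a] is compared with [x] directly, and [1 - b] with [1 - y] through the complemented digits; the
   resulting inequality is then raised to the power s. *)
have h := @powR_add_le R _ a (1 - b) t_ge1 powR_2_t.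
have {}h : (a + (1 - b)) `^ t <= 1 + x + (1 - y).
  apply: le_trans (h _ _) _; [by rewrite b0|by apply/andP; split; lra|lra].
have xy0 : 0 <= 1 + x + (1 - y) by move: x01 x01' => /andP[? ?] /andP[? ?]; lra.
have {}h : a + (1 - b) <= (1 + x + (1 - y)) `^ s.
  have -> : a + (1 - b) = ((a + (1 - b)) `^ t) `^ s.
    by rewrite -powRrM mulVf ?gt_eqF// powRr1//; lra.
  by rewrite ge0_ler_powR ?nnegrE ?powR_ge0// ltW.
have -> : (1 + a) / 2 - (0 + b) / 2 = (a + (1 - b)) / 2 by field.
have -> : (2 + x) / 3 - (0 + y) / 3 = (1 + x + (1 - y)) / 3 by field.
rewrite ger0_norm ?divr_ge0// powRM//.
have -> : 3^-1 `^ s = 2^-1.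
  have : (3 * 3^-1) `^ s = 1 by rewrite divff// powR1.
  by rewrite powRM ?invr_ge0// powR_3_log3_2 => h'; apply: (mulfI (_ : 2 != 0)) => //;
    rewrite h' divff.
by rewrite ler_pM2r.
Qed.
End Hoelder.

(** * Scaling and normalization of the Hausdorff measure *)

Section hausdorff_facts.
Context (R : realType) (s : R) (s0 : 0 < s).
Implicit Types (A B : set R) (e : R).
Local Open Scope ereal_scope.

Lemma diameter_le A (b : R) : (0 <= b)%R ->
  (forall x y, A x -> A y -> (`|x - y| <= b)%R) -> diameter A <= b%:E.
Proof.
move=> b0 h; apply: ge_ereal_sup => _ [->|[x Ax [y Ay <-]]]; rewrite lee_fin//.
exact: h.
Qed.

Lemma le_poweR_diameter A (b : R) : diameter A <= b%:E ->
  diameter A `^ s <= (b `^ s)%:E.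
Proof.
move=> h; rewrite -poweR_EFin; have D0 := diameter_ge0 A.
apply: gt0_ler_poweR => //; first exact: ltW.
  by rewrite in_itv/= D0 leey.
by rewrite in_itv/= leey andbT (le_trans D0).
Qed.

Lemma hausdorff_pre_cover e A (U : nat -> set R) n :
  (0 <= e)%R -> (forall k, (k < n)%N -> diameter (U k) <= e%:E) ->
  (forall x, A x -> exists2 k, (k < n)%N & U k x) ->
  hausdorff_pre s e A <= \sum_(k < n) diameter (U k) `^ s.
Proof.
move=> e0 dU AU; pose V k := if (k < n)%N then U k else set0.
have p0 : diameter set0 `^ s = 0 :> \bar R by rewrite diameter0 poweR0r// gt_eqF.
apply: (@le_trans _ _ (\sum_(k <oo) diameter (V k) `^ s)).
  apply: ereal_inf_lbound; exists V => //; split.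
    by move=> k; rewrite /V; case: ifP => [/dU//|_]; rewrite diameter0 lee_fin.
  by move=> x /AU[k kn Ux]; exists k => //; rewrite /V kn.
rewrite (nneseries_split 0 n); last by move=> *; exact: poweR_ge0.
rewrite add0n [X in _ + X]eseries0 ?adde0; last first.
  by move=> k nk _; rewrite /V ltnNge nk.
by rewrite big_mkord lee_sum// => i _; rewrite /V ltn_ord.
Qed.

Lemma hausdorff_point x : hausdorff s [set x] = 0.
Proof.
apply/eqP; rewrite eq_le hausdorff_ge0 andbT.
have d0 : diameter [set x] = 0 :> \bar R.
  apply/eqP; rewrite eq_le diameter_ge0 andbT; apply: diameter_le => // y z -> ->.
  by rewrite subrr normr0.
apply: ge_ereal_sup => _ [e /= e0 <-].
have := @hausdorff_pre_cover e [set x] (fun=> [set x]) 1 (ltW e0).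
rewrite big_ord1 d0 poweR0r ?gt_eqF//; apply => [k _|y ->].
  by rewrite lee_fin ltW.
by exists 0%N.
Qed.

Let hausdorff_affine_le (r c : R) A : (0 < r)%R ->
  hausdorff s [set x | A (r * x + c)%R] <= (r `^ - s)%:E * hausdorff s A.
Proof.
move=> r0; have k0 : (0 < r `^ - s)%R by rewrite powR_gt0.
apply: ge_ereal_sup => _ [e /= e0 <-].
have re0 : (0 < r * e)%R by rewrite mulr_gt0.
apply: (@le_trans _ _ ((r `^ - s)%:E * hausdorff_pre s (r * e) A)); last first.
  by rewrite lee_pmul2l// ?hausdorff_pre_le_hausdorff// lte_fin.
rewrite -lee_pdivrMl//; apply: le_ereal_inf_tmp => _ [U [dU AU] <-].
rewrite lee_pdivrMl// -nneseriesZl//; last by move=> *; exact: poweR_ge0.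
have dP k : diameter [set x | U k (r * x + c)%R] <= (r^-1)%:E * diameter (U k).
  apply: ge_ereal_sup => _ [->|[x Ux [y Uy <-]]].
    by rewrite mule_ge0 ?diameter_ge0// lee_fin invr_ge0 ltW.
  have := @le_diameter _ (r * x + c)%R (r * y + c)%R (U k) Ux Uy.
  rewrite lee_pdivlMl// -EFinM => h; apply: (le_trans _ h); rewrite lee_fin.
  rewrite -{1}(gtr0_norm r0) -normrM le_eqVlt; apply/orP; left; apply/eqP.
  by congr (`|_|)%R; ring.
apply: (@le_trans _ _ (\sum_(k <oo) diameter [set x | U k (r * x + c)%R] `^ s)).
  apply: ereal_inf_lbound; exists (fun k => [set x | U k (r * x + c)%R]) => //.
  split => [k|x /AU[k _ Ux]]; last by exists k.
  apply: le_trans (dP k) _; rewrite lee_pdivrMl// -EFinM; exact: dU.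
apply: lee_nneseries => [*|k _]; first exact: poweR_ge0.
have -> : (r `^ - s)%:E = (r^-1)%:E `^ s.
  by rewrite poweR_EFin -powR_inv1 ?ltW// -powRrM mulN1r.
rewrite -poweRM ?diameter_ge0//; last by rewrite lee_fin invr_ge0 ltW.
apply: gt0_ler_poweR (dP k); first exact: ltW.
  by rewrite in_itv/= diameter_ge0 leey.
by rewrite in_itv/= leey andbT (le_trans (diameter_ge0 _) (dP k)).
Qed.

Lemma hausdorff_affine (r c : R) A : (0 < r)%R ->
  hausdorff s [set x | A (r * x + c)%R] = (r `^ - s)%:E * hausdorff s A.
Proof.
move=> r0; apply/eqP; rewrite eq_le hausdorff_affine_le//=.
have r0' : (0 < r^-1)%R by rewrite invr_gt0.
have k0 : (0 < r `^ - s)%R by rewrite powR_gt0.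
rewrite -lee_pdivlMl//.
have := @hausdorff_affine_le r^-1 (- (c / r)) [set x | A (r * x + c)%R] r0'.
have -> : [set x | [set x0 | A (r * x0 + c)%R] (r^-1 * x + - (c / r))%R] = A.
  apply/seteqP; split => x /=.
    by rewrite mulrDr mulrA divff ?gt_eqF// mul1r mulrN mulrCA divff ?gt_eqF// mulr1 subrK.
  by rewrite mulrDr mulrA divff ?gt_eqF// mul1r mulrN mulrCA divff ?gt_eqF// mulr1 subrK.
suff -> : ((r^-1) `^ (- s))%R = ((r `^ (- s))^-1)%R by [].
rewrite -[in LHS]powR_inv1 ?ltW// -powRrM mulN1r opprK.
by rewrite powRN invrK.
Qed.

End hausdorff_facts.

Section hausdorff_Cantor.
Context (R : realType).
Local Notation s := (@log3_2 R).
Local Notation C := (@Cantor_set R).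
Let s0 : 0 < s := log3_2_gt0 R.

Lemma Cantor_cover n : exists V : nat -> set R,
  (forall k, (diameter (V k) <= (3^-1 ^+ n)%:E)%E) /\
  forall x, C x -> exists2 k, (k < 2 ^ n)%N & V k x.
Proof.
elim: n => [|n [V [dV CV]]].
  exists (fun=> C); split=> [k|x Cx]; last by exists 0%N.
  apply: diameter_le => // x y /Cantor_set_itv/andP[? ?] /Cantor_set_itv/andP[? ?].
  by rewrite expr0 ler_norml; apply/andP; split; lra.
(* The parity of [k] selects the left or right third, and [k./2] the set covering its
   enlargement. *)
exists (fun k => [set x | V k./2 (3 * x - (if odd k then 2 else 0))]).
split=> [k|x /(Cantor_set_self x).1[]/CV[k kn Vk]].
- apply: diameter_le => [|x y /= Vx Vy]; first by rewrite exprn_ge0.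
  have := le_trans (@le_diameter _ (3 * x - (if odd k then 2 else 0))
    (3 * y - (if odd k then 2 else 0)) (V k./2) Vx Vy) (dV k./2).
  rewrite lee_fin exprS ler_pdivlMl// => h; rewrite -{1}(ger0_norm (ler0n R 3)) -normrM.
  by apply: (le_trans _ h); rewrite le_eqVlt; apply/orP; left; apply/eqP; congr (`|_|); ring.
- exists k.*2; first by rewrite expnS mul2n ltn_double.
  by rewrite /= odd_double doubleK subr0.
- exists k.*2.+1; first by rewrite expnS mul2n ltn_Sdouble.
  by rewrite /= odd_double/= uphalf_double.
Qed.

Lemma hausdorff_Cantor_le1 : (hausdorff s C <= 1)%E.
Proof.
apply: ge_ereal_sup => _ [e /= e0 <-].
have [n hn] : exists n : nat, (3^-1 : R) ^+ n <= e.
  have h : (3^-1 : R) ^+ n @[n --> \oo] --> 0.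
    have := @cvg_geometric R 1 3^-1; rewrite ger0_norm// invf_lt1// => /(_ _).
    rewrite (_ : geometric _ _ = [eta GRing.exp 3^-1]); last first.
      by apply/funext => n /=; rewrite mul1r.
    by apply; lra.
  have [n _ /(_ n (leqnn n)) hn] := cvgr_lt 0 h _ e0.
  by exists n; exact: ltW.
have [V [dV CV]] := Cantor_cover n.
apply: (le_trans (@hausdorff_pre_cover _ _ s0 e C V (2 ^ n) (ltW e0) _ CV)) => [k _|].
  by apply: le_trans (dV k) _; rewrite lee_fin.
apply: (@le_trans _ _ (\sum_(k < 2 ^ n) ((2^-1 : R) ^+ n)%:E)%E).
  apply: lee_sum => k _; apply: (le_trans (le_poweR_diameter s0 (dV k))).
  rewrite lee_fin -(@powR_mulrn _ 3^-1) ?invr_ge0// -powRrM mulrC powRrM.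
  have -> : 3^-1 `^ s = 2^-1.
    have : (3 * 3^-1) `^ s = 1 by rewrite divff// powR1.
    by rewrite powRM ?invr_ge0// powR_3_log3_2 => h'; apply: (mulfI (_ : 2 != 0)) => //;
      rewrite h' divff.
  by rewrite powR_mulrn ?invr_ge0.
rewrite sumEFin lee_fin big_const_ord iter_addr_0 -[_ *+ _]mulr_natr natrX -exprMn mulVf//.
Qed.

(** The map b sends the part of C in [U k] into an interval of length [delta k]. These intervals
    cover [0, 1] as b is onto, so the sum of the [delta k] is at least 1. The argument works at any
    scale; 1 is taken. *)
Lemma hausdorff_Cantor_ge1 : (1 <= hausdorff s C)%E.
Proof.
apply: le_trans (hausdorff_pre_le_hausdorff s C ltr01).
apply: le_ereal_inf_tmp => _ [U [dU CU] <-].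
have fU k : diameter (U k) \is a fin_num.
  by rewrite ge0_fin_numE ?diameter_ge0// (le_lt_trans (dU k))// ltry.
pose delta k : R := fine (diameter (U k)) `^ s.
have deltaE k : (delta k)%:E = (diameter (U k) `^ s)%E.
  by rewrite /delta -poweR_EFin fineK.
pose W k := [set y | exists2 d, U k (cantor_point R d) & y = binary_value R d].
have Wdist k y y' : W k y -> W k y' -> y <= y' + delta k.
  move=> [d Ud ->] [d' Ud' ->]; rewrite -lerBlDl.
  apply: le_trans (binary_value_Hoelder _ _ _) _.
  rewrite ge0_ler_powR ?nnegrE ?(ltW s0)//; first exact: fine_ge0 (diameter_ge0 _).
  by rewrite -lee_fin fineK//; exact: le_diameter.
(* For empty [W k] the supremum is a default value, and any interval of this length is
   acceptable. *)
pose I k : set R := `[sup (W k) - delta k, sup (W k)]%classic.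
have WI k : W k `<=` I k.
  move=> y Wy; rewrite /I /= in_itv/=; apply/andP; split; last first.
    apply: ub_le_sup => //; exists (y + delta k) => z Wz; exact: Wdist.
  rewrite lerBlDr; apply: ge_sup; first by exists y.
  by move=> z Wz; exact: Wdist.
have cov : `[0, 1]%classic `<=` \bigcup_k I k.
  move=> y /=; rewrite in_itv/= => /binary_value_surj[d ->].
  have [|k _ Uk] := CU (cantor_point R d); first by apply/Cantor_setP; exists d.
  by exists k => //; apply: WI; exists d.
have -> : 1%E = lebesgue_measure (`[0, 1]%classic : set R).
  by rewrite lebesgue_measure_itv/= lte_fin ltr01 oppr0 adde0.
apply: (le_trans (measure_sigma_subadditive (@lebesgue_measure R) _ _ cov)) => [k||].
- exact: measurable_itv.
- exact: measurable_itv.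
apply: lee_nneseries => [*|k _]; first exact: measure_ge0.
rewrite -deltaE.
have /= := @lebesgue_measure_itv R `[sup (W k) - delta k, sup (W k)].
rewrite -/(I k) => ->; case: ifPn => _; last by rewrite lee_fin powR_ge0.
by rewrite -EFinB lee_fin; lra.
Qed.

Lemma hausdorff_Cantor : hausdorff s C = 1%E.
Proof. by apply/eqP; rewrite eq_le hausdorff_Cantor_le1 hausdorff_Cantor_ge1. Qed.
End hausdorff_Cantor.

(** * The set $\mathcal{R}$ and its symmetries *)

Section fractal_set.
Context (R : realType).
Local Notation C := (@Cantor_set R).
Local Notation fractal := (@fractal R).
Implicit Types (x : R) (d : nat -> 'I_3).

Let lt13 : (1 : R) < 3. Proof. by lra. Qed.

Lemma ternaryS d : ternary R d = ((d 0%N)%:R + ternary R (fun k => d k.+1)) / 3.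
Proof. by rewrite !ternaryE (expansionS lt13 (ternary_itv R d)). Qed.

Lemma ternary_shift N d : exists a : nat,
  3 ^+ N * ternary R d = a%:R + ternary R (fun k => d (k + N)%N).
Proof.
elim: N d => [|N ih] d.
  exists 0%N; rewrite expr0 mul1r add0r; congr ternary.
  by apply/funext => k; rewrite addn0.
have [a ha] := ih (fun k => d k.+1).
exists (3 ^ N * d 0%N + a)%N; rewrite ternaryS exprSr.
have -> : (fun k => d (k + N.+1)%N) = (fun k => d (k + N).+1).
  by apply/funext => k; rewrite addnS.
by rewrite natrD natrM natrX -addrA -ha; field.
Qed.

(** The [Q] ternary digits of [n], padded with zeros, are put in front of those of [c]; the
    induction splits off the leading digit, the quotient by a power of 3. *)
Lemma nat_add_Cantor_set Q n c : (n < 3 ^ Q)%N -> C c ->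
  exists d, n%:R + c = 3 ^+ Q * ternary R d /\ finite_set [set k | d k = 1%N :> nat].
Proof.
elim: Q n => [|Q ih] n.
  rewrite expn0 ltnS leqn0 => /eqP -> [d d1 ->]; exists d.
  rewrite expr0 mul1r add0r; split=> //.
  by rewrite (_ : [set _ | _] = set0)//; apply/seteqP; split=> // k /= /d1.
move=> nQ Cc; have Q0 : (0 < 3 ^ Q)%N by rewrite expn_gt0.
have [d [hd fd]] := ih (n %% 3 ^ Q)%N (ltn_pmod _ Q0) Cc.
have aP : (n %/ 3 ^ Q < 3)%N by rewrite ltn_divLR// -expnS.
exists (fun k => if k is k'.+1 then d k' else Ordinal aP); split.
  rewrite ternaryS exprSr {1}(divn_eq n (3 ^ Q)) natrD -addrA hd natrM natrX /=.
  by field.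
apply: (@sub_finite_set _ _ ([set 0%N] `|` S @` [set k | d k = 1%N :> nat])).
  by move=> [|k] /= h; [left|right; exists k].
by rewrite finite_setU; split; [exact: finite_set1|exact: finite_image].
Qed.

(** Beyond the last digit 1 only 0 and 2 occur, so the tail is a point of C. This form carries no
    sign and is the one in which invariance and countable covers become visible. *)
Lemma fractalP x : fractal x <-> exists (k : int) (p : nat), C (3 ^+ p * x - k%:~R).
Proof.
split=> [[q [d [xE fd]]]|[k [p Cx]]].
  have [N [qN hN]] : exists N, (q <= N)%N /\ forall k, (N <= k)%N -> d k <> 1%N :> nat.
    have /finite_seqP[l hl] := fd.
    exists (maxn q (\max_(i <- l) i).+1); split; first exact: leq_maxl.
    move=> k; rewrite geq_max => /andP[_ kl] dk.
    have : [set k | d k = 1%N :> nat] k by [].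
    rewrite hl /= => kin; have := @leq_bigmax_seq _ l xpredT id k kin isT.
    by rewrite leqNgt kl.
  have [a ha] := ternary_shift N d.
  have Cc : C (ternary R (fun k => d (k + N)%N)).
    by exists (fun k => d (k + N)%N) => // k; apply: hN; rewrite leq_addl.
  have E : 3 ^+ (N - q) * `|x| - a%:R = ternary R (fun k => d (k + N)%N).
    by rewrite xE mulrA -exprD subnK// ha addrC addKr.
  have [x0|x0] := leP 0 x.
    exists a%:Z, (N - q)%N; rewrite -(ger0_norm x0).
    by rewrite (_ : a%:~R = a%:R)// E.
  (* For negative x the fractional part c is replaced by 1 - c, which is again in C; this shifts the
     integer part by one. *)
  exists (- a%:Z - 1), (N - q)%N.
  have := Cantor_set_compl Cc; rewrite -E ltr0_norm//; congr C.
  by rewrite intrB intrN /= (_ : a%:~R = a%:R)//; ring.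
have aux (y : R) (n : nat) : C (3 ^+ p * y - n%:R) -> exists (q : nat) d,
    `|y| = 3 ^+ q * ternary R d /\ finite_set [set k | d k = 1%N :> nat].
  move=> Cy; have np : (n < 3 ^ (n + p))%N.
    by rewrite (leq_trans (ltn_expl n (isT : 1 < 3)%N))// leq_pexp2l// leq_addr.
  have [d [hd fd]] := nat_add_Cantor_set np Cy.
  exists n, d; split => //.
  have p0 : 0 < 3 ^+ p :> R by rewrite exprn_gt0.
  have /andP[c0 _] := Cantor_set_itv Cy.
  have y0 : 0 <= y.
    by rewrite -(pmulr_rge0 _ p0); have : 0 <= n%:R :> R by []; lra.
  rewrite ger0_norm//; apply: (mulfI (lt0r_neq0 p0)).
  by rewrite mulrA -exprD addnC -hd addrC subrK.
case: k Cx => n Cx; first exact: (aux x n).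
rewrite /Defs.fractal /= -normrN; apply: (aux (- x) n).
have := Cantor_set_compl Cx; congr C.
by rewrite NegzE intrN /= (_ : n.+1%:~R = n.+1%:R)// -(addn1 n) natrD; ring.
Qed.

(** By self-similarity an enlarged point of C lies in an integer translate of C; this serves to pass
    to a common denominator. *)
Lemma Cantor_set_zoom r x : C x -> exists b : int, C (3 ^+ r * x - b%:~R).
Proof.
move=> Cx; elim: r => [|r [b /Cantor_set_self Cb]].
  by exists 0; rewrite expr0 mul1r subr0.
have [h|h] := Cb; [exists (3 * b)|exists (3 * b + 2)]; move: h; congr C;
  by rewrite ?intrD intrM exprS; ring.
Qed.

Lemma fractal_translate k p x : fractal (x + triadic R k p) <-> fractal x.
Proof.
have aux l y : fractal y -> fractal (y + triadic R l p).
  move=> /fractalP[j [q /(Cantor_set_zoom p)[b Cb]]]; apply/fractalP.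
  exists (b + 3 ^+ p * j + 3 ^+ q * l), (p + q)%N; move: Cb; congr C.
  rewrite /triadic !intrD !intrM !rmorphXn/= exprD.
  have : 3 ^+ p != 0 :> R by rewrite expf_neq0.
  by move=> ?; field.
split; last exact: aux.
by move=> /(aux (- k)); rewrite /triadic intrN mulNr addrK.
Qed.

Lemma fractal_scale x : fractal (3 * x) <-> fractal x.
Proof.
split=> /fractalP[k [p]].
  move=> Cx; apply/fractalP; exists k, p.+1; move: Cx; congr C.
  by rewrite exprSr mulrA.
move=> /(Cantor_set_zoom 1)[b Cb]; apply/fractalP; exists (b + 3 * k), p.
by move: Cb; congr C; rewrite intrD intrM expr1; ring.
Qed.

Lemma Cantor_sub_fractal : C `<=` fractal.
Proof.
by move=> x Cx; apply/fractalP; exists 0, 0%N; rewrite expr0 mul1r subr0.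
Qed.

Definition cantor_copy (i : int * nat) : set R := [set x | C (3 ^+ i.2 * x - i.1%:~R)].

Lemma measurable_cantor_copy i : measurable (cantor_copy i).
Proof.
exact: (measurable_preimage_affine (3 ^+ i.2) (- i.1%:~R) (@measurable_Cantor_set R)).
Qed.

(** The countably many copies of C in one sequence; codes of no pair give the empty set. *)
Definition copy_seq n : set R := if unpickle n is Some i then cantor_copy i else set0.

Lemma measurable_copy_seq n : measurable (copy_seq n).
Proof. by rewrite /copy_seq; case: unpickle => [i|//]; exact: measurable_cantor_copy. Qed.

Lemma fractal_copies : fractal = \bigcup_n copy_seq n.
Proof.
apply/seteqP; split=> x.
  move=> /fractalP[k [p Cx]]; exists (pickle (k, p)) => //.
  by rewrite /copy_seq pickleK.
move=> [n _]; rewrite /copy_seq; case: unpickle => [[k p] Cx|//].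
by apply/fractalP; exists k, p.
Qed.

Lemma measurable_fractal : measurable fractal.
Proof.
by rewrite fractal_copies; apply: bigcup_measurable => n _; exact: measurable_copy_seq.
Qed.

Local Notation H := (@hausdorff_fractal R).

Lemma ae_fractal : {ae H, forall x, (\bigcup_n copy_seq n) x}.
Proof.
rewrite -fractal_copies; exists (~` fractal); split.
- by apply: measurableC; exact: measurable_fractal.
- change (hausdorff (log3_2 R) (~` fractal `&` fractal) = 0%E).
  by rewrite setIC setICr hausdorff0// log3_2_gt0.
- by [].
Qed.

Lemma hausdorff_fractal_translate k p (A : set R) :
  H [set x | A (x + triadic R k p)] = H A.
Proof.
rewrite -[LHS]/(hausdorff _ _) -[RHS]/(hausdorff _ _).
rewrite (_ : _ `&` _ = [set x | (A `&` fractal) (1 * x + triadic R k p)]).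
  by rewrite hausdorff_affine ?log3_2_gt0// powR1 mul1e.
by apply/seteqP; split=> x /=; rewrite mul1r => -[? ?]; split => //;
  exact/(fractal_translate k p x).
Qed.

Lemma hausdorff_fractal_scale (A : set R) : H [set x | A (3 * x)] = ((2^-1)%:E * H A)%E.
Proof.
rewrite -[LHS]/(hausdorff _ _) -[H A]/(hausdorff _ _).
rewrite (_ : _ `&` _ = [set x | (A `&` fractal) (3 * x + 0)]).
  by rewrite hausdorff_affine ?log3_2_gt0// powRN powR_3_log3_2.
by apply/seteqP; split=> x /=; rewrite addr0 => -[? ?]; split => //;
  exact/(fractal_scale x).
Qed.

Lemma hausdorff_fractal_Cantor : H C = 1%E.
Proof.
rewrite -[LHS]/(hausdorff _ _) (_ : _ `&` _ = C) ?hausdorff_Cantor//.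
by apply/setIidPl; exact: Cantor_sub_fractal.
Qed.

Lemma hausdorff_fractal_sub_point x (A : set R) : A `<=` [set x] -> H A = 0%E.
Proof.
move=> Ax; apply/eqP; rewrite eq_le hausdorff_fractal_ge0 andbT.
have s0 := log3_2_gt0 R; rewrite -(hausdorff_point s0 x).
have h : A `&` fractal `<=` [set x] by move=> y [/Ax].
exact: (le_hausdorff _ h).
Qed.

End fractal_set.

(** * Characteristic functions of triadic cells *)

Section indicator_classes.
Context d (T : measurableType d) (R : realType) (mu : {measure set T -> \bar R}).

Definition cindic (E : set T) (x : T) : R[i] := (\1_E x)%:C.

Lemma square_integrable_indic (E : set T) : measurable E -> (mu E < +oo)%E ->
  square_integrable mu (cindic E).
Proof.
move=> mE fE; split; first by apply: cmeasurable_real; exact: measurable_indic.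
rewrite (eq_integral (fun x => (\1_E x)%:E)); last first.
  move=> x _; rewrite /sqr_norm /cindic normc_real indicE.
  by case: (_ \in _); rewrite /= ?normr1 ?normr0 ?expr1n ?expr0n.
by rewrite integral_indic// setIT.
Qed.

Lemma L2dot_indic (E F : set T) : measurable E -> measurable F ->
  (mu E < +oo)%E -> (mu F < +oo)%E ->
  L2dot (L2class mu (cindic E)) (L2class mu (cindic F)) = (fine (mu (E `&` F)))%:C.
Proof.
move=> mE mF fE fF; rewrite L2dotE; [|exact: square_integrable_indic..].
have -> : (fun x => cindic E x * (cindic F x)^*) = cindic (E `&` F).
  apply/funext => x; rewrite /cindic indicI rmorphM/=; congr (_ * _).
  by apply/eqP; rewrite eq_complex/= oppr0 !eqxx.
rewrite /cintegral /cindic /= Rintegral_cst// mul0r.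
by rewrite /Rintegral integral_indic ?setIT//; exact: measurableI.
Qed.

Lemma hnorm_indic (E : set T) : measurable E -> (mu E < +oo)%E ->
  hnorm (@L2dot _ _ _ mu) (L2class mu (cindic E)) = Num.sqrt (fine (mu E)).
Proof. by move=> mE fE; rewrite /hnorm L2dot_indic// setIid. Qed.

Lemma cindicU (E F : set T) : E `&` F = set0 ->
  cindic (E `|` F) = cindic E + cindic F.
Proof.
move=> EF; apply/funext => x; rewrite -[RHS]/(cindic E x + cindic F x) /cindic.
rewrite !indicE in_setU.
have [/set_mem Ex|] := boolP (x \in E); have [/set_mem Fx|] := boolP (x \in F);
  rewrite /= ?addr0 ?add0r//.
by have : (E `&` F) x by []; rewrite EF.
Qed.
End indicator_classes.

(** * Change of variables, cells and overlaps *)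

Section fractal_integral.
Context (R : realType).
Local Notation C := (@Cantor_set R).
Local Notation H := (@hausdorff_fractal R).
Implicit Types (g : R -> \bar R) (k : int) (l : R) (p q n : nat).

Lemma integral_translate k p g : measurable_fun setT g -> (forall x, 0 <= g x)%E ->
  (\int[H]_x g (x + triadic R k p)%R = \int[H]_x g x)%E.
Proof.
move=> mg g0.
have mphi : measurable_fun setT (fun x : R => x + triadic R k p).
  by apply: measurable_funD.
have := @ge0_integral_pushforward _ _ _ _ R _ mphi H setT g measurableT mg.
rewrite preimage_setT => <-; last by move=> y _; exact: g0.
apply: eq_measure_integral => A mA _.
exact: (hausdorff_fractal_translate k p A).
Qed.

(** The factor is 3^s = 2, which is why 1 / sqrt 2 makes the dilation isometric. *)
Lemma integral_dilate g : measurable_fun setT g -> (forall x, 0 <= g x)%E ->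
  (\int[H]_x g (x / 3)%R = 2%:E * \int[H]_x g x)%E.
Proof.
move=> mg g0.
have mphi : measurable_fun setT (fun x : R => x / 3) by apply: measurable_funM.
have := @ge0_integral_pushforward _ _ _ _ R _ mphi H setT g measurableT mg.
rewrite preimage_setT => <-; last by move=> y _; exact: g0.
rewrite -(@ge0_integral_mscale _ _ R H setT measurableT (2%:nng)%R g mg)//.
apply: eq_measure_integral => A mA _.
have := hausdorff_fractal_scale [set x | A (x / 3)%R].
rewrite (_ : [set x | _ (3 * x)%R] = A); last first.
  by apply/seteqP; split=> x /=; rewrite mulrAC divff// mul1r.
move=> E; change (H [set x | A (x / 3)%R] = 2%:E * H A)%E.
by rewrite E muleA -EFinM divff// mul1e.
Qed.

(** The copy l + 3^-n C of the Cantor set; level 0 gives the translates of C itself. *)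
Definition cell n (l : R) : set R := [set x | C (3 ^+ n * (x - l))].

Lemma measurable_cell n l : measurable (cell n l).
Proof.
have := measurable_preimage_affine (3 ^+ n) (- (3 ^+ n * l)) (@measurable_Cantor_set R).
by congr measurable; apply/seteqP; split=> x; rewrite /cell /= mulrBr.
Qed.

Lemma cell_Cantor n : H [set x | C (3 ^+ n * x)] = ((2^-1) ^+ n)%:E.
Proof.
elim: n => [|n ih].
  rewrite expr0 -(@hausdorff_fractal_Cantor R); congr (H _).
  by apply/seteqP; split=> x /=; rewrite mul1r.
rewrite [in RHS]exprS EFinM -ih -hausdorff_fractal_scale; congr (H _).
by apply/seteqP; split=> x /=; rewrite exprSr mulrA.
Qed.

Lemma cell_measure n k p : H (cell n (triadic R k p)) = ((2^-1) ^+ n)%:E.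
Proof.
rewrite -cell_Cantor -(hausdorff_fractal_translate (- k) p [set x | C (3 ^+ n * x)]).
by congr (H _); apply/seteqP; split=> x; rewrite /cell /= /triadic intrN mulNr.
Qed.

Lemma cell_fin n k p : (H (cell n (triadic R k p)) < +oo)%E.
Proof. by rewrite cell_measure ltry. Qed.

Lemma cellS n (l : R) : cell n l = cell n.+1 l `|` cell n.+1 (l + 2 / 3 ^+ n.+1).
Proof.
have p0 : 3 ^+ n.+1 != 0 :> R by rewrite expf_neq0.
have E1 x : 3 * (3 ^+ n * (x - l)) = 3 ^+ n.+1 * (x - l) by rewrite exprS mulrA.
have E2 x : 3 * (3 ^+ n * (x - l)) - 2 = 3 ^+ n.+1 * (x - (l + 2 / 3 ^+ n.+1)).
  by rewrite E1; field.
apply/seteqP; split=> x.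
  move=> /Cantor_set_self; rewrite E2 E1 => -[]; [by left|by right].
by move=> h; apply/Cantor_set_self; rewrite E2 E1; case: h; [left|right].
Qed.

Lemma cellS_disjoint n (l : R) (j : nat) : (0 < j)%N ->
  cell n l `&` cell n (l + j%:R * (2 / 3 ^+ n)) = set0.
Proof.
move=> j0; apply/seteqP; split=> // x [/Cantor_set_itv/andP[_ h1] /Cantor_set_itv/andP[h2 _]].
have p0 : 3 ^+ n != 0 :> R by rewrite expf_neq0.
have j1 : 1 <= j%:R :> R by rewrite ler1n.
have : 3 ^+ n * (x - (l + j%:R * (2 / 3 ^+ n))) = 3 ^+ n * (x - l) - 2 * j%:R by field.
by move: h1 h2; set u := 3 ^+ n * _; set v := 3 ^+ n * _; lra.
Qed.

Lemma triadicD k p (l : int) q : triadic R k p + triadic R l q =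
  triadic R (k * 3 ^+ q + l * 3 ^+ p) (p + q).
Proof.
rewrite /triadic intrD !intrM !rmorphXn/= exprD.
have p0 : 3 ^+ p != 0 :> R by rewrite expf_neq0.
have q0 : 3 ^+ q != 0 :> R by rewrite expf_neq0.
by field; rewrite p0 q0.
Qed.

Definition overlap (l : R) : \bar R := H (C `&` [set x | C (x + l)]).

Let mC (c : R) : measurable [set x | C (x + c)].
Proof.
have := measurable_preimage_affine 1 c (@measurable_Cantor_set R).
by congr measurable; apply/seteqP; split=> x /=; rewrite mul1r.
Qed.

Lemma overlap_int k : overlap k%:~R = (k == 0)%:R%:E.
Proof.
rewrite /overlap; have [->|k0] := eqVneq k 0.
  rewrite -(@hausdorff_fractal_Cantor R); congr (H _).
  by apply/seteqP; split=> [x []//|x Cx]; split => //=; rewrite addr0.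
(* Two integer translates of [0, 1] share at most an end point: 0 for positive [k], 1 for negative
   [k]. *)
apply: (@hausdorff_fractal_sub_point _ (if 0 < k then 0 else 1)).
move=> x [/Cantor_set_itv/andP[x0 x1] /Cantor_set_itv/andP[y0 y1]] /=.
have [kp|kn] := ltP 0 k.
  have : 1 <= k%:~R :> R by rewrite -[1]/(1%:~R) ler_int -gtz0_ge1.
  by lra.
have : 1 <= (- k)%:~R :> R.
  by rewrite -[1]/(1%:~R) ler_int -gtz0_ge1 oppr_gt0 lt_neqAle k0.
by rewrite intrN; lra.
Qed.

(** After enlarging by 3, both copies split into C and C + 2. Of the four intersections [B1] and
    [B4] have measure [overlap l], [B2] and [B3] are the cases l - 2 and l + 2, and undoing the
    scaling halves the total. *)
Lemma overlap_rec k q : overlap (triadic R k q.+1) =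
  (overlap (triadic R k q) + (2^-1)%:E * (overlap (triadic R (k + 2 * 3 ^+ q) q) +
     overlap (triadic R (k - 2 * 3 ^+ q) q)))%E.
Proof.
set l := triadic R k q.
have q0 : 3 ^+ q != 0 :> R by rewrite expf_neq0.
have lE : triadic R k q.+1 = l / 3.
  by rewrite /l /triadic exprSr invfM mulrA.
have -> : triadic R (k + 2 * 3 ^+ q) q = l + 2.
  by rewrite /l /triadic intrD intrM rmorphXn/=; field.
have -> : triadic R (k - 2 * 3 ^+ q) q = l - 2.
  by rewrite /l /triadic intrB intrM rmorphXn/=; field.
pose B1 := C `&` [set x | C (x + l)].
pose B2 := C `&` [set x | C (x + (l - 2))].
pose B3 := [set x | C (x - 2)] `&` [set x | C (x + l)].
pose B4 := [set x | C (x - 2)] `&` [set x | C (x + (l - 2))].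
have mB1 : measurable B1 by apply: measurableI => //; exact: measurable_Cantor_set.
have mB2 : measurable B2 by apply: measurableI => //; exact: measurable_Cantor_set.
have mB3 : measurable B3 by apply: measurableI.
have mB4 : measurable B4 by apply: measurableI.
have t2 (A : set R) : H [set x | A (x - 2)] = H A.
  rewrite -(hausdorff_fractal_translate (- 2) 0 A) /triadic expr0 divr1.
  by congr (H _); apply/seteqP; split=> x.
have h3 : H B3 = overlap (l + 2).
  rewrite /overlap -[RHS]t2; congr (H _); apply/seteqP; split=> x [? /= h]; split => //=;
    by move: h; congr C; ring.
have h4 : H B4 = overlap l.
  rewrite /overlap -[RHS]t2; congr (H _); apply/seteqP; split=> x [? /= h]; split => //=;
    by move: h; congr C; ring.
have -> : overlap (triadic R k q.+1) = ((2^-1)%:E * H (B1 `|` B2 `|` (B3 `|` B4)))%E.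
  rewrite -hausdorff_fractal_scale lE; congr (H _).
  have E1 x : 3 * (x + l / 3) = 3 * x + l by field.
  have E2 x : 3 * x + l - 2 = 3 * x + (l - 2) by ring.
  apply/seteqP; split=> x; rewrite /B1 /B2 /B3 /B4 /=.
    move=> [/Cantor_set_self h1 /Cantor_set_self]; rewrite E1 E2 => h2.
    by case: h1; case: h2; tauto.
  by move=> h; split; apply/Cantor_set_self; rewrite ?E1 ?E2; tauto.
have dis A A' B B' : (A `<=` C) -> (A' `<=` [set x : R | C (x - 2)]) ->
    (A `&` B) `&` (A' `&` B') = set0.
  move=> AC AC'; apply/seteqP; split=> // x [[/AC/Cantor_set_itv/andP[? ?] _]].
  by move=> [/AC'/Cantor_set_itv/andP[? ?] _]; lra.
have dis2 A B (c : R) : (A `&` [set x : R | C (x + c)]) `&` (B `&` [set x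
  : R | C (x + (c - 2))]) = set0.
  apply/seteqP; split=> // x [[_ /Cantor_set_itv/andP[? ?]] [_ /Cantor_set_itv/andP[? ?]]].
  lra.
rewrite measureU//; last 3 first.
- exact: measurableU.
- exact: measurableU.
- by rewrite setIUl !setIUr !dis// !setU0.
rewrite (measureU _ mB1 mB2) ?dis2// (measureU _ mB3 mB4) ?dis2//.
rewrite -[X in ((2^-1)%:E * X)%E]/(H B1 + H B2 + (H B3 + H B4))%E h3 h4.
rewrite -[H B1]/(overlap l) -[H B2]/(overlap (l - 2)).
have fin c : (0 <= overlap c)%E by exact: hausdorff_fractal_ge0.
have -> : (overlap l + overlap (l - 2) + (overlap (l + 2) + overlap l) =
    2%:E * overlap l + (overlap (l + 2) + overlap (l - 2)))%E.
  by rewrite -[2]/(1 + 1 : R) EFinD ge0_muleDl//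
    mul1e addeACA (addeC (overlap (l - 2))) addeACA addeA.
rewrite ge0_muleDr ?adde_ge0 ?mule_ge0//.
by rewrite muleA -EFinM mulVf// mul1e.
Qed.
End fractal_integral.

Lemma exists_expr_lt (R : realType) (e : R) : 0 < e -> exists n : nat, (3^-1 : R) ^+ n < e.
Proof.
move=> e0; have h : (3^-1 : R) ^+ n @[n --> \oo] --> 0.
  have := @cvg_geometric R 1 3^-1; rewrite ger0_norm// invf_lt1// => /(_ _).
  rewrite (_ : geometric _ _ = [eta GRing.exp 3^-1]); last first.
    by apply/funext => n /=; rewrite mul1r.
  by apply; lra.
have [n _ /(_ n (leqnn n)) hn] := cvgr_lt 0 h _ e0.
by exists n.
Qed.

(* With [S n] the partial sums of [\sum (-1) ^ k (E k + E (k + 1))], the Cesaro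
   means of [S] differ from [E 0] by a mean of orthogonal vectors. *)
Lemma closed_subspace_alternating (R : realType) (H : lmodType R[i])
    (dot : H -> H -> R[i]) (hH : hilbert dot) (V : set H) (E : nat -> H) (B : R) :
  closed_subspace dot V -> (forall i j, i != j -> dot (E i) (E j) = 0) ->
  (forall i, hnorm dot (E i) <= B) -> (forall i, V (E i + E i.+1)) -> V (E 0%N).
Proof.
move=> VV orth EB VE; have [V0 VD Vc] := VV; apply: Vc => e e0.
have B0 : 0 <= B := le_trans (hnorm_ge0 _ _) (EB 0%N).
pose S n := \sum_(k < n) (-1) ^+ k *: (E k + E k.+1).
have SE n : S n = E 0%N - (-1) ^+ n *: E n.
  elim: n => [|n ih]; first by rewrite /S big_ord0 expr0 scale1r subrr.
  rewrite /S big_ord_recr/= -/(S n) ih scalerDr addrA subrK exprS mulN1r scaleNr.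
  by rewrite opprK.
have VS n : V (S n).
  elim: n => [|n ih]; first by rewrite /S big_ord0.
  by rewrite /S big_ord_recr/= addrC; exact: VD.
have Vsum n : V (\sum_(k < n) S k).
  elim: n => [|n ih]; first by rewrite big_ord0.
  by rewrite big_ord_recr/= addrC -[S n]scale1r; exact: VD.
pose A n := \sum_(k < n) (-1) ^+ k *: E k.
(* Pythagoras: the norm of the sum grows like sqrt n only, so its mean tends to 0. *)
have normA n : hnorm dot (A n) ^+ 2 <= n%:R * B ^+ 2.
  elim: n => [|n ih]; first by rewrite /A big_ord0 (hnorm0 hH) expr0n mul0r.
  rewrite /A big_ord_recr/= -/(A n) (sqr_hnormD hH).
  have -> : dot (A n) ((-1) ^+ n *: E n) = 0.
    rewrite (dotZr hH) (dot_suml hH) big1 ?mulr0// => k _.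
    by rewrite (dotZl hH) orth ?mulr0// ltn_eqF.
  rewrite mulr0 addr0 (hnormZ hH) -natr1 mulrDl mul1r lerD//.
  have -> : normc ((-1 : R[i]) ^+ n) = 1.
    by elim: n {ih} => [|n ih]; rewrite ?expr0 ?normc1// exprS normcM ih normcN normc1 mulr1.
  by rewrite mul1r ler_sqr ?nnegrE ?hnorm_ge0.
(* The mean has squared norm at most B^2 / M, which this [M] makes smaller than e^2. *)
have [M M0 hM] : exists2 M : nat, (0 < M)%N & B ^+ 2 < M%:R * e ^+ 2.
  exists (Num.truncn (B ^+ 2 / e ^+ 2)).+1 => //.
  by rewrite -ltr_pdivrMr ?exprn_gt0// truncnS_gt.
have Mn : (M%:R : R[i]) != 0 by rewrite pnatr_eq0 -lt0n.
exists (M%:R^-1 *: \sum_(k < M) S k); first by rewrite -[_ *: _]addr0; exact: VD.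
have -> : E 0%N - M%:R^-1 *: \sum_(k < M) S k = M%:R^-1 *: A M.
  under eq_bigr do rewrite SE.
  rewrite sumrB sumr_const card_ord scalerBr -[E 0%N *+ M]scaler_nat scalerA mulVf//.
  by rewrite scale1r opprB addrC subrK.
rewrite (hnormZ hH).
have MR : 0 < M%:R :> R by rewrite ltr0n.
have -> : normc (M%:R^-1 : R[i]) = M%:R^-1.
  by rewrite normcV -(rmorph_nat (real_complex R) M) normc_real ger0_norm.
rewrite ltr_pdivrMl// -(@ltr_pXn2r _ 2) ?nnegrE ?hnorm_ge0 ?mulr_ge0 ?ltW//.
by rewrite (le_lt_trans (normA M))// exprMn expr2 -mulrA ltr_pM2l.
Qed.

(** * Density of the translates of $\chi_C$ *)

Section fractal_density.
Context (R : realType).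
Local Notation C := (@Cantor_set R).
Local Notation H := (@hausdorff_fractal R).
Local Notation dot := (@L2dot _ _ _ H).

Definition cell_class (i : int * nat) : L2 H :=
  L2class H (cindic R (cell 0 (triadic R i.1 i.2))).

Local Notation V := (closed_span dot cell_class).

Let VV : closed_subspace dot V := closed_span_subspace (hilbert_L2 H) cell_class.

Lemma cell_in_span n (k : int) p : V (L2class H (cindic R (cell n (triadic R k p)))).
Proof.
elim: n k p => [|n ih] k p.
  exact: (closed_span_gen (hilbert_L2 H) cell_class (k, p)).
(* Left end points spaced by twice the cell length: the cells of level [n.+1] are disjoint, and any
   two consecutive ones form a cell of level [n]. *)
pose mu (j : nat) : R := triadic R k p + j%:R * (2 / 3 ^+ n.+1).
have muE j : mu j = triadic R (k * 3 ^+ n.+1 + (2 * j%:Z) * 3 ^+ p) (p + n.+1).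
  rewrite -triadicD; congr (_ + _); rewrite /triadic intrM (_ : j%:~R = j%:R)//.
  by rewrite [RHS]mulrAC mulrC.
pose E j := L2class H (cindic R (cell n.+1 (mu j))).
have mE j : measurable (cell n.+1 (mu j)) by exact: measurable_cell.
have fE j : (H (cell n.+1 (mu j)) < +oo)%E by rewrite muE cell_fin.
have -> : triadic R k p = mu 0%N by rewrite /mu mul0r addr0.
apply: (@closed_subspace_alternating _ _ _ (hilbert_L2 H) V E 1 VV).
- have lt i j : (i < j)%N -> dot (E i) (E j) = 0.
    move=> ij; rewrite L2dot_indic; [|exact: mE|exact: mE|exact: fE|exact: fE].
    have -> : mu j = mu i + (j - i)%:R * (2 / 3 ^+ n.+1).
      by rewrite /mu -addrA -mulrDl -natrD subnKC// ltnW.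
    by rewrite cellS_disjoint ?subn_gt0// measure0.
  move=> i j; rewrite neq_ltn => /orP[/lt//|/lt h].
  by rewrite (dotC (hilbert_L2 H)) h rmorph0.
- move=> j; rewrite hnorm_indic; [|exact: mE|exact: fE].
  have hm : H (cell n.+1 (mu j)) = (2^-1 ^+ n.+1)%:E by rewrite muE cell_measure.
  rewrite -[X in fine X]/(H (cell n.+1 (mu j))) hm -[leRHS]sqrtr1; apply: ler_wsqrtr.
  by rewrite /= exprn_ile1 ?invr_ge0// invf_le1//; lra.
- move=> j; rewrite -L2classD; [|exact: (square_integrable_indic (mE _) (fE _))..].
  have -> : mu j.+1 = mu j + 1%:R * (2 / 3 ^+ n.+1).
    by rewrite /mu -addrA -mulrDl -natrD addn1.
  rewrite -cindicU ?cellS_disjoint// mul1r -cellS muE; exact: ih.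
Qed.

Definition half (a : R) : set R := [set x | a <= x].

Lemma measurable_half a : measurable (half a).
Proof.
rewrite (_ : half a = `[a, +oo[%classic); first exact: measurable_itv.
by apply/seteqP; split=> x; rewrite /half /= in_itv/= andbT.
Qed.

(** After [n] subdivisions [a] lies at an integer multiple of the cell length from each left end
    point. The half-line then contains the whole cell or meets it at most in its right end point, a
    null set. *)
Lemma half_cell_in_span n n0 a (k : int) p (j : int) :
  3 ^+ (n + n0) * (a - triadic R k p) = j%:~R ->
  V (L2class H (cindic R (half a `&` cell n0 (triadic R k p)))).
Proof.
have mh n1 (l : R) : measurable (half a `&` cell n1 l).
  by apply: measurableI; [exact: measurable_half|exact: measurable_cell].
have fh n1 k' p' : (H (half a `&` cell n1 (triadic R k' p')) < +oo)%E.
  apply: le_lt_trans (cell_fin R n1 k' p'); apply: le_measure; rewrite ?inE//.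
  exact: measurable_cell.
elim: n n0 k p j => [|n ih] n0 k p j jE.
  rewrite add0n in jE.
  have n0p : 0 < 3 ^+ n0 :> R by rewrite exprn_gt0.
  have [j0|j0] := leP j 0.
    rewrite (_ : half a `&` _ = cell n0 (triadic R k p)); first exact: cell_in_span.
    apply/seteqP; split=> [x []//|x Cx]; split => //.
    have /andP[x0 _] := Cantor_set_itv Cx.
    have ja : a <= triadic R k p.
      by rewrite -subr_le0 -(pmulr_rle0 _ n0p) jE -[0]/(0%:~R) ler_int.
    apply: le_trans ja _; rewrite -subr_ge0 -(pmulr_rge0 _ n0p)//.
  set D := half a `&` _.
  have D0 : H D = 0%E.
    apply: (@hausdorff_fractal_sub_point _ (triadic R k p + (3 ^+ n0)^-1)) => x.
    move=> [ax /Cantor_set_itv/andP[_ x1]] /=.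
    have j1 : 1 <= j%:~R :> R by rewrite -[1]/(1%:~R) ler_int -gtz0_ge1.
    have h : 3 ^+ n0 * (x - triadic R k p) = 1.
      apply/eqP; rewrite eq_le x1 (le_trans j1)// -jE ler_pM2l// lerD2r.
      exact: ax.
    have : x - triadic R k p = (3 ^+ n0)^-1.
      by apply: (mulfI (lt0r_neq0 n0p)); rewrite h divff ?gt_eqF.
    by move=> <-; rewrite addrC subrK.
  have [V0 _ _] := VV.
  suff -> : L2class H (cindic R D) = 0 by [].
  have fD : (H D < +oo)%E by rewrite D0 ltry.
  apply: (hnorm0_eq0 (hilbert_L2 H)); rewrite hnorm_indic; [|exact: mh|exact: fD].
  by rewrite -[X in fine X]/(H D) D0 sqrtr0.
have lE : triadic R k p + 2 / 3 ^+ n0.+1 =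
    triadic R (k * 3 ^+ n0.+1 + 2 * 3 ^+ p) (p + n0.+1).
  by rewrite -triadicD.
rewrite cellS lE setIUr cindicU; last first.
  apply/seteqP; split=> // x [[_ h1] [_ h2]].
  have := @cellS_disjoint R n0.+1 (triadic R k p) 1 isT.
  rewrite mul1r lE => h; have : (cell n0.+1 (triadic R k p) `&`
    cell n0.+1 (triadic R (k * 3 ^+ n0.+1 + 2 * 3 ^+ p) (p + n0.+1))) x by [].
  by rewrite h.
rewrite L2classD; [|exact: square_integrable_indic (mh _ _) (fh _ _ _)..].
have [_ VD _] := VV; rewrite -[X in X + _]scale1r; apply: VD.
  by apply: (ih n0.+1 k p j); rewrite addnS.
apply: (ih _ _ _ (j - 2 * 3 ^+ n)); rewrite -lE opprD addrA mulrDr addnS -addSn jE.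
rewrite intrB intrM rmorphXn/= mulrN addSnnS exprD.
by have : 3 ^+ n0.+1 != 0 :> R by [rewrite expf_neq0]; move=> ?; field.
Qed.

Lemma mult_half (k : int) p : mult_set V (half (triadic R k p)).
Proof.
set a := triadic R k p.
split; first exact: measurable_half.
split; first by apply: cbounded_indic; exact: measurable_half.
have bh : cbounded (cindic R (half a)) by apply: cbounded_indic; exact: measurable_half.
move=> u Vu; refine (@bounded_linear_span R _ _ _ _ _ cell_class
  (mulL2 (cindic R (half a))) 1 V (mulL2_linear bh) _ VV _ u Vu) => [v|[l q]].
  apply: mulL2_bound; first exact: bh.1.
  by move=> x; rewrite normc_real indicE; case: (_ \in _); rewrite /= ?normr1 ?normr0.
rewrite /cell_class /= mulL2_class//; last first.
  by apply: square_integrable_indic; [exact: measurable_cell|exact: cell_fin].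
rewrite (_ : (fun x => _) = cindic R (half a `&` cell 0 (triadic R l q))); last first.
  by apply/funext => x; rewrite /cindic indicI rmorphM.
(* 3^(p + q) is a common denominator of [a] and the left end point. *)
apply: (@half_cell_in_span (p + q)%N 0%N a l q (k * 3 ^+ q - l * 3 ^+ p)).
rewrite addn0 intrB !intrM !rmorphXn/= /a /triadic exprD.
have p0 : 3 ^+ p != 0 :> R by rewrite expf_neq0.
have q0 : 3 ^+ q != 0 :> R by rewrite expf_neq0.
by field; rewrite p0 q0.
Qed.

Lemma mult_measurable (E : set R) : measurable E -> mult_set V E.
Proof.
move=> mE; have : (@ocitv R).-sigma.-measurable E by exact: mE.
rewrite RGenOInfty.measurableE; move: E {mE}.
apply: smallest_sub; first exact: mult_set_sigma_algebra VV.
move=> _ [b ->].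
(* The least multiple of 3^-n greater than [b]. *)
pose a n := triadic R (Num.floor (3 ^+ n * b) + 1) n.
have -> : `]b, +oo[%classic = \bigcup_n half (a n).
  have p0 n : 0 < 3 ^+ n :> R by rewrite exprn_gt0.
  apply/seteqP; split=> x /=.
    rewrite in_itv/= andbT => bx; have xb : 0 < x - b by rewrite subr_gt0.
    have [n hn] := exists_expr_lt xb; exists n => //.
    rewrite /half /= /a /triadic ler_pdivrMr//.
    have h : 1 < (x - b) * 3 ^+ n by rewrite -ltr_pdivrMr// mul1r -exprVn.
    have := floor_le (3 ^+ n * b); rewrite intrD; move: h.
    by rewrite mulrBl (mulrC b) => h h'; rewrite ltW//; lra.
  move=> [n _]; rewrite /half /= in_itv/= andbT; apply: lt_le_trans.
  by rewrite /a /triadic ltr_pdivlMr// mulrC floorD1_gt.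
by apply: (mult_set_bigcup VV) => n; exact: mult_half.
Qed.

Lemma cell_dense (u : L2 H) : V u.
Proof.
apply: (mult_set_dense VV mult_measurable (@measurable_copy_seq R)) => [n|n|].
- rewrite /copy_seq; case: unpickle => [[k p]|].
    rewrite (_ : @cantor_copy R (k, p) = cell p (triadic R k p)).
      by apply: square_integrable_indic; [exact: measurable_cell|exact: cell_fin].
    apply/seteqP; split=> x;
      rewrite /cantor_copy /cell /= mulrBr /triadic mulrCA divff ?mulr1// expf_neq0//.
  by apply: square_integrable_indic; rewrite ?measure0 ?ltry.
- rewrite /copy_seq; case: unpickle => [[k p]|].
    rewrite (_ : @cantor_copy R (k, p) = cell p (triadic R k p)); first exact: cell_in_span.
    by apply/seteqP; split=> x;
      rewrite /cantor_copy /cell /= mulrBr /triadic mulrCA divff ?mulr1// expf_neq0.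
  rewrite (_ : (fun _ => _) = 0).
    by rewrite L2class0; have [] := VV.
  by apply/funext => x; rewrite indic0.
- exact: ae_fractal.
Qed.

End fractal_density.

(** * The Fourier coefficients of $m$ *)

Section even_expansions.
Context (R : realType).
Implicit Types (l : R) (p : nat) (d : nat -> int).

Lemma even_digit_norm (c : int) : c \in [:: -2; 0; 2] -> `|c%:~R| <= 2 :> R.
Proof.
by rewrite !inE => /or3P[] /eqP ->; rewrite ?mulrNz ?normrN ?normr0// ger0_norm.
Qed.

(** The first n digits contribute at most 1 - 3^-n. The strict bound determines the first digit,
    since different candidates put the rest at distance at least 2. *)
Lemma even_expansion_lt1 l p d : even_expansion l p d -> `|l| < 1.
Proof.
move=> [hd ->].
suff h n : (n <= p.+1)%N ->
    `|\sum_(j < n) ((d j)%:~R / 3 ^+ j.+1 : R)| <= 1 - (3 ^+ n)^-1.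
  by apply: le_lt_trans (h _ (leqnn _)) _; rewrite gtrBl invr_gt0 exprn_gt0.
elim: n => [|n ih] np; first by rewrite big_ord0 normr0 expr0 invr1 subrr.
rewrite big_ord_recr/= (le_trans (ler_normD _ _))//.
have p0 : 0 < 3 ^+ n :> R by rewrite exprn_gt0.
have := ih (ltnW np); have := even_digit_norm (hd n np).
rewrite normrM normfV (@ger0_norm _ (3 ^+ n.+1)) ?exprn_ge0//.
have -> : (3 ^+ n)^-1 = 3 * (3 ^+ n.+1)^-1 :> R.
  by rewrite exprS invfM mulrA divff// mul1r.
have q0 : 0 < (3 ^+ n.+1)^-1 :> R by rewrite invr_gt0 exprn_gt0.
move: `|\sum_(j < n) _| `|(d n)%:~R| (3 ^+ n.+1)^-1 q0 => s c e e0 c2 hs.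
by have := ler_wpM2r (ltW e0) c2; lra.
Qed.

Lemma even_expansion_behead l p d : even_expansion l p.+1 d ->
  d 0%N \in [:: -2; 0; 2] /\ even_expansion (3 * l - (d 0%N)%:~R) p (fun j => d j.+1).
Proof.
move=> [hd ->]; split; first exact: hd.
split; first by move=> j jp; exact: hd.
rewrite big_ord_recl/= expr1 mulrDr mulrCA divff// mulr1 addrC addrA addNr add0r.
rewrite mulr_sumr; apply: eq_bigr => j _; rewrite [in LHS]exprS.
by have : 3 ^+ j.+1 != 0 :> R by [rewrite expf_neq0]; move=> ?; field.
Qed.

Lemma even_expansion_cons (c : int) l p d : c \in [:: -2; 0; 2] ->
  even_expansion l p d ->
  even_expansion ((c%:~R + l) / 3) p.+1 (fun j => if j is j'.+1 then d j' else c).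
Proof.
move=> hc [hd ->]; split; first by move=> [|j] //; rewrite ltnS; exact: hd.
rewrite [RHS]big_ord_recl/= expr1 mulrDl; congr (_ + _); rewrite mulr_suml.
apply: eq_bigr => j _; rewrite [in RHS]exprS.
by have : 3 ^+ j.+1 != 0 :> R by [rewrite expf_neq0]; move=> ?; field.
Qed.

(** Lets one assume at least two digits, as [even_expansion_behead] requires. *)
Lemma even_expansion_pad l p d : even_expansion l p d ->
  even_expansion l p.+1 (fun j => if (j <= p)%N then d j else 0).
Proof.
move=> [hd ->]; split=> [j _|]; first by case: ifP => [/hd//|_]; rewrite !inE.
rewrite [in RHS]big_ord_recr/= ltnn mul0r addr0.
by apply: eq_bigr => j _; rewrite -ltnS ltn_ord.
Qed.

Lemma triadic_shift (k : int) q (c : int) :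
  triadic R (k + c * 3 ^+ q) q = triadic R k q + c%:~R.
Proof.
rewrite /triadic intrD intrM rmorphXn/=.
by have : 3 ^+ q != 0 :> R by [rewrite expf_neq0]; move=> ?; field.
Qed.

Lemma triadicS (k : int) q : triadic R k q = 3 * triadic R k q.+1.
Proof.
rewrite /triadic exprS.
by have : 3 ^+ q != 0 :> R by [rewrite expf_neq0]; move=> ?; field.
Qed.
End even_expansions.

Section coefficients.
Context (R : realType) (m : {measure set (borel_solenoid R) -> \bar R}).
Hypothesis m_coef : forall (k : int) (q p : nat) (d : nat -> int),
  even_expansion (triadic R k q) p d ->
  fourier m k q = (2 `^ (- (\sum_(j < p.+1) `|d j|%N)%:R / 2))%:C.
Hypothesis m_coef0 : forall (k : int) (q : nat),
  ~ (exists p d, even_expansion (triadic R k q) p d) -> fourier m k q = 0.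

Lemma fourier_ge1 k q : 1 <= `|triadic R k q| -> fourier m k q = 0.
Proof.
move=> h; apply: m_coef0 => -[p [d /even_expansion_lt1]].
by rewrite ltNge h.
Qed.

Lemma fourier_int k : fourier m k 0 = (k == 0)%:R.
Proof.
have [->|k0] := eqVneq k 0.
  rewrite (m_coef (p := 0%N) (d := fun=> 0)); last first.
    by split => [//|]; rewrite /triadic big_ord1 !mul0r.
  by rewrite big_ord1 absz0 oppr0 mul0r powRr0.
apply: fourier_ge1; rewrite /triadic expr0 divr1 -intr_norm -[1]/(1%:~R) ler_int.
by rewrite -gtz0_ge1 normr_gt0.
Qed.

(** At most one term on the right is nonzero, the one whose argument continues the expansion. A
    first digit 0 leaves the coefficient unchanged; 2 or -2 multiplies it by 2^(-2/2), the factor in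
    front. *)
Lemma fourier_rec k q : fourier m k q.+1 = fourier m k q +
  2^-1 * (fourier m (k + 2 * 3 ^+ q) q + fourier m (k - 2 * 3 ^+ q) q).
Proof.
pose G c := fourier m (k + c * 3 ^+ q) q.
have -> : fourier m k q = G 0 by rewrite /G mul0r addr0.
rewrite -mulNr -!/(G _).
have [[p [e he]]|no] :=
    pselect (exists p e, even_expansion (triadic R k q.+1) p.+1 e).
  have [hc hb] := even_expansion_behead he.
  rewrite (m_coef he).
  rewrite big_ord_recl; set S := (\sum_(i < p.+1) _)%N.
  rewrite -triadicS in hb.
  (* One of the three arguments lies in ]-1, 1[, so the other two, at distance at least 2 from it,
     do not. *)
  have G0 c : c \in [:: -2; 0; 2] -> c != - e 0%N -> G c = 0.
    move=> hc' ne; apply: fourier_ge1; rewrite triadic_shift leNgt; apply/negP => h.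
    have := even_expansion_lt1 hb; move: h; rewrite !ltr_norml => /andP[a b] /andP[a' b'].
    move: (e 0%N) hc hc' a b a' b' ne => c0; rewrite !inE.
    move=> /or3P[] /eqP -> /or3P[] /eqP -> // h1 h2 h3 h4 _; exfalso;
      by move: h1 h2 h3 h4; rewrite ?mulrNz ?mulr0z; lra.
  have GE : G (- e 0%N) = (2 `^ (- S%:R / 2))%:C.
    by apply: (m_coef (p := p) (d := fun j => e j.+1)); rewrite triadic_shift intrN.
  have two : 2 `^ (-1) = 2^-1 :> R by rewrite powR_inv1.
  have h2 : 2 `^ (- (2 + S)%:R / 2) = 2^-1 * 2 `^ (- S%:R / 2) :> R.
    rewrite -[X in _ = X * _]two -powRD; last by rewrite pnatr_eq0 implybT.
    by congr (2 `^ _); rewrite natrD; field.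
  have h2C : (2^-1)%:C = 2^-1 :> R[i] by rewrite fmorphV rmorph_nat.
  move: hc; rewrite !inE => /or3P[] /eqP ec; rewrite ec in G0 GE *.
  - by rewrite (G0 0)// (G0 (-2))// GE h2 rmorphM/= h2C add0r addr0.
  - by rewrite (G0 2)// (G0 (-2))// -[G 0]/(G (- 0)) GE addr0 mulr0 addr0.
  - by rewrite (G0 0)// (G0 2)// GE h2 rmorphM/= h2C !add0r.
(* An expansion of any argument on the right, preceded by the opposite of its shift, would be one
   for the left side. *)
have none c : c \in [:: -2; 0; 2] -> G c = 0.
  move=> hc; apply: m_coef0 => -[p [d]]; rewrite triadic_shift => hd; apply: no.
  have hc' : - c \in [:: -2; 0; 2] by move: hc; rewrite !inE => /or3P[] /eqP ->.
  exists p, (fun j => if j is j'.+1 then d j' else - c).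
  have := even_expansion_cons hc' hd.
  by rewrite intrN addrC addrK triadicS [_ / 3]mulrC mulKf.
rewrite !none// addr0 mulr0 addr0; apply: m_coef0 => -[p [d hd]]; apply: no.
by exists p; eexists; exact: even_expansion_pad hd.
Qed.
End coefficients.

(** * The operators on generators, and equality of the Gram matrices *)

Section fractal_operators.
Context (R : realType).
Local Notation C := (@Cantor_set R).
Local Notation H := (@hausdorff_fractal R).
Local Notation N := (hnorm (@L2dot _ _ _ H)).
Implicit Types (k : int) (p : nat).

Lemma square_integrable_cell n k p :
  square_integrable H (cindic R (cell n (triadic R k p))).
Proof. by apply: square_integrable_indic; [exact: measurable_cell|exact: cell_fin]. Qed.

Lemma translation_operator k p :
  [/\ forall f, square_integrable H f ->
        translation (triadic R k p) (L2class H f) =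
        L2class H (fun x => f (x - triadic R k p)),
      linear (translation (triadic R k p)) &
      forall u, N (translation (triadic R k p) u) <= 1 * N u].
Proof.
have mphi : measurable_fun setT (fun x : R => x - triadic R k p).
  exact: measurable_funB.
have [//|f sf|_ h1 h2 h3] := @L2_operator _ _ _ _ R H H
  (fun f x => f (x - triadic R k p)) 1 ler01.
  split; first by split;
    [exact: (measurableT_comp sf.1.1 mphi)|exact: (measurableT_comp sf.1.2 mphi)].
  rewrite expr1n mul1e; have := @integral_translate R (- k) p (EFin \o sqr_norm f).
  rewrite /triadic intrN mulNr => <- //.
    by apply/measurable_EFinP; exact: (measurable_sqr_norm sf.1).
  by move=> x; rewrite /= lee_fin sqr_norm_ge0.
by split.
Qed.

Lemma dilation_operator :
  [/\ forall f, square_integrable H f ->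
        dilation (L2class H f) =
        L2class H (fun x => ((Num.sqrt 2)^-1)%:C * f (x / 3)),
      linear (@dilation R) & forall u : L2 H, N (dilation u) <= 1 * N u].
Proof.
have mphi : measurable_fun setT (fun x : R => x / 3) by exact: measurable_funM.
have [|f sf|_ h1 h2 h3] := @L2_operator _ _ _ _ R H H
  (fun f x => ((Num.sqrt 2)^-1)%:C * f (x / 3)) 1 ler01.
- by move=> a f g; apply/funext => x; rewrite /= mulrDr mulrCA.
- have mf : cmeasurable (fun x : R => f (x / 3)).
    by split; [exact: (measurableT_comp sf.1.1 mphi)|exact: (measurableT_comp sf.1.2 mphi)].
  split; first exact: (cmeasurableM (cmeasurable_cst _ _) mf).
  have mg := measurable_sqr_norm sf.1.
  rewrite expr1n mul1e.
  rewrite (eq_integral (fun x : R => (2^-1)%:E * (sqr_norm f (x / 3))%:E)%E); last first.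
    move=> x _; rewrite /sqr_norm normcM exprMn normc_real ger0_norm ?invr_ge0//.
    by rewrite exprVn sqr_sqrtr.
  rewrite ge0_integralZl_EFin//.
  + rewrite (integral_dilate (g := EFin \o sqr_norm f)).
    - by rewrite muleA -EFinM mulVf// mul1e.
    - exact/measurable_EFinP.
    - by move=> x; rewrite lee_fin sqr_norm_ge0.
  + by move=> x _; rewrite lee_fin sqr_norm_ge0.
  + by apply/measurable_EFinP; exact: (measurableT_comp mg mphi).
by split.
Qed.

Lemma translation_cell k p l q : translation (triadic R k p) (cell_class R (l, q)) =
  cell_class R (l * 3 ^+ p + k * 3 ^+ q, (q + p)%N).
Proof.
have [opE _ _] := translation_operator k p.
rewrite /cell_class opE; last exact: square_integrable_cell.
congr L2class; apply/funext => x; rewrite /= -triadicD /cindic !indicE.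
congr ((_ : bool)%:R%:C); apply/idP/idP; rewrite !inE /cell /= !expr0 !mul1r;
  by congr C; ring.
Qed.

Lemma dilation_cell k p : dilation (cell_class R (k, p)) =
  ((Num.sqrt 2)^-1)%:C *: (cell_class R (3 * k, p) +
                          cell_class R (3 * k + 2 * 3 ^+ p, p)).
Proof.
have [opE _ _] := dilation_operator.
rewrite /cell_class opE; last exact: square_integrable_cell.
rewrite -L2classD; [|exact: square_integrable_cell..].
rewrite -L2classZ; last by apply: square_integrableD; exact: square_integrable_cell.
have -> : triadic R (3 * k + 2 * 3 ^+ p) p = triadic R (3 * k) p + 1%:R * (2 / 3 ^+ 0).
  by rewrite triadic_shift mul1r expr0 divr1.
rewrite /= -cindicU; last exact: cellS_disjoint.
congr L2class; apply/funext => x; rewrite -[RHS]/(_ * _) /cindic !indicE.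
congr (_ * (_ : bool)%:R%:C).
have e1 : 3 * (x / 3 - triadic R k p) = x - triadic R (3 * k) p.
  by rewrite /triadic intrM; have : 3 ^+ p != 0 :> R by [rewrite expf_neq0]; move=> ?; field.
have e2 : x - (triadic R (3 * k) p + 1%:R * (2 / 3 ^+ 0)) = x - triadic R (3 * k) p - 2.
  by rewrite mul1r expr0 divr1; ring.
apply/idP/idP; rewrite !inE /cell /= e2 expr0 !mul1r.
  by move=> /Cantor_set_self; rewrite e1.
by move=> h; apply/Cantor_set_self; rewrite e1.
Qed.

End fractal_operators.

Section solenoid_operators.
Context (R : realType) (m : {measure set (borel_solenoid R) -> \bar R}).
Hypothesis m_fin : (m setT < +oo)%E.
Hypothesis m_coef : forall (k : int) (q p : nat) (d : nat -> int),
  even_expansion (triadic R k q) p d ->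
  fourier m k q = (2 `^ (- (\sum_(j < p.+1) `|d j|%N)%:R / 2))%:C.
Hypothesis m_coef0 : forall (k : int) (q : nat),
  ~ (exists p d, even_expansion (triadic R k q) p d) -> fourier m k q = 0.
Local Notation H := (@hausdorff_fractal R).
Local Notation N := (hnorm (@L2dot _ _ _ m)).
Implicit Types (k : int) (p : nat).

Let square_integrable_chi k p : square_integrable m (chi k p).
Proof. by apply: cbounded_square_integrable => //; exact: cbounded_chi. Qed.

(** The bound is an equality: it is [integral_shift] for |f|^2. *)
Lemma mul_m0_shift_operator :
  [/\ forall f, square_integrable m f ->
        mul_m0_shift (L2class m f) =
        L2class m (fun z => m0 (coord z 0) * f (solenoid_shift z)),
      linear (@mul_m0_shift R m) & forall u : L2 m, N (mul_m0_shift u) <= 1 * N u].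
Proof.
have [|f sf|_ h1 h2 h3] := @L2_operator _ _ _ _ R m m
  (fun f z => m0 (coord z 0) * f (solenoid_shift z)) 1 ler01.
- by move=> a f g; apply/funext => z; rewrite /= mulrDr mulrCA.
- split; first exact: (cmeasurableM (cmeasurable_m0 R) (cmeasurable_shift sf.1)).
  rewrite expr1n mul1e.
  have mg := measurable_sqr_norm sf.1; have g0 z := sqr_norm_ge0 f z.
  rewrite -(integral_shift m_fin (fourier_rec m_coef m_coef0) mg g0).
  rewrite le_eqVlt; apply/orP; left; apply/eqP; apply: eq_integral => z _.
  by rewrite /sqr_norm normcM exprMn.
by split.
Qed.

Lemma mul_chi_class k p l q : mul_chi k p (chi_class m (l, q)) =
  chi_class m (l * 3 ^+ p + k * 3 ^+ q, (q + p)%N).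
Proof.
rewrite -[LHS]/(mulL2 (chi k p) _) mulL2_class//; last exact: cbounded_chi.
congr L2class; apply/funext => z.
by rewrite chiM addrC addnC -!natz !natrX.
Qed.

(** The exact counterpart of [dilation_cell]: chi_l o S is the character of 3 l, and m_0 is (1 +
    chi_2) / sqrt 2. *)
Lemma mul_m0_shift_chi k p : mul_m0_shift (chi_class m (k, p)) =
  ((Num.sqrt 2)^-1)%:C *: (chi_class m (3 * k, p) + chi_class m (3 * k + 2 * 3 ^+ p, p)).
Proof.
have [opE _ _] := mul_m0_shift_operator.
rewrite /chi_class opE// -L2classD// -L2classZ; last exact: square_integrableD.
congr L2class; apply/funext => z; rewrite -[RHS]/(_ * (_ + _)) /=.
have -> : chi k p (solenoid_shift z) = chi (3 * k) p z.
  by rewrite chi_lift chi_shift mulrC.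
rewrite /m0 (_ : coord z 0 ^+ 2 = chi 2 0 z)//.
have -> : chi (3 * k + 2 * 3 ^+ p) p z = chi (3 * k) p z * chi 2 0 z.
  by rewrite chiM addn0 expn0 mulr1 -natz natrX.
rewrite fmorphV /=; ring.
Qed.

(** Induction on the exponent of the denominator. Overlaps are at most the measure 1 of C, so
    finite, and the recursion can be read in the reals. *)
Lemma fourier_overlap k q : fourier m k q = (fine (overlap (triadic R k q)))%:C.
Proof.
have fin (l : R) : overlap l \is a fin_num.
  have lC : (overlap l <= H (@Cantor_set R))%E.
    by apply: (@le_hausdorff R) => x [[]].
  rewrite ge0_fin_numE; last exact: hausdorff_fractal_ge0.
  by rewrite (le_lt_trans lC)// hausdorff_fractal_Cantor ltry.
elim: q k => [|q ih] k.
  by rewrite (fourier_int m_coef m_coef0) /triadic expr0 divr1 overlap_int; case: (_ == _).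
rewrite (fourier_rec m_coef m_coef0) overlap_rec !ih.
move: (fin (triadic R k q)) (fin (triadic R (k + 2 * 3 ^+ q) q))
  (fin (triadic R (k - 2 * 3 ^+ q) q)).
move: (overlap _) (overlap _) (overlap _) => [a| |] [b| |] [c| |] //= _ _ _.
by rewrite rmorphD rmorphM rmorphD fmorphV rmorph_nat.
Qed.

Lemma cell_chi_gram i j : L2dot (cell_class R i) (cell_class R j) =
  L2dot (chi_class m i) (chi_class m j).
Proof.
case: i j => [k p] [l q].
rewrite L2dot_indic; [|exact: measurable_cell|exact: measurable_cell|exact: cell_fin|exact: cell_fin].
rewrite L2dotE//= (_ : (fun z => _) = chi (k * 3 ^+ q - l * 3 ^+ p) (p + q)); last first.
  by apply/funext => z; rewrite conj_chi chiM -!natz !natrX mulNr.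
rewrite -[RHS]/(fourier _ _ _) fourier_overlap; congr ((fine _)%:C).
(* Moving the first cell back to C leaves the overlap at the difference of the two translations. *)
rewrite /overlap -(hausdorff_fractal_translate k p) -mulNr -triadicD.
congr (H _); have e x : x + triadic R k p - triadic R k p = x by rewrite addrK.
have e' x : x + triadic R k p - triadic R l q = x + (triadic R k p + triadic R (- l) q).
  by rewrite /triadic intrN mulNr addrA.
by apply/seteqP; split=> x; rewrite /cell /= !expr0 !mul1r e e'.
Qed.
End solenoid_operators.

(** * The unitary operator *)

Section fourier_transform.
Context (R : realType) (m : {measure set (borel_solenoid R) -> \bar R}).
Local Notation H := (@hausdorff_fractal R).
Local Notation one := (L2class m (cst 1)).
Local Notation chi_C := (L2class H (fun x => (\1_(@Cantor_set R) x)%:C)).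

Lemma linear_comp (U V W : lmodType R[i]) (A : U -> V) (B : V -> W) :
  linear A -> linear B -> linear (B \o A).
Proof. by move=> lA lB a u v /=; rewrite lA lB. Qed.

Lemma linear_additive (U V : lmodType R[i]) (A : U -> V) : linear A ->
  (forall u v, A (u + v) = A u + A v) /\ forall a u, A (a *: u) = a *: A u.
Proof.
move=> lA; have A0 : A 0 = 0.
  by have /eqP := lA 1 0 0;
    rewrite !scale1r addr0 -subr_eq0 opprD addrA subrr sub0r oppr_eq0 => /eqP.
split=> [u v|a u]; first by have := lA 1 u v; rewrite !scale1r.
by have := lA a u 0; rewrite !addr0 A0 addr0.
Qed.

Lemma chi_C_cell : chi_C = cell_class R (0, 0%N).
Proof.
congr L2class; apply/funext => x; rewrite /cindic; congr ((\1_(_ : set R) x)%:C).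
by apply/seteqP; split=> y; rewrite /cell /= /triadic mul0r subr0 expr0 mul1r.
Qed.

Lemma one_chi : one = chi_class m (0, 0%N).
Proof. by congr L2class; apply/funext => z; rewrite chi0. Qed.

Lemma translation_chi_C k p : translation (triadic R k p) chi_C = cell_class R (k, p).
Proof. by rewrite chi_C_cell translation_cell mul0r add0r expr0 mulr1. Qed.

Lemma mul_chi_one (m_fin : (m setT < +oo)%E) k p : mul_chi k p one = chi_class m (k, p).
Proof. by rewrite one_chi (mul_chi_class m_fin) mul0r add0r expr0 mulr1. Qed.

End fourier_transform.

Theorem corollary5p8 (R : realType) (m : probability (borel_solenoid R) R)
  (m_coef : forall (k : int) (q p : nat) (d : nat -> int),
     even_expansion (triadic R k q) p d ->
     fourier m k q = (2 `^ (- (\sum_(j < p.+1) `|d j|%N)%:R / 2))%:C)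
  (m_coef0 : forall (k : int) (q : nat),
     ~ (exists p d, even_expansion (triadic R k q) p d) ->
     fourier m k q = 0) :
  exists! F : L2 (@hausdorff_fractal R) -> L2 m,
    unitary F /\
    exists2 Finv : L2 m -> L2 (@hausdorff_fractal R),
      cancel F Finv /\ cancel Finv F &
      [/\ forall (k : int) (p : nat) (f : L2 m),
            F (translation (triadic R k p) (Finv f)) = mul_chi k p f,
          forall f : L2 m, F (dilation (Finv f)) = mul_m0_shift f &
          F (L2class (@hausdorff_fractal R)
               (fun x => (\1_(@Cantor_set R) x)%:C)) = L2class m (cst 1)].
Proof.
have m_fin : (m setT < +oo)%E by rewrite probability_setT ltry.
have dense1 := @cell_dense R; have hm := hilbert_L2 m.
have iso_bound (F : L2 (@hausdorff_fractal R) -> L2 m) : unitary F ->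
    forall u, hnorm (@L2dot _ _ _ m) (F u) <= 1 * hnorm (@L2dot _ _ _ (@hausdorff_fractal R)) u.
  by move=> [_ _ dF] u; rewrite /hnorm dF mul1r.
have [F [lF bF dF FE]] := gram_unitary (hilbert_L2 (@hausdorff_fractal R)) hm
  (cell_chi_gram m_fin m_coef m_coef0) dense1 (chi_dense m_fin).
have uF : unitary F by [].
have [G FG GF] := bF.
have [FD FZ] := linear_additive lF.
exists F; split.
  split=> //; exists G => //; split.
  (* Writing [f] as [F (G f)] turns the relation into an equality of two bounded operators on the
     fractal side, which is checked on the cells. *)
  - move=> k p f; rewrite -{2}[f]GF; move: (G f).
    have [_ lT bT] := translation_operator R k p.
    have lM : linear (@mul_chi R m k p) by exact: (mulL2_linear (cbounded_chi R k p)).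
    have bM u : hnorm (@L2dot _ _ _ m) (mul_chi k p u) <= 1 * hnorm (@L2dot _ _ _ m) u.
      apply: (@mulL2_bound _ _ _ m (chi k p) 1); first exact: cmeasurable_chi.
      by move=> z; rewrite normc_chi.
    apply: (bounded_linear_eq (a := 1) (b := 1) hm (linear_comp lT lF)
      (linear_comp lF lM) _ _ dense1).
    + by move=> u; rewrite (le_trans (iso_bound F uF _))// !mul1r -[leRHS]mul1r.
    + by move=> u; rewrite (le_trans (bM _))// mul1r iso_bound.
    + by move=> [l q] /=; rewrite translation_cell !FE (mul_chi_class m_fin).
  - move=> f; rewrite -{2}[f]GF; move: (G f).
    have [_ lU bU] := dilation_operator R.
    have [_ lM bM] := mul_m0_shift_operator m_fin m_coef m_coef0.
    apply: (bounded_linear_eq (a := 1) (b := 1) hm (linear_comp lU lF)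
      (linear_comp lF lM) _ _ dense1).
    + by move=> u; rewrite (le_trans (iso_bound F uF _))// !mul1r -[leRHS]mul1r.
    + by move=> u; rewrite (le_trans (bM _))// mul1r iso_bound.
    + by move=> [k p] /=; rewrite dilation_cell FZ FD !FE (mul_m0_shift_chi m_fin m_coef m_coef0).
  - by rewrite chi_C_cell FE one_chi.
(* The relations force F' T_l chi_C = chi_l F' chi_C = chi_l, so [F'] agrees with [F] on a family
   with dense span. *)
move=> F' [uF' [G' [FG' GF'] [F'T _ F'C]]]; apply/funext.
have [lF' _ _] := uF'.
apply: (bounded_linear_eq hm lF lF' (iso_bound F uF) (iso_bound F' uF') dense1) => -[k p].
rewrite FE -translation_chi_C -(FG' (L2class _ _)) F'T.
by rewrite F'C (mul_chi_one m_fin).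
Qed.
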